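(* Let $c>0$ be real, $a\in\mathbb{C}\setminus\{0,-1,-2,\ldots\}$, and $s\in\mathbb{C}$ with $\Re(s)>1$. For every $x\in\mathbb{R}$ with $|x|\le 2c$, $$s\sum_{n=0}^{\infty}\frac{1}{(a+n)^{s+1}}\cos\frac{(a+n)\pi x}{c}+\frac{\pi x}{c}\sum_{n=0}^{\infty}\frac{1}{(a+n)^s}\sin\frac{(a+n)\pi x}{c}=\sum_{k=0}^{\infty}(-1)^k\frac{s-2k}{(2k)!}\left(\frac{\pi x}{c}\right)^{2k}\zeta(s+1-2k,a),$$ where, if $s=2k$ for some $k$, the product $(s-2k)\zeta(s+1-2k,a)$ is understood as $\lim_{w\to0}w\,\zeta(1+w,a)=1$.
   Context: $\zeta(s,a)$ is the Hurwitz zeta function: the meromorphic continuation in $s$ of $\sum_{n\ge0}(n+a)^{-s}$ ($\Re(s)>1$), with a simple pole of residue $1$ at $s=1$; complex powers are principal. *)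

(* Defs.v *)
From Stdlib Require Import Reals Factorial ClassicalEpsilon.
From Coquelicot Require Export Coquelicot.
Open Scope R_scope.
Open Scope C_scope.

Definition Cexp (z : C) : C :=
  ((exp (Re z) * cos (Im z))%R, (exp (Re z) * sin (Im z))%R).

Definition Ccos (z : C) : C := (Cexp (Ci * z) + Cexp (- (Ci * z))) / 2.

Definition Csin (z : C) : C := (Cexp (Ci * z) - Cexp (- (Ci * z))) / (2 * Ci).

(* Principal argument, in (-PI, PI]; only meaningful for z <> 0. *)
Definition Carg (z : C) : R :=
  if Rle_dec 0 (Im z) then acos (Re z / Cmod z) else (- acos (Re z / Cmod z))%R.

Definition Cln (z : C) : C := (ln (Cmod z), Carg z).

(* Principal power z ^ w = exp (w Log z); only meaningful for z <> 0.  The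
   notation z ^ n of Coquelicot is the power with a natural exponent. *)
Definition Cpower (z w : C) : C := Cexp (w * Cln z).

(* F is the meromorphic continuation to the complex plane of
   s |-> \sum_n (n + a)^(-s): its only singularity is a simple pole at 1,
   with residue 1.  The value F 1 is irrelevant. *)
Definition is_hurwitz_zeta (a : C) (F : C -> C) : Prop :=
  (forall s : C, (1 < Re s)%R ->
     is_series (K := C_AbsRing) (V := C_NormedModule)
       (fun n : nat => Cpower (RtoC (INR n) + a) (- s)) (F s)) /\
  (forall s : C, s <> 1 -> ex_derive (K := C_AbsRing) (V := C_NormedModule) F s) /\
  filterlim (fun s : C => (s - 1) * F s)
    (locally' (T := C_UniformSpace) (RtoC 1)) (locally (T := C_UniformSpace) (RtoC 1)).

(* Such an F is unique outside 1, by the identity theorem. *)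
Definition hurwitz_zeta (s a : C) : C :=
  epsilon (inhabits (fun _ : C => RtoC 0)) (is_hurwitz_zeta a) s.

(* The product (s - 2k) zeta(s + 1 - 2k, a), extended by its limit to s = 2k. *)
Definition hurwitz_factor (s a : C) (k : nat) : C :=
  if Ceq_dec s (RtoC (INR (2 * k)))
  then C_lim (fun w : C => w * hurwitz_zeta (1 + w) a) 0
  else (s - RtoC (INR (2 * k))) * hurwitz_zeta (s + 1 - RtoC (INR (2 * k))) a.

(* Main.v *)
Require Import Defs.
From Stdlib Require Import Reals Factorial Lra Lia Psatz ClassicalEpsilon.
From Coquelicot Require Import Coquelicot.
Open Scope R_scope.
Open Scope C_scope.

(** Put [phi z = z^(-s) cos (theta z)] with [theta = pi x / c].  The summand on
    the left is [- phi'(a + n)], and the residue theorem for the kernel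
    [(pi/2) / sin^2 (pi w)] on the strip [|Re w| <= 1/2] gives
      [sum_n - phi'(b + n) = int phi(b - 1/2 + i t) (pi/2) / cosh^2 (pi t) dt]
    for every [phi] of moderate growth.  Applied to [z^(1-s)] the same formula
    reads [(s-1) zeta(s,b) = int (b - 1/2 + i t)^(1-s) (pi/2) / cosh^2 (pi t) dt],
    whose right side is entire in [s]: this is the continuation.  Expanding the
    cosine under the integral yields the series on the right.  At
    [|theta| = 2 pi] the growth of [cosh (theta t)] cancels the decay of the
    kernel exactly, and [|t|^(- Re s)] is an integrable dominating function
    because [Re s > 1].  A general [a] is shifted to [b = a + N]; the [N] terms
    split off are handled by the power series of [cos] and [sin]. *)

(** * Complex derivatives *)

(** The kernel has a double pole, so it sums derivatives, and both sides are of that kind: the left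
    summand is a derivative as it stands, and [z^(1-s)] yields [(s-1) z^(-s)]. Hence the product
    [(s-1) zeta(s,b)], which has no pole, appears as a single line integral. Its value at [s = 1] is
    the total mass [1] of the weight on the line, which is why the convention at [s = 2k] holds
    without a separate argument.

    [hurwitz_zeta] is chosen by its specification, so the explicit continuation has to be matched
    with it by uniqueness. The identity theorem needed for this is obtained without power series,
    from mean values over circles.

    The shift to [b] serves [Re b >= 3/2]: the line of integration then lies in [Re z >= 1], where
    the principal logarithm is holomorphic and powers are controlled. The split-off terms may lie on
    the branch cut, but only their values matter, never a derivative in [z].

    All integrands are bounded by [B (1 + |t|)^(-tau)] with [tau > 1]. Tails are then explicit, and
    dominated convergence reduces to uniform convergence on bounded intervals. *)

Notation is_Cderive f z l :=
  (is_derive (K := C_AbsRing) (V := C_NormedModule) (f : C -> C) (z%C : C) (l%C : C)).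
Notation Clocally := (locally (T := C_UniformSpace)).

Lemma locally_Cmod (z : C) (P : C -> Prop) :
  Clocally z P <->
  exists d : R, (0 < d)%R /\ forall w : C, (Cmod (w - z) < d)%R -> P w.
Proof.
rewrite locally_C; split.
- intros [d Hd]; exists d; split; [apply cond_pos|]; intros w Hw; apply Hd; exact Hw.
- intros [d [Hd H]]; exists (mkposreal d Hd); intros w Hw; apply H; exact Hw.
Qed.

Lemma filterlim_Cmod {T : Type} (F : (T -> Prop) -> Prop) {FF : Filter F}
  (f : T -> C) (l : C) :
  filterlim f F (Clocally l) <->
  forall e : R, (0 < e)%R -> F (fun x => (Cmod (f x - l) < e)%R).
Proof.
split.
- intros H e He. apply (H (fun y => (Cmod (y - l) < e)%R)).
  apply locally_Cmod; exists e; auto.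
- intros H P HP. apply locally_Cmod in HP; destruct HP as [d [Hd HP]].
  unfold filtermap. generalize (H d Hd); apply filter_imp; auto.
Qed.

Lemma is_Cderive_Cmod (f : C -> C) (z l : C) :
  is_Cderive f z l <->
  forall e : R, (0 < e)%R -> exists d : R, (0 < d)%R /\
  forall w : C, (Cmod (w - z) < d)%R ->
  (Cmod (f w - f z - l * (w - z)) <= e * Cmod (w - z))%R.
Proof.
split.
- intros [_ H] e He.
  specialize (H z (fun P HP => HP) (mkposreal e He)).
  destruct H as [d H].
  exists d; split; [apply cond_pos|]. intros w Hw. specialize (H w Hw).
  replace (l * (w - z)) with ((w - z) * l) by ring. exact H.
- intros H. split.
  { apply is_linear_scal_l. }
  intros y Hy e.
  assert (y = z) as ->.
  { symmetry; apply (is_filter_lim_locally_unique (V := AbsRing_NormedModule C_AbsRing)); exact Hy. }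
  destruct (H e (cond_pos e)) as [d [Hd H']].
  exists (mkposreal d Hd); intros w Hw. specialize (H' w Hw).
  replace (l * (w - z)) with ((w - z) * l) in H' by ring. exact H'.
Qed.

(* Coquelicot states the product and chain rules for [C] as a module over itself, whose
   uniform structure differs from the product structure of [C_NormedModule]. *)
Lemma is_Cderive_Ring (f : C -> C) (z l : C) :
  is_Cderive f z l <-> is_derive (K := C_AbsRing) (V := AbsRing_NormedModule C_AbsRing) f z l.
Proof.
rewrite is_Cderive_Cmod; split.
- intros H. split.
  { apply is_linear_scal_l. }
  intros y Hy e.
  assert (y = z) as ->.
  { symmetry; apply (is_filter_lim_locally_unique (V := AbsRing_NormedModule C_AbsRing)); exact Hy. }
  destruct (H e (cond_pos e)) as [d [Hd H']].
  exists (mkposreal d Hd); intros w Hw. specialize (H' w Hw).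
  replace (l * (w - z)) with ((w - z) * l) in H' by ring. exact H'.
- intros [_ H] e He.
  specialize (H z (fun P HP => HP) (mkposreal e He)).
  destruct H as [d H].
  exists d; split; [apply cond_pos|]. intros w Hw. specialize (H w Hw).
  replace (l * (w - z)) with ((w - z) * l) by ring. exact H.
Qed.

Lemma is_Cderive_const (c z : C) : is_Cderive (fun _ => c) z 0.
Proof. apply (is_derive_const (K := C_AbsRing) (V := C_NormedModule)). Qed.

Lemma is_Cderive_id (z : C) : is_Cderive (fun w => w) z 1.
Proof. apply is_Cderive_Ring. apply (is_derive_id (K := C_AbsRing)). Qed.

Lemma is_Cderive_plus (f g : C -> C) (z l m : C) :
  is_Cderive f z l -> is_Cderive g z m -> is_Cderive (fun w => f w + g w) z (l + m).
Proof. apply (is_derive_plus (K := C_AbsRing) (V := C_NormedModule)). Qed.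

Lemma is_Cderive_opp (f : C -> C) (z l : C) :
  is_Cderive f z l -> is_Cderive (fun w => - f w) z (- l).
Proof. apply (is_derive_opp (K := C_AbsRing) (V := C_NormedModule)). Qed.

Lemma is_Cderive_minus (f g : C -> C) (z l m : C) :
  is_Cderive f z l -> is_Cderive g z m -> is_Cderive (fun w => f w - g w) z (l - m).
Proof. apply (is_derive_minus (K := C_AbsRing) (V := C_NormedModule)). Qed.

Lemma is_Cderive_mult (f g : C -> C) (z l m : C) :
  is_Cderive f z l -> is_Cderive g z m ->
  is_Cderive (fun w => f w * g w) z (l * g z + f z * m).
Proof.
rewrite !is_Cderive_Ring; intros Hf Hg.
apply (is_derive_mult (K := C_AbsRing)); auto. apply Cmult_comm.
Qed.

Lemma is_Cderive_comp (f g : C -> C) (z l m : C) :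
  is_Cderive f (g z) l -> is_Cderive g z m -> is_Cderive (fun w => f (g w)) z (m * l).
Proof.
rewrite (is_Cderive_Ring g); intros Hf Hg.
apply (is_derive_comp (K := C_AbsRing) (V := C_NormedModule)); auto.
Qed.

Lemma is_Cderive_eq (f : C -> C) (z l m : C) :
  is_Cderive f z l -> l = m -> is_Cderive f z m.
Proof. now intros H <-. Qed.

Lemma is_Cderive_ext (f g : C -> C) (z l : C) :
  (forall w, f w = g w) -> is_Cderive f z l -> is_Cderive g z l.
Proof. apply (is_derive_ext (K := C_AbsRing) (V := C_NormedModule)). Qed.

Lemma is_Cderive_continuous (f : C -> C) (z l : C) :
  is_Cderive f z l -> continuous (T := C_UniformSpace) (U := C_UniformSpace) f z.
Proof.
intros H. apply filterlim_Cmod; [apply locally_filter|]. intros e He.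
apply is_Cderive_Cmod with (e := 1%R) in H; [|lra].
destruct H as [d [Hd H]].
apply locally_Cmod.
assert (Hm : (0 < Cmod l + 1)%R) by (generalize (Cmod_ge_0 l); lra).
exists (Rmin d (e / (Cmod l + 1))). split.
{ apply Rmin_pos; auto. apply Rdiv_lt_0_compat; auto. }
intros w Hw.
assert (H1 := H w (Rlt_le_trans _ _ _ Hw (Rmin_l _ _))).
assert (H2 := Rlt_le_trans _ _ _ Hw (Rmin_r _ _)).
replace (f w - f z) with ((f w - f z - l * (w - z)) + l * (w - z)) by ring.
eapply Rle_lt_trans. apply Cmod_triangle. rewrite (Cmod_mult l).
apply Rlt_le_trans with (e / (Cmod l + 1) * (Cmod l + 1))%R.
- generalize (Cmod_ge_0 l) (Cmod_ge_0 (w - z)); nra.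
- right; field; lra.
Qed.

Lemma is_Cderive_inv (z : C) : z <> 0 -> is_Cderive (fun w => / w) z (- / (z * z)).
Proof.
intros Hz. apply is_Cderive_Cmod. intros e He.
assert (Hm := proj1 (Cmod_gt_0 z) Hz).
set (m := Cmod z) in *.
exists (Rmin (m / 2) (e * (m * m * m) / 2)). split.
{ apply Rmin_pos; [lra|]. assert (0 < m * m * m)%R by (repeat apply Rmult_lt_0_compat; auto).
  assert (0 < e * (m * m * m))%R by (apply Rmult_lt_0_compat; auto). lra. }
intros w Hw.
assert (H1 := Rlt_le_trans _ _ _ Hw (Rmin_l _ _)).
assert (H2 := Rlt_le_trans _ _ _ Hw (Rmin_r _ _)).
assert (Hwm : (m / 2 < Cmod w)%R).
{ assert (m <= Cmod w + Cmod (w - z))%R.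
  { unfold m. replace z with (w + - (w - z)) at 1 by ring.
    eapply Rle_trans; [apply Cmod_triangle|]. rewrite Cmod_opp. lra. }
  lra. }
assert (Hw0 : w <> 0) by (apply Cmod_gt_0; lra).
replace (/ w - / z - - / (z * z) * (w - z)) with ((w - z) * ((w - z) / (z * z * w)))
  by (field; auto).
rewrite (Cmod_mult (w - z) (_ / _)), (Rmult_comm e).
apply Rmult_le_compat_l; [apply Cmod_ge_0|].
rewrite Cmod_div by (repeat apply Cmult_neq_0; auto).
rewrite !Cmod_mult. fold m.
apply Rle_div_l. { apply Rmult_lt_0_compat; [nra|lra]. }
apply Rle_trans with (e * (m * m * m) / 2)%R; [lra|].
replace (e * (m * m * m) / 2)%R with (e * (m * m * (m / 2)))%R by field.
apply Rmult_le_compat_l; [lra|]. apply Rmult_le_compat_l; [nra|lra].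
Qed.

(** * Continuity and integrals of complex-valued functions *)

Notation Ccontinuous f x := (continuous (U := C_UniformSpace) f x).
Notation is_CInt f a b l := (is_RInt (V := C_R_NormedModule) (f : R -> C) a%R b%R (l%C : C)).
Notation CInt f a b := (RInt (V := C_R_CompleteNormedModule) (f : R -> C) a%R b%R : C).

Lemma Ccontinuous_pair {T : UniformSpace} (f g : T -> R) (x : T) :
  continuous f x -> continuous g x -> Ccontinuous (fun y => (f y, g y)) x.
Proof.
intros Hf Hg. apply filterlim_Cmod; [apply locally_filter|]. intros e He.
assert (He2 : (0 < e / 2)%R) by lra.
generalize (proj1 (filterlim_locally f (f x)) Hf (mkposreal _ He2))
 (proj1 (filterlim_locally g (g x)) Hg (mkposreal _ He2)).
intros H1 H2. generalize (filter_and _ _ H1 H2). apply filter_imp.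
intros y [h1 h2]. unfold ball in *; simpl in *; unfold AbsRing_ball in *; simpl in *.
unfold abs, minus, plus, opp in *; simpl in *.
eapply Rle_lt_trans; [apply Cmod_2Rmax|]. simpl.
assert (sqrt 2 < 2)%R.
{ rewrite <- (sqrt_square 2) at 2 by lra. apply sqrt_lt_1; lra. }
apply Rlt_le_trans with (2 * (e / 2))%R; [|lra].
apply Rmult_le_0_lt_compat; auto. apply sqrt_pos.
apply Rle_trans with (2 := Rmax_l _ _), Rabs_pos.
apply Rmax_lub_lt; assumption.
Qed.

Lemma continuous_Cfst {T : UniformSpace} (f : T -> C) (x : T) :
  Ccontinuous f x -> continuous (fun y => fst (f y)) x.
Proof. intros H; apply (continuous_comp f fst); auto. apply continuous_fst. Qed.

Lemma continuous_Csnd {T : UniformSpace} (f : T -> C) (x : T) :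
  Ccontinuous f x -> continuous (fun y => snd (f y)) x.
Proof. intros H; apply (continuous_comp f snd); auto. apply continuous_snd. Qed.

Lemma Ccontinuous_plus {T : UniformSpace} (f g : T -> C) (x : T) :
  Ccontinuous f x -> Ccontinuous g x -> Ccontinuous (fun y => f y + g y) x.
Proof.
intros Hf Hg. apply Ccontinuous_pair; apply (continuous_plus (V := R_NormedModule));
 auto using continuous_Cfst, continuous_Csnd.
Qed.

Lemma Ccontinuous_opp {T : UniformSpace} (f : T -> C) (x : T) :
  Ccontinuous f x -> Ccontinuous (fun y => - f y) x.
Proof.
intros Hf. apply Ccontinuous_pair; apply (continuous_opp (V := R_NormedModule));
 auto using continuous_Cfst, continuous_Csnd.
Qed.

Lemma Ccontinuous_minus {T : UniformSpace} (f g : T -> C) (x : T) :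
  Ccontinuous f x -> Ccontinuous g x -> Ccontinuous (fun y => f y - g y) x.
Proof. intros Hf Hg. apply Ccontinuous_plus; auto. now apply Ccontinuous_opp. Qed.

Lemma Ccontinuous_mult {T : UniformSpace} (f g : T -> C) (x : T) :
  Ccontinuous f x -> Ccontinuous g x -> Ccontinuous (fun y => f y * g y) x.
Proof.
intros Hf Hg. apply Ccontinuous_pair;
[apply (continuous_minus (V := R_NormedModule))|apply (continuous_plus (V := R_NormedModule))];
apply (continuous_mult (K := R_AbsRing));
 auto using continuous_Cfst, continuous_Csnd.
Qed.

Lemma Ccontinuous_const {T : UniformSpace} (c : C) (x : T) : Ccontinuous (fun _ : T => c) x.
Proof. apply continuous_const. Qed.

Lemma Ccontinuous_RtoC {T : UniformSpace} (f : T -> R) (x : T) :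
  continuous f x -> Ccontinuous (fun y => RtoC (f y)) x.
Proof. intros H; apply Ccontinuous_pair; auto. apply continuous_const. Qed.

Lemma Ccontinuous_comp {T : UniformSpace} (f : C -> C) (g : T -> C) (x : T) :
  Ccontinuous g x -> continuous (T := C_UniformSpace) (U := C_UniformSpace) f (g x) ->
  Ccontinuous (fun y => f (g y)) x.
Proof. intros Hg Hf. apply (continuous_comp g f); auto. Qed.

Lemma continuous_Cmod {T : UniformSpace} (f : T -> C) (x : T) :
  Ccontinuous f x -> continuous (fun y => Cmod (f y)) x.
Proof.
intros H. apply filterlim_locally; intros e.
generalize (proj1 (filterlim_Cmod _ f (f x)) H e (cond_pos e)).
apply filter_imp. intros y Hy. unfold ball; simpl; unfold AbsRing_ball; simpl.
unfold abs, minus, plus, opp; simpl.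
eapply Rle_lt_trans; [|exact Hy]. apply Rabs_le.
assert (H1 := Cmod_triangle (f y - f x) (f x)).
assert (H2 := Cmod_triangle (f x - f y) (f y)).
replace (f y - f x + f x) with (f y) in H1 by ring.
replace (f x - f y + f y) with (f x) in H2 by ring.
replace (f x - f y) with (- (f y - f x)) in H2 by ring. rewrite Cmod_opp in H2. lra.
Qed.

Lemma is_CInt_CInt (f : R -> C) (a b : R) :
  (forall t : R, (Rmin a b <= t <= Rmax a b)%R -> Ccontinuous f t) ->
  is_CInt f a b (CInt f a b).
Proof.
intros H. apply (RInt_correct (V := C_R_CompleteNormedModule)).
apply (ex_RInt_continuous (V := C_R_CompleteNormedModule)). exact H.
Qed.

Lemma CInt_unique (f : R -> C) (a b : R) (l : C) : is_CInt f a b l -> CInt f a b = l.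
Proof. apply (is_RInt_unique (V := C_R_CompleteNormedModule)). Qed.

(** The integral takes values in a real vector space, where a complex factor is not a scalar; it is
    moved out through real and imaginary parts. *)
Lemma is_CInt_mult (c : C) (f : R -> C) (a b : R) (l : C) :
  is_CInt f a b l -> is_CInt (fun t => c * f t) a b (c * l).
Proof.
intros H.
assert (H1 := is_RInt_fct_extend_fst (U := R_NormedModule) (V := R_NormedModule) f a b l H).
assert (H2 := is_RInt_fct_extend_snd (U := R_NormedModule) (V := R_NormedModule) f a b l H).
apply (is_RInt_fct_extend_pair (U := R_NormedModule) (V := R_NormedModule)); simpl.
- apply (is_RInt_minus (V := R_NormedModule)); apply (is_RInt_scal (V := R_NormedModule)); auto.
- apply (is_RInt_plus (V := R_NormedModule)); apply (is_RInt_scal (V := R_NormedModule)); auto.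
Qed.

Lemma is_CInt_plus (f g : R -> C) (a b : R) (l m : C) :
  is_CInt f a b l -> is_CInt g a b m -> is_CInt (fun t => f t + g t) a b (l + m).
Proof. apply (is_RInt_plus (V := C_R_NormedModule)). Qed.

Lemma is_CInt_minus (f g : R -> C) (a b : R) (l m : C) :
  is_CInt f a b l -> is_CInt g a b m -> is_CInt (fun t => f t - g t) a b (l - m).
Proof. apply (is_RInt_minus (V := C_R_NormedModule)). Qed.

Lemma is_CInt_ext (f g : R -> C) (a b : R) (l : C) :
  (forall t, (Rmin a b < t < Rmax a b)%R -> f t = g t) -> is_CInt f a b l -> is_CInt g a b l.
Proof. apply (is_RInt_ext (V := C_R_NormedModule)). Qed.

Lemma is_CInt_Chasles (f : R -> C) (a b c : R) (l m : C) :
  is_CInt f a b l -> is_CInt f b c m -> is_CInt f a c (l + m).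
Proof. apply (is_RInt_Chasles (V := C_R_NormedModule)). Qed.

Lemma is_CInt_RtoC (f : R -> R) (a b l : R) :
  is_RInt f a b l -> is_CInt (fun t => RtoC (f t)) a b (RtoC l).
Proof.
intros H.
apply (is_RInt_fct_extend_pair (U := R_NormedModule) (V := R_NormedModule)); simpl; auto.
generalize (is_RInt_const (V := R_NormedModule) a b 0%R).
unfold scal; simpl; unfold mult; simpl. now rewrite Rmult_0_r.
Qed.

Lemma is_CInt_le (f : R -> C) (g : R -> R) (a b : R) (l : C) (m : R) :
  (a <= b)%R -> (forall t : R, (a <= t <= b)%R -> (Cmod (f t) <= g t)%R) ->
  is_CInt f a b l -> is_RInt g a b m -> (Cmod l <= m)%R.
Proof.
intros Hab H Hf Hg. rewrite Cmod_norm.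
apply (norm_RInt_le (V := C_R_NormedModule)) with f g a b; auto.
intros x Hx. change (norm (f x)) with (@norm R_AbsRing C_R_NormedModule (f x)).
rewrite <- Cmod_norm. auto.
Qed.

Lemma is_CInt_le_const (f : R -> C) (M a b : R) (l : C) :
  (a <= b)%R -> (forall t : R, (a <= t <= b)%R -> (Cmod (f t) <= M)%R) ->
  is_CInt f a b l -> (Cmod l <= (b - a) * M)%R.
Proof.
intros Hab H Hf. apply is_CInt_le with f (fun _ => M) a b; auto.
apply (is_RInt_const (V := R_NormedModule)).
Qed.

Lemma is_CInt_derive (f df : R -> C) (a b : R) :
  (forall t, (Rmin a b <= t <= Rmax a b)%R ->
     is_derive (K := R_AbsRing) (V := C_R_NormedModule) f t (df t)) ->
  (forall t, (Rmin a b <= t <= Rmax a b)%R -> Ccontinuous df t) ->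
  is_CInt df a b (f b - f a).
Proof. apply (is_RInt_derive (V := C_R_CompleteNormedModule)). Qed.

(** The passage from complex to real differentiation: through it the fundamental theorem of calculus
    in a real variable applies to holomorphic functions on segments. *)
Lemma is_derive_comp_line (f : C -> C) (p v : C) (t : R) (l : C) :
  is_Cderive f (p + v * RtoC t) l ->
  is_derive (K := R_AbsRing) (V := C_R_NormedModule) (fun u : R => f (p + v * RtoC u)) t (v * l).
Proof.
intros H. rewrite is_Cderive_Cmod in H. split.
{ apply is_linear_scal_l. }
intros y Hy e.
assert (y = t) as ->.
{ symmetry; apply (is_filter_lim_locally_unique (V := R_NormedModule)); exact Hy. }
(* The [+ 1] keeps the tolerance and the radius meaningful when [v = 0]. *)
assert (Hm : (0 < Cmod v + 1)%R) by (generalize (Cmod_ge_0 v); lra).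
destruct (H (e / (Cmod v + 1))%R) as [d [Hd H']].
{ apply Rdiv_lt_0_compat; auto. apply cond_pos. }
assert (Hd' : (0 < d / (Cmod v + 1))%R) by (apply Rdiv_lt_0_compat; auto).
exists (mkposreal _ Hd'); intros u Hu.
change (Rabs (u - t) < d / (Cmod v + 1))%R in Hu.
assert (E : (p + v * u - (p + v * t)) = v * RtoC (u - t)) by (rewrite RtoC_minus; ring).
specialize (H' (p + v * u)). rewrite E in H'.
change (norm (minus u t)) with (Rabs (u - t)).
match goal with |- (norm ?z <= _)%R => replace (norm z) with (Cmod z) by apply Cmod_norm end.
change (Rle (Cmod ((f (p + v * u)%C - f (p + v * t)%C) - scal (V := C_R_NormedModule) (u - t)%R (v * l)%C)) (e * Rabs (u - t))).
rewrite scal_R_Cmult.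
replace (RtoC (u - t) * (v * l)) with (l * (v * RtoC (u - t))) by ring.
rewrite Cmod_mult, Cmod_R in H'.
assert (Hve : (Cmod v * Rabs (u - t) <= (Cmod v + 1) * Rabs (u - t))%R)
 by (apply Rmult_le_compat_r; [apply Rabs_pos|lra]).
eapply Rle_trans; [apply H'|].
- apply Rlt_div_r in Hu; lra.
- apply Rle_trans with (e / (Cmod v + 1) * ((Cmod v + 1) * Rabs (u - t)))%R.
  + apply Rmult_le_compat_l; auto. apply Rlt_le, Rdiv_lt_0_compat; auto. apply cond_pos.
  + right; field; lra.
Qed.

Lemma CInt_ext (f g : R -> C) (a b : R) :
  (forall t, f t = g t) -> CInt f a b = CInt g a b.
Proof.
intros H. apply (RInt_ext (V := C_R_CompleteNormedModule)). intros t _; apply H.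
Qed.

(** * The complex exponential *)

Lemma C_ext (z w : C) : Re z = Re w -> Im z = Im w -> z = w.
Proof. destruct z, w; simpl; intros; f_equal; auto. Qed.

Lemma Cmod_le_Rabs (z : C) : (Cmod z <= Rabs (Re z) + Rabs (Im z))%R.
Proof.
replace z with (RtoC (Re z) + RtoC (Im z) * Ci) at 1.
- eapply Rle_trans; [apply Cmod_triangle|]. rewrite Cmod_mult, !Cmod_R, Cmod_Ci. lra.
- apply C_ext; simpl; ring.
Qed.

Lemma im_le_Cmod (z : C) : (Rabs (Im z) <= Cmod z)%R.
Proof. eapply Rle_trans; [apply Rmax_r|apply Rmax_Cmod]. Qed.

Lemma Cmod2_eq (z : C) : (Cmod z * Cmod z = Re z * Re z + Im z * Im z)%R.
Proof. generalize (Cmod2_alt z); intros H; simpl in H. rewrite !Rmult_1_r in H. exact H. Qed.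

Lemma Cexp_plus (z w : C) : Cexp (z + w) = Cexp z * Cexp w.
Proof.
unfold Cexp. apply C_ext; simpl; unfold Re, Im; rewrite exp_plus, ?cos_plus, ?sin_plus; ring.
Qed.

Lemma Cexp_0 : Cexp 0 = 1.
Proof. unfold Cexp; apply C_ext; simpl; rewrite exp_0, ?cos_0, ?sin_0; ring. Qed.

Lemma Cmod_Cexp (z : C) : Cmod (Cexp z) = exp (Re z).
Proof.
unfold Cmod, Cexp; simpl.
replace (_ + _)%R with (Rsqr (exp (Re z))).
- apply sqrt_Rsqr. left; apply exp_pos.
- generalize (sin2_cos2 (Im z)). unfold Rsqr. intros H.
  replace (exp (Re z) * exp (Re z))%R with
   (exp (Re z) * exp (Re z) * (sin (Im z) * sin (Im z) + cos (Im z) * cos (Im z)))%R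
   by (rewrite H; ring). ring.
Qed.

Lemma Cexp_neq_0 (z : C) : Cexp z <> 0.
Proof. apply Cmod_gt_0. rewrite Cmod_Cexp. apply exp_pos. Qed.

Lemma Cexp_opp (z : C) : Cexp (- z) = / Cexp z.
Proof.
assert (H : Cexp z * Cexp (- z) = 1) by (rewrite <- Cexp_plus, Cplus_opp_r; apply Cexp_0).
assert (H0 := Cexp_neq_0 z).
transitivity (/ Cexp z * (Cexp z * Cexp (- z))); [field; auto|rewrite H; ring].
Qed.

Lemma one_minus_cos_bounds (y : R) : (0 <= 1 - cos y <= y * y / 2)%R.
Proof.
replace y with (2 * (y / 2))%R at 1 2 by field.
rewrite cos_2a_sin.
assert (H : (Rabs (sin (y / 2)) <= Rabs (y / 2))%R).
{ destruct (MVT_gen sin 0 (y / 2) cos) as [c [_ Hc]].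
  - intros x _; apply is_derive_sin.
  - intros x _; apply continuity_sin.
  - rewrite sin_0, !Rminus_0_r in Hc. rewrite Hc, Rabs_mult.
    assert (Rabs (cos c) <= 1)%R by (apply Rabs_le, COS_bound).
    generalize (Rabs_pos (y / 2)); nra. }
apply Rsqr_le_abs_1 in H. unfold Rsqr in H. nra.
Qed.

Lemma sin_sub_id_bound (y : R) : (Rabs (sin y - y) <= y * y / 2 * Rabs y)%R.
Proof.
destruct (MVT_gen sin 0 y cos) as [c [Hc' Hc]].
- intros x _; apply is_derive_sin.
- intros x _; apply continuity_sin.
- rewrite sin_0, !Rminus_0_r in Hc. rewrite Hc.
  replace (cos c * y - y)%R with (- (1 - cos c) * y)%R by ring.
  rewrite Rabs_mult, Rabs_Ropp. apply Rmult_le_compat_r; [apply Rabs_pos|].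
  generalize (one_minus_cos_bounds c); intros H. rewrite Rabs_pos_eq by lra.
  assert (c * c <= y * y)%R; [|lra].
  revert Hc'; unfold Rmin, Rmax; destruct (Rle_dec 0 y); nra.
Qed.

Lemma exp_sub_lin_bound (x : R) : (Rabs x <= / 2)%R -> (0 <= exp x - 1 - x <= 2 * (x * x))%R.
Proof.
intros H. apply Rabs_le_between in H.
generalize (exp_ineq1_le x) (exp_ineq1_le (- x)). rewrite exp_Ropp. intros H1 H2.
split; [lra|].
assert (H3 : (exp x * (1 - x) <= 1)%R).
{ apply Rmult_le_reg_l with (/ exp x)%R; [apply Rinv_0_lt_compat, exp_pos|].
  rewrite <- Rmult_assoc, Rinv_l by (generalize (exp_pos x); lra). lra. }
nra.
Qed.

(** Assembled from real estimates for [exp], [cos] and [sin]. Together with the functional equation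
    it yields the derivative of [Cexp] at every point. *)
Lemma Cexp_sub_lin_bound (z : C) :
  (Cmod z <= / 2)%R -> (Cmod (Cexp z - 1 - z) <= 4 * (Cmod z * Cmod z))%R.
Proof.
intros Hz. rewrite Cmod2_eq.
assert (Hx := Rle_trans _ _ _ (re_le_Cmod z) Hz).
assert (Hy := Rle_trans _ _ _ (im_le_Cmod z) Hz).
destruct z as [x y]; simpl in *.
eapply Rle_trans; [apply Cmod_le_Rabs|]. simpl.
assert (H1 := exp_sub_lin_bound x Hx).
assert (H2 := one_minus_cos_bounds y).
assert (H3 := sin_sub_id_bound y).
assert (Hx2 : (x * x = Rabs x * Rabs x)%R) by (rewrite <- Rabs_mult, Rabs_pos_eq; nra).
assert (Hy2 : (y * y = Rabs y * Rabs y)%R) by (rewrite <- Rabs_mult, Rabs_pos_eq; nra).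
assert (H4 : (Rabs (exp x - 1) <= 2 * Rabs x)%R).
{ replace (exp x - 1)%R with ((exp x - 1 - x) + x)%R by ring.
  eapply Rle_trans; [apply Rabs_triang|]. rewrite Rabs_pos_eq by lra.
  generalize (Rabs_pos x); nra. }
assert (H5 : (Rabs (sin y) <= Rabs y + / 2 * Rabs y)%R).
{ replace (sin y)%R with ((sin y - y) + y)%R by ring.
  eapply Rle_trans; [apply Rabs_triang|]. generalize (Rabs_pos y); nra. }
assert (E1 : (Rabs (exp x * cos y + - (1) + - x) <= 2 * (x * x) + (y * y))%R).
{ replace (exp x * cos y + - (1) + - x)%R with ((exp x - 1 - x) - exp x * (1 - cos y))%R by ring.
  apply Rabs_le. apply Rabs_le_between in Hx. apply Rabs_le_between in Hy.
  assert (exp x <= 2)%R by nra. generalize (exp_pos x); nra. }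
assert (E2 : (Rabs (exp x * sin y + - 0 + - y) <= 3 * (Rabs x * Rabs y) + / 4 * (Rabs y * Rabs y))%R).
{ replace (exp x * sin y + - 0 + - y)%R with ((exp x - 1) * sin y + (sin y - y))%R by ring.
  eapply Rle_trans; [apply Rabs_triang|]. rewrite Rabs_mult.
  generalize (Rabs_pos x) (Rabs_pos y) (Rabs_pos (sin y)) (Rabs_pos (exp x - 1)); nra. }
replace (Im (x, y)) with y in * by reflexivity.
generalize (Rabs_pos x) (Rabs_pos y); nra.
Qed.

Lemma is_Cderive_Cexp (z : C) : is_Cderive Cexp z (Cexp z).
Proof.
apply is_Cderive_Cmod. intros e He.
set (K := Cmod (Cexp z)).
assert (HK : (0 < K)%R) by (apply Cmod_gt_0, Cexp_neq_0).
exists (Rmin (/ 2) (e / (4 * K))). split.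
{ apply Rmin_pos; [lra|]. apply Rdiv_lt_0_compat; lra. }
intros w Hw.
assert (H1 := Rlt_le_trans _ _ _ Hw (Rmin_l _ _)).
assert (H2 := Rlt_le_trans _ _ _ Hw (Rmin_r _ _)).
replace (Cexp w) with (Cexp z * Cexp (w - z)) by (rewrite <- Cexp_plus; f_equal; ring).
replace (_ - _ - _) with (Cexp z * (Cexp (w - z) - 1 - (w - z))) by ring.
rewrite Cmod_mult. fold K.
apply Rle_trans with (K * (4 * (Cmod (w - z) * Cmod (w - z))))%R.
- apply Rmult_le_compat_l; [lra|]. apply Cexp_sub_lin_bound; lra.
- replace (K * (4 * (Cmod (w - z) * Cmod (w - z))))%R with
   ((Cmod (w - z) * (4 * K)) * Cmod (w - z))%R by ring.
  apply Rmult_le_compat_r; [apply Cmod_ge_0|].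
  apply Rlt_le, Rlt_div_r; lra.
Qed.

(** * Finite sums and Taylor polynomials of the exponential *)

Fixpoint Csum (f : nat -> C) (n : nat) : C :=
  match n with O => 0 | S m => Csum f m + f m end.

(** [sum_n] includes its upper index while [Csum] excludes it; with the empty sum available,
    splitting and telescoping need no correction. *)
Lemma sum_n_Csum (f : nat -> C) (n : nat) :
  sum_n (G := C_AbelianMonoid) f n = Csum f (S n).
Proof.
induction n as [|n IH].
- rewrite sum_O. simpl. ring.
- rewrite sum_Sn, IH. reflexivity.
Qed.

Lemma is_series_Csum (f : nat -> C) (l : C) :
  is_series (K := C_AbsRing) (V := C_NormedModule) f l <->
  filterlim (Csum f) eventually (Clocally l).
Proof.
split; intros H; apply filterlim_Cmod; try exact _; intros e He;
destruct (proj1 (filterlim_Cmod eventually _ _) H e He) as [N HN].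
- exists (S N). intros [|n] Hn; [lia|]. rewrite <- sum_n_Csum. apply HN; lia.
- exists N. intros n Hn.
  change (Cmod (sum_n (G := C_AbelianMonoid) f n - l)%C < e)%R.
  rewrite sum_n_Csum. apply HN; lia.
Qed.

Lemma Csum_ext (f g : nat -> C) (n : nat) :
  (forall k, (k < n)%nat -> f k = g k) -> Csum f n = Csum g n.
Proof.
induction n as [|n IH]; simpl; intros H; auto. rewrite IH, H; auto.
Qed.

Lemma Csum_plus (f g : nat -> C) (n : nat) :
  Csum (fun k => f k + g k) n = Csum f n + Csum g n.
Proof. induction n as [|n IH]; simpl; [ring|rewrite IH; ring]. Qed.

Lemma Csum_mult (c : C) (f : nat -> C) (n : nat) :
  Csum (fun k => c * f k) n = c * Csum f n.
Proof. induction n as [|n IH]; simpl; [ring|rewrite IH; ring]. Qed.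

Lemma Csum_split (f : nat -> C) (m n : nat) :
  Csum f (m + n) = Csum f m + Csum (fun k => f (m + k)%nat) n.
Proof.
induction n as [|n IH]; simpl.
- rewrite Nat.add_0_r. ring.
- rewrite Nat.add_succ_r; simpl. rewrite IH; ring.
Qed.

Lemma INR_fact_neq_0_C (n : nat) : RtoC (INR (fact n)) <> 0.
Proof. intros H. apply RtoC_inj in H. now apply (INR_fact_neq_0 n). Qed.

Lemma is_Cderive_Cpow (n : nat) (z : C) :
  is_Cderive (fun w => w ^ S n) z (RtoC (INR (S n)) * z ^ n).
Proof.
induction n as [|n IH].
- apply is_Cderive_eq with (1%R * 1 + z * 0); [|simpl; ring].
  apply is_Cderive_mult; [apply is_Cderive_id|].
  apply is_Cderive_ext with (fun _ => RtoC 1); [reflexivity|]. apply is_Cderive_const.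
- apply is_Cderive_eq with (1 * (z ^ S n) + z * (RtoC (INR (S n)) * z ^ n)).
  + apply (is_Cderive_mult (fun w => w) (fun w => w ^ S n)); auto. apply is_Cderive_id.
  + rewrite (S_INR (S n)), RtoC_plus. simpl Cpow. ring.
Qed.

Definition exp_partial (n : nat) (u : C) : C := Csum (fun k => u ^ k / RtoC (INR (fact k))) n.

Lemma is_Cderive_exp_partial (n : nat) (z : C) :
  is_Cderive (fun w => exp_partial (S n) w) z
    (exp_partial n z).
Proof.
induction n as [|n IH].
- apply is_Cderive_ext with (fun _ => RtoC 1); [|apply is_Cderive_const].
  intros w; unfold exp_partial; simpl. field.
- apply is_Cderive_plus; [exact IH|].
  apply is_Cderive_eq with
   (RtoC (INR (S n)) * z ^ n * / RtoC (INR (fact (S n))) + z ^ S n * 0).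
  + apply (is_Cderive_mult (fun w => w ^ S n) (fun _ => / RtoC (INR (fact (S n))))); [apply is_Cderive_Cpow|apply is_Cderive_const].
  + rewrite fact_simpl, mult_INR, RtoC_mult. field.
    split; [apply INR_fact_neq_0_C|]. intros H; apply RtoC_inj in H. now apply (not_0_INR (S n)).
Qed.

Lemma Csum_exp_0 (n : nat) : exp_partial (S n) 0 = 1.
Proof.
induction n as [|n IH]; [unfold exp_partial; simpl; field|].
change (exp_partial (S n) 0 + 0 ^ S n / RtoC (INR (fact (S n))) = 1).
rewrite IH, Cpow_S. field. apply INR_fact_neq_0_C.
Qed.

(** Induction on the order: the derivative of one remainder is the previous remainder, which is
    integrated along the segment from 0 to [u]. *)
Lemma Cexp_remainder (n : nat) (u : C) :
  (Cmod (Cexp u - exp_partial n u)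
   <= Cmod u ^ n / INR (fact n) * exp (Cmod u))%R.
Proof.
revert u; induction n as [|n IH]; intros u.
- change (exp_partial 0 u) with (RtoC 0). simpl. replace (Cexp u - 0) with (Cexp u) by ring. rewrite Cmod_Cexp.
  unfold Rdiv; rewrite Rinv_1, !Rmult_1_l.
  assert (H := re_le_Cmod u). apply Rabs_le_between in H.
  destruct (Req_dec (Re u) (Cmod u)) as [->|H']; [lra|]. left; apply exp_increasing; lra.
- set (f := fun w => Cexp w - exp_partial (S n) w).
  set (df := fun w => Cexp w - exp_partial n w).
  assert (D : forall w, is_Cderive f w (df w)).
  { intros w. apply is_Cderive_minus; [apply is_Cderive_Cexp|apply is_Cderive_exp_partial]. }
  assert (Cdf : forall w, continuous (T := C_UniformSpace) (U := C_UniformSpace) df w).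
  { intros w. destruct n as [|n].
    - apply (is_Cderive_continuous df w (Cexp w - 0)). apply is_Cderive_minus; [apply is_Cderive_Cexp|apply is_Cderive_const].
    - apply (is_Cderive_continuous df w (Cexp w - exp_partial n w)).
      apply is_Cderive_minus; [apply is_Cderive_Cexp|apply is_Cderive_exp_partial]. }
  assert (HI : is_CInt (fun y => u * df (0 + u * RtoC y)) 0 1
     (f (0 + u * RtoC 1) - f (0 + u * RtoC 0))).
  { apply (is_CInt_derive (fun y => f (0 + u * RtoC y))).
    - intros t _. apply is_derive_comp_line, D.
    - intros t _. apply Ccontinuous_mult; [apply Ccontinuous_const|].
      apply Ccontinuous_comp; [|apply Cdf].
      apply Ccontinuous_plus; [apply Ccontinuous_const|].
      apply Ccontinuous_mult; [apply Ccontinuous_const|].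
      apply Ccontinuous_RtoC, continuous_id. }
  replace (0 + u * RtoC 1) with u in HI by ring.
  replace (0 + u * RtoC 0) with (RtoC 0) in HI by ring.
  assert (F0 : f 0 = 0) by (unfold f; rewrite Csum_exp_0, Cexp_0; ring).
  rewrite F0 in HI. replace (f u - 0) with (f u) in HI by ring.
  fold (f u).
  (* [A] is the bound to be proved. The majorant is [A] times the derivative of [y ^ S n], so its
     integral over [0, 1] is exactly [A]. *)
  set (A := (Cmod u ^ S n * exp (Cmod u) / INR (fact (S n)))%R).
  assert (HG : is_RInt (fun y => (A * (INR (S n) * y ^ n))%R) 0 1 A).
  { assert (E : minus (A * 1 ^ S n)%R (A * 0 ^ S n)%R = A)
      by (unfold minus, plus, opp; simpl; rewrite pow1; ring).
    cut (is_RInt (fun y => (A * (INR (S n) * y ^ n))%R) 0 1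
      (minus (A * 1 ^ S n)%R (A * 0 ^ S n)%R)); [now rewrite E|].
    apply (is_RInt_derive (V := R_CompleteNormedModule) (fun y => A * y ^ S n)%R).
    - intros y _. auto_derive; auto. change (A * (1 * (INR (S n) * y ^ n)) = A * (INR (S n) * y ^ n))%R. ring.
    - intros y _. apply (ex_derive_continuous (K := R_AbsRing) (V := R_NormedModule)).
      auto_derive; auto. }
  replace (Cmod u ^ S n / INR (fact (S n)) * exp (Cmod u))%R with A
    by (unfold A; field; apply INR_fact_neq_0).
  apply is_CInt_le with (3 := HI) (4 := HG); [lra|].
  intros y Hy. replace (0 + u * RtoC y) with (u * RtoC y) by ring.
  rewrite Cmod_mult.
  eapply Rle_trans; [apply Rmult_le_compat_l; [apply Cmod_ge_0|apply (IH (u * RtoC y))]|].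
  rewrite Cmod_mult, Cmod_R, Rabs_pos_eq by lra.
  unfold A. rewrite fact_simpl, mult_INR, Rpow_mult_distr.
  apply Rle_trans with (Cmod u ^ S n * y ^ n / INR (fact n) * exp (Cmod u))%R.
  + replace (Cmod u * (Cmod u ^ n * y ^ n / INR (fact n) * exp (Cmod u * y)))%R with
     (Cmod u ^ S n * y ^ n / INR (fact n) * exp (Cmod u * y))%R by (simpl; unfold Rdiv; ring).
    apply Rmult_le_compat_l.
    * apply Rdiv_le_0_compat; [|apply INR_fact_lt_0].
      apply Rmult_le_pos; apply pow_le; [apply Cmod_ge_0|lra].
    * generalize (Cmod_ge_0 u); intros H.
      destruct (Rle_lt_or_eq_dec (Cmod u * y) (Cmod u)) as [H'| ->]; [nra| |lra].
      left; now apply exp_increasing.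
  + right. field. split; [apply INR_fact_neq_0|now apply not_0_INR].
Qed.

(** No smallness of [u] is assumed: in [Cpower_remainder] the argument is a multiple of a logarithm
    that is unbounded along the line of integration. *)
Lemma Cexp_sub_lin_bound_exp (u : C) :
  (Cmod (Cexp u - 1 - u) <= Cmod u ^ 2 * exp (Cmod u))%R.
Proof.
assert (H := Cexp_remainder 2 u).
assert (E : exp_partial 2 u = 1 + u) by (unfold exp_partial; simpl; field).
rewrite E in H. replace (Cexp u - (1 + u)) with (Cexp u - 1 - u) in H by ring.
eapply Rle_trans; [exact H|]. simpl.
generalize (exp_pos (Cmod u)) (Cmod_ge_0 u); intros.
assert (0 <= Cmod u * (Cmod u * 1) * exp (Cmod u))%R by (apply Rmult_le_pos; nra).
unfold Rdiv. nra.
Qed.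

(** * Logarithm, powers, cosine and sine *)

Lemma Carg_bound (z : C) : (Rabs (Carg z) <= PI)%R.
Proof.
unfold Carg. assert (H := acos_bound (Re z / Cmod z)).
destruct (Rle_dec 0 (Im z)); apply Rabs_le; lra.
Qed.

Lemma Cexp_Cln (z : C) : z <> 0 -> Cexp (Cln z) = z.
Proof.
intros Hz. assert (Hm := proj1 (Cmod_gt_0 z) Hz).
assert (Hq := Cmod2_eq z).
assert (Hb : (-1 <= Re z / Cmod z <= 1)%R).
{ assert (H := re_le_Cmod z). apply Rabs_le_between in H. split.
  - apply Rle_div_r; lra.
  - apply Rle_div_l; lra. }
assert (Hs : sqrt (1 - (Re z / Cmod z)²) = (Rabs (Im z) / Cmod z)%R).
{ replace (1 - (Re z / Cmod z)²)%R with ((Im z / Cmod z)²).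
  - rewrite sqrt_Rsqr_abs. unfold Rdiv. rewrite Rabs_mult, Rabs_inv, (Rabs_pos_eq (Cmod z)); lra.
  - replace 1%R with ((Re z * Re z + Im z * Im z) / (Cmod z * Cmod z))%R
      by (rewrite <- Hq; field; lra).
    unfold Rsqr. field. lra. }
unfold Cexp, Cln, Carg; apply C_ext; simpl; rewrite exp_ln by auto.
- destruct (Rle_dec 0 (Im z)); rewrite ?cos_neg, cos_acos by auto; field; lra.
- destruct (Rle_dec 0 (Im z)); rewrite ?sin_neg, sin_acos, Hs by auto.
  + rewrite Rabs_pos_eq by auto. field; lra.
  + rewrite Rabs_left by lra. field; lra.
Qed.

(** The definition by [acos] changes its formula across the real axis; on the right half-plane this
    single formula gives continuity of [Cln]. *)
Lemma Carg_atan (z : C) : (0 < Re z)%R -> Carg z = atan (Im z / Re z).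
Proof.
intros Hz.
assert (Hz0 : z <> 0) by (intros ->; simpl in Hz; lra).
assert (E := Cexp_Cln z Hz0).
assert (Hm := proj1 (Cmod_gt_0 z) Hz0).
assert (Er := f_equal Re E). assert (Ei := f_equal Im E).
simpl in Er, Ei. rewrite exp_ln in Er, Ei by auto. change (fst z) with (Re z) in Er. change (snd z) with (Im z) in Ei.
assert (Hc : (0 < cos (Carg z))%R) by nra.
assert (Hb : (- (PI / 2) < Carg z < PI / 2)%R).
{ assert (H := Carg_bound z). apply Rabs_le_between in H.
  split.
  - destruct (Rle_lt_dec (Carg z) (- (PI / 2))); auto.
    assert (cos (- Carg z) <= 0)%R by (apply cos_le_0; lra). rewrite cos_neg in *. lra.
  - destruct (Rle_lt_dec (PI / 2) (Carg z)); auto.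
    assert (cos (Carg z) <= 0)%R by (apply cos_le_0; lra). lra. }
rewrite <- (atan_tan (Carg z)) by auto. f_equal.
unfold tan. rewrite <- Er at 1. rewrite <- Ei at 1. field. lra.
Qed.

Lemma Cln_continuous (z : C) : (0 < Re z)%R ->
  continuous (T := C_UniformSpace) (U := C_UniformSpace) Cln z.
Proof.
intros Hz.
assert (Hz0 : z <> 0) by (intros ->; simpl in Hz; lra).
assert (Hm := proj1 (Cmod_gt_0 z) Hz0).
assert (Cid : continuous (T := C_UniformSpace) (U := C_UniformSpace) (fun w : C => w) z)
  by apply continuous_id.
apply continuous_ext_loc with (fun w : C => (ln (Cmod w), atan (Im w / Re w))).
- apply locally_Cmod. exists (Re z). split; auto. intros w Hw.
  unfold Cln. rewrite Carg_atan; auto.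
  assert (H := re_le_Cmod (w - z)). apply Rabs_le_between in H. simpl in H.
  unfold Re in *. lra.
- apply Ccontinuous_pair.
  + apply (continuous_comp (fun w : C => Cmod w) ln).
    * apply (continuous_Cmod (fun w : C => w)); auto.
    * apply (ex_derive_continuous (K := R_AbsRing) (V := R_NormedModule)). auto_derive; auto.
  + apply (continuous_comp (fun w : C => (Im w / Re w)%R) atan).
    * apply (continuous_mult (K := R_AbsRing) (fun w : C => Im w) (fun w : C => (/ Re w)%R)).
      { apply (continuous_Csnd (fun w : C => w)); auto. }
      apply (continuous_comp (fun w : C => Re w) Rinv).
      { apply (continuous_Cfst (fun w : C => w)); auto. }
      apply (ex_derive_continuous (K := R_AbsRing) (V := R_NormedModule)). auto_derive. lra.
    * apply (ex_derive_continuous (K := R_AbsRing) (V := R_NormedModule)). auto_derive; auto.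
Qed.

(** Inverse function argument: [Cln] is a continuous right inverse of [Cexp], whose derivative at
    [Cln z] is [z], hence not 0. *)
Lemma is_Cderive_Cln (z : C) : (0 < Re z)%R -> is_Cderive Cln z (/ z).
Proof.
intros Hz.
assert (Hz0 : z <> 0) by (intros ->; simpl in Hz; lra).
assert (Hm := proj1 (Cmod_gt_0 z) Hz0).
assert (Hc := Cln_continuous z Hz).
apply is_Cderive_Cmod. intros e He.
set (m := Cmod z) in *.
(* The first entry makes [Cln] Lipschitz near [z] with constant [2 / m]; the second turns the error
   term of [Cexp], divided by [m], into at most [e]. *)
set (e' := Rmin (m / 2) (e * (m * m) / 2)).
assert (He' : (0 < e')%R).
{ apply Rmin_pos; [lra|]. assert (0 < e * (m * m))%R by (apply Rmult_lt_0_compat; nra). lra. }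
assert (D := is_Cderive_Cexp (Cln z)).
rewrite Cexp_Cln in D by auto.
destruct (proj1 (is_Cderive_Cmod _ _ _) D e' He') as [d [Hd HD]].
assert (Hl := proj1 (filterlim_Cmod _ _ _) Hc d Hd).
apply locally_Cmod in Hl. destruct Hl as [d' [Hd' Hl]].
exists (Rmin d' (Re z)). split; [apply Rmin_pos; auto|].
intros w Hw.
assert (H1 := Rlt_le_trans _ _ _ Hw (Rmin_l _ _)).
assert (H2 := Rlt_le_trans _ _ _ Hw (Rmin_r _ _)).
assert (Hw0 : w <> 0).
{ intros ->. assert (H := re_le_Cmod (0 - z)). apply Rabs_le_between in H. simpl in H. unfold Re in *. lra. }
specialize (HD (Cln w) (Hl w H1)).
rewrite !Cexp_Cln in HD by auto.
set (k := Cln w - Cln z) in *.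
assert (Hk : (Cmod k <= 2 / m * Cmod (w - z))%R).
{ assert (Ht : (Cmod (z * k) <= Cmod (w - z) + e' * Cmod k)%R).
  { replace (z * k) with ((w - z) + - (w - z - z * k)) by ring.
    eapply Rle_trans; [apply Cmod_triangle|]. rewrite Cmod_opp. lra. }
  rewrite Cmod_mult in Ht. fold m in Ht.
  assert (e' <= m / 2)%R by apply Rmin_l.
  assert (Hkk := Cmod_ge_0 k).
  apply Rmult_le_reg_l with (m / 2)%R; [lra|].
  replace (m / 2 * (2 / m * Cmod (w - z)))%R with (Cmod (w - z)) by (field; lra).
  nra. }
replace (k - / z * (w - z)) with (- (w - z - z * k) / z) by (field; auto).
rewrite Cmod_div by auto. rewrite Cmod_opp. fold m.
apply Rle_div_l; auto.
eapply Rle_trans; [apply HD|].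
assert (He2 : (e' <= e * (m * m) / 2)%R) by apply Rmin_r.
apply Rle_trans with (e * (m * m) / 2 * (2 / m * Cmod (w - z)))%R.
- apply Rmult_le_compat; auto; [lra|apply Cmod_ge_0].
- right; field; lra.
Qed.

Lemma Cpower_plus (z v w : C) : Cpower z (v + w) = Cpower z v * Cpower z w.
Proof. unfold Cpower. rewrite <- Cexp_plus. f_equal. ring. Qed.

Lemma Cpower_neq_0 (z w : C) : Cpower z w <> 0.
Proof. apply Cexp_neq_0. Qed.

Lemma Cpower_opp (z w : C) : Cpower z (- w) = / Cpower z w.
Proof. unfold Cpower. rewrite <- Cexp_opp. f_equal. ring. Qed.

Lemma Cpower_0 (z : C) : Cpower z 0 = 1.
Proof. unfold Cpower. rewrite Cmult_0_l. apply Cexp_0. Qed.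

Lemma Cpower_1 (z : C) : z <> 0 -> Cpower z 1 = z.
Proof. intros H. unfold Cpower. rewrite Cmult_1_l. now apply Cexp_Cln. Qed.

Lemma Cpower_INR (z : C) (n : nat) : z <> 0 -> Cpower z (RtoC (INR n)) = z ^ n.
Proof.
intros H. induction n as [|n IH].
- apply Cpower_0.
- rewrite S_INR, RtoC_plus, Cpower_plus, IH, Cpower_1 by auto. simpl; ring.
Qed.

Lemma Cmod_Cpower (z w : C) : z <> 0 ->
  Cmod (Cpower z w) = (Rpower (Cmod z) (Re w) * exp (- Im w * Carg z))%R.
Proof.
intros Hz. unfold Cpower. rewrite Cmod_Cexp. unfold Rpower. rewrite <- exp_plus.
f_equal. simpl. unfold Re, Im. ring.
Qed.

Lemma Cmod_Cpower_le (z w : C) : z <> 0 ->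
  (Cmod (Cpower z w) <= Rpower (Cmod z) (Re w) * exp (PI * Rabs (Im w)))%R.
Proof.
intros Hz. rewrite Cmod_Cpower by auto. apply Rmult_le_compat_l.
{ left; apply exp_pos. }
assert (- Im w * Carg z <= PI * Rabs (Im w))%R.
{ eapply Rle_trans; [apply Rle_abs|]. rewrite Rabs_mult, Rabs_Ropp, Rmult_comm.
  apply Rmult_le_compat_r; [apply Rabs_pos|apply Carg_bound]. }
destruct H as [H| ->]; [left; now apply exp_increasing|lra].
Qed.

Lemma is_Cderive_Cpower_l (z w : C) : (0 < Re z)%R ->
  is_Cderive (fun u => Cpower u w) z (w * Cpower z (w - 1)).
Proof.
intros Hz.
assert (Hz0 : z <> 0) by (intros ->; simpl in Hz; lra).
apply is_Cderive_eq with ((0 * Cln z + w * / z) * Cexp (w * Cln z)).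
- apply (is_Cderive_comp Cexp (fun u => w * Cln u)); [apply is_Cderive_Cexp|].
  apply (is_Cderive_mult (fun _ => w) Cln); [apply is_Cderive_const|now apply is_Cderive_Cln].
- fold (Cpower z w). unfold Cminus. rewrite Cpower_plus, Cpower_opp, Cpower_1 by auto. field; auto.
Qed.

Lemma is_Cderive_Cpower_r (z w : C) :
  is_Cderive (fun u => Cpower z u) w (Cln z * Cpower z w).
Proof.
apply is_Cderive_eq with ((1 * Cln z + w * 0) * Cexp (w * Cln z)).
- apply (is_Cderive_comp Cexp (fun u => u * Cln z)); [apply is_Cderive_Cexp|].
  apply (is_Cderive_mult (fun u => u) (fun _ => Cln z)); [apply is_Cderive_id|apply is_Cderive_const].
- fold (Cpower z w). ring.
Qed.

Lemma Ci2 : Ci * Ci = - (1).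
Proof. apply C_ext; simpl; ring. Qed.

Lemma is_Cderive_Ccos (z : C) : is_Cderive Ccos z (- Csin z).
Proof.
apply is_Cderive_eq with
 (((0 * z + Ci * 1) * Cexp (Ci * z) + - (0 * z + Ci * 1) * Cexp (- (Ci * z))) * / 2 +
  (Cexp (Ci * z) + Cexp (- (Ci * z))) * 0).
- assert (D : is_Cderive (fun w => Ci * w) z (0 * z + Ci * 1)).
  { apply (is_Cderive_mult (fun _ => Ci) (fun w => w)); [apply is_Cderive_const|apply is_Cderive_id]. }
  apply (is_Cderive_mult (fun w => Cexp (Ci * w) + Cexp (- (Ci * w))) (fun _ => / 2));
   [|apply is_Cderive_const].
  apply is_Cderive_plus.
  + apply (is_Cderive_comp Cexp (fun w => Ci * w)); [apply is_Cderive_Cexp|auto].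
  + apply (is_Cderive_comp Cexp (fun w => - (Ci * w))); [apply is_Cderive_Cexp|].
    now apply is_Cderive_opp.
- unfold Csin.
  transitivity (Ci * (Cexp (Ci * z) - Cexp (- (Ci * z))) / 2); [field|].
  set (A := Cexp (Ci * z) - Cexp (- (Ci * z))).
  replace (A / (2 * Ci)) with (A / 2 * / Ci) by (field; apply Ci_nz).
  rewrite Ci_inv. field.
Qed.

Lemma Cmod_Ccos_le (z : C) : (Cmod (Ccos z) <= exp (Rabs (Im z)))%R.
Proof.
unfold Ccos. rewrite Cmod_div by (intros H; apply RtoC_inj in H; lra).
rewrite Cmod_R, (Rabs_pos_eq 2) by lra. apply Rle_div_l; [lra|].
eapply Rle_trans; [apply Cmod_triangle|]. rewrite !Cmod_Cexp. simpl.
replace (0 * fst z - 1 * snd z)%R with (- Im z)%R by (unfold Im; ring).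
rewrite Ropp_involutive.
assert (forall x y, x <= y -> exp x <= exp y)%R.
{ intros x y [H| ->]; [left; now apply exp_increasing|lra]. }
assert (H1 := H (- Im z)%R (Rabs (Im z))). assert (H2 := H (Im z) (Rabs (Im z)) (Rle_abs _)).
rewrite <- Rabs_Ropp in H1. specialize (H1 (Rle_abs _)). rewrite Rabs_Ropp in H1. lra.
Qed.

Lemma Cmod_Csin_le (z : C) : (Cmod (Csin z) <= exp (Rabs (Im z)))%R.
Proof.
unfold Csin.
assert (H2 : RtoC 2 <> 0) by (intros H; apply RtoC_inj in H; lra).
rewrite Cmod_div by (apply Cmult_neq_0; auto using Ci_nz).
rewrite Cmod_mult, Cmod_R, Cmod_Ci, (Rabs_pos_eq 2) by lra. apply Rle_div_l; [lra|].
eapply Rle_trans; [apply Cmod_triangle|]. rewrite Cmod_opp, !Cmod_Cexp. simpl.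
replace (0 * fst z - 1 * snd z)%R with (- Im z)%R by (unfold Im; ring).
rewrite Ropp_involutive.
assert (forall x y, x <= y -> exp x <= exp y)%R.
{ intros x y [H| ->]; [left; now apply exp_increasing|lra]. }
assert (H1 := H (- Im z)%R (Rabs (Im z))). assert (H3 := H (Im z) (Rabs (Im z)) (Rle_abs _)).
rewrite <- Rabs_Ropp in H1. specialize (H1 (Rle_abs _)). rewrite Rabs_Ropp in H1. lra.
Qed.

(** * Goursat's theorem on rectangles *)

Notation Ccontinuous_at f := (continuous (T := C_UniformSpace) (U := C_UniformSpace) (f : C -> C)).

(** The contour integral over the boundary of a rectangle, counterclockwise; the factor [Ci] is the
    direction of the vertical sides. *)
Definition Crect (f : C -> C) (x1 x2 y1 y2 : R) : C :=
  CInt (fun x => f (x, y1)) x1 x2 + Ci * CInt (fun y => f (x2, y)) y1 y2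
  - CInt (fun x => f (x, y2)) x1 x2 - Ci * CInt (fun y => f (x1, y)) y1 y2.

Lemma Ccontinuous_horizontal (f : C -> C) (x y : R) :
  Ccontinuous_at f (x, y) -> Ccontinuous (fun t => f (t, y)) x.
Proof.
intros H. apply (Ccontinuous_comp f (fun t : R => (t, y))); auto.
apply Ccontinuous_pair; [apply continuous_id|apply continuous_const].
Qed.

Lemma Ccontinuous_vertical (f : C -> C) (x y : R) :
  Ccontinuous_at f (x, y) -> Ccontinuous (fun t => f (x, t)) y.
Proof.
intros H. apply (Ccontinuous_comp f (fun t : R => (x, t))); auto.
apply Ccontinuous_pair; [apply continuous_const|apply continuous_id].
Qed.

Lemma is_CInt_horizontal (f : C -> C) (x1 x2 y : R) :
  (x1 <= x2)%R -> (forall x, (x1 <= x <= x2)%R -> Ccontinuous_at f (x, y)) ->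
  is_CInt (fun x => f (x, y)) x1 x2 (CInt (fun x => f (x, y)) x1 x2).
Proof.
intros Hx H. apply is_CInt_CInt. intros t Ht.
rewrite Rmin_left, Rmax_right in Ht by auto. now apply Ccontinuous_horizontal, H.
Qed.

Lemma is_CInt_vertical (f : C -> C) (x y1 y2 : R) :
  (y1 <= y2)%R -> (forall y, (y1 <= y <= y2)%R -> Ccontinuous_at f (x, y)) ->
  is_CInt (fun y => f (x, y)) y1 y2 (CInt (fun y => f (x, y)) y1 y2).
Proof.
intros Hy H. apply is_CInt_CInt. intros t Ht.
rewrite Rmin_left, Rmax_right in Ht by auto. now apply Ccontinuous_vertical, H.
Qed.

Lemma Crect_split_x (f : C -> C) (x1 x2 x3 y1 y2 : R) :
  (x1 <= x2 <= x3)%R ->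
  (forall x, (x1 <= x <= x3)%R -> Ccontinuous_at f (x, y1)) ->
  (forall x, (x1 <= x <= x3)%R -> Ccontinuous_at f (x, y2)) ->
  Crect f x1 x3 y1 y2 = Crect f x1 x2 y1 y2 + Crect f x2 x3 y1 y2.
Proof.
intros Hx H1 H2. unfold Crect.
assert (E : forall y, (forall x, (x1 <= x <= x3)%R -> Ccontinuous_at f (x, y)) ->
  CInt (fun x => f (x, y)) x1 x3 = CInt (fun x => f (x, y)) x1 x2 + CInt (fun x => f (x, y)) x2 x3).
{ intros y Hy. apply CInt_unique.
  apply is_CInt_Chasles with x2; apply is_CInt_horizontal; try lra; intros; apply Hy; lra. }
rewrite !E by auto. ring.
Qed.

Lemma Crect_split_y (f : C -> C) (x1 x2 y1 y2 y3 : R) :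
  (y1 <= y2 <= y3)%R ->
  (forall y, (y1 <= y <= y3)%R -> Ccontinuous_at f (x1, y)) ->
  (forall y, (y1 <= y <= y3)%R -> Ccontinuous_at f (x2, y)) ->
  Crect f x1 x2 y1 y3 = Crect f x1 x2 y1 y2 + Crect f x1 x2 y2 y3.
Proof.
intros Hx H1 H2. unfold Crect.
assert (E : forall x, (forall y, (y1 <= y <= y3)%R -> Ccontinuous_at f (x, y)) ->
  CInt (fun y => f (x, y)) y1 y3 = CInt (fun y => f (x, y)) y1 y2 + CInt (fun y => f (x, y)) y2 y3).
{ intros y Hy. apply CInt_unique.
  apply is_CInt_Chasles with y2; apply is_CInt_vertical; try lra; intros; apply Hy; lra. }
rewrite !E by auto. ring.
Qed.

Lemma Crect_bound (f : C -> C) (x1 x2 y1 y2 M : R) :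
  (x1 <= x2)%R -> (y1 <= y2)%R ->
  (forall x, (x1 <= x <= x2)%R -> (Ccontinuous_at f (x, y1) /\ (Cmod (f (x, y1)) <= M)%R)) ->
  (forall x, (x1 <= x <= x2)%R -> (Ccontinuous_at f (x, y2) /\ (Cmod (f (x, y2)) <= M)%R)) ->
  (forall y, (y1 <= y <= y2)%R -> (Ccontinuous_at f (x1, y) /\ (Cmod (f (x1, y)) <= M)%R)) ->
  (forall y, (y1 <= y <= y2)%R -> (Ccontinuous_at f (x2, y) /\ (Cmod (f (x2, y)) <= M)%R)) ->
  (Cmod (Crect f x1 x2 y1 y2) <= 2 * ((x2 - x1) + (y2 - y1)) * M)%R.
Proof.
intros Hx Hy B1 B2 B3 B4. unfold Crect.
assert (I1 := is_CInt_horizontal f x1 x2 y1 Hx (fun x h => proj1 (B1 x h))).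
assert (I2 := is_CInt_horizontal f x1 x2 y2 Hx (fun x h => proj1 (B2 x h))).
assert (I3 := is_CInt_vertical f x1 y1 y2 Hy (fun x h => proj1 (B3 x h))).
assert (I4 := is_CInt_vertical f x2 y1 y2 Hy (fun x h => proj1 (B4 x h))).
apply is_CInt_le_const with (M := M) in I1; auto; [|intros; now apply B1].
apply is_CInt_le_const with (M := M) in I2; auto; [|intros; now apply B2].
apply is_CInt_le_const with (M := M) in I3; auto; [|intros; now apply B3].
apply is_CInt_le_const with (M := M) in I4; auto; [|intros; now apply B4].
eapply Rle_trans; [apply Cmod_triangle|]. rewrite Cmod_opp, Cmod_mult, Cmod_Ci.
eapply Rle_trans; [apply Rplus_le_compat_r, Cmod_triangle|]. rewrite Cmod_opp.
eapply Rle_trans; [apply Rplus_le_compat_r, Rplus_le_compat_r, Cmod_triangle|].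
rewrite Cmod_mult, Cmod_Ci. lra.
Qed.

Lemma Crect_primitive (F f : C -> C) (x1 x2 y1 y2 : R) :
  (forall z, is_Cderive F z (f z)) -> (forall z, Ccontinuous_at f z) ->
  Crect f x1 x2 y1 y2 = 0.
Proof.
intros D Hc.
assert (E : forall p v a b, is_CInt (fun t => v * f (p + v * RtoC t)) a b
   (F (p + v * RtoC b) - F (p + v * RtoC a))).
{ intros p v a b. apply (is_CInt_derive (fun t => F (p + v * RtoC t))).
  - intros t _. apply is_derive_comp_line, D.
  - intros t _. apply Ccontinuous_mult; [apply Ccontinuous_const|].
    apply Ccontinuous_comp; [|apply Hc].
    apply Ccontinuous_plus; [apply Ccontinuous_const|].
    apply Ccontinuous_mult; [apply Ccontinuous_const|].
    apply Ccontinuous_RtoC, continuous_id. }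
assert (Eh : forall y, CInt (fun x => f (x, y)) x1 x2 = F (x2, y) - F (x1, y)).
{ intros y. apply CInt_unique.
  replace (x2, y) with ((0, y)%R + 1 * RtoC x2) by (apply C_ext; simpl; ring).
  replace (x1, y) with ((0, y)%R + 1 * RtoC x1) by (apply C_ext; simpl; ring).
  refine (is_CInt_ext _ _ _ _ _ _ (E (0, y)%R 1 x1 x2)).
  intros t _. replace ((0, y)%R + 1 * RtoC t) with (t, y) by (apply C_ext; simpl; ring). ring. }
assert (Ev : forall x, Ci * CInt (fun y => f (x, y)) y1 y2 = F (x, y2) - F (x, y1)).
{ intros x.
  replace (x, y2) with ((x, 0)%R + Ci * RtoC y2) by (apply C_ext; simpl; ring).
  replace (x, y1) with ((x, 0)%R + Ci * RtoC y1) by (apply C_ext; simpl; ring).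
  rewrite <- (CInt_unique _ _ _ _ (E (x, 0)%R Ci y1 y2)).
  symmetry. apply CInt_unique.
  apply is_CInt_ext with (fun t => Ci * f (x, t)).
  { intros t _. do 2 f_equal. apply C_ext; simpl; ring. }
  apply is_CInt_mult. apply is_CInt_CInt. intros t _. apply Ccontinuous_vertical, Hc. }
unfold Crect. rewrite !Eh, !Ev. ring.
Qed.

Lemma Crect_minus (f g : C -> C) (x1 x2 y1 y2 : R) :
  (x1 <= x2)%R -> (y1 <= y2)%R ->
  (forall x, (x1 <= x <= x2)%R -> Ccontinuous_at f (x, y1) /\ Ccontinuous_at g (x, y1)) ->
  (forall x, (x1 <= x <= x2)%R -> Ccontinuous_at f (x, y2) /\ Ccontinuous_at g (x, y2)) ->
  (forall y, (y1 <= y <= y2)%R -> Ccontinuous_at f (x1, y) /\ Ccontinuous_at g (x1, y)) ->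
  (forall y, (y1 <= y <= y2)%R -> Ccontinuous_at f (x2, y) /\ Ccontinuous_at g (x2, y)) ->
  Crect (fun z => f z - g z) x1 x2 y1 y2 = Crect f x1 x2 y1 y2 - Crect g x1 x2 y1 y2.
Proof.
intros Hx Hy H1 H2 H3 H4. unfold Crect.
assert (Eh : forall y, (forall x, (x1 <= x <= x2)%R -> Ccontinuous_at f (x, y) /\ Ccontinuous_at g (x, y)) ->
  CInt (fun x => f (x, y) - g (x, y)) x1 x2 =
  CInt (fun x => f (x, y)) x1 x2 - CInt (fun x => g (x, y)) x1 x2).
{ intros y H. apply CInt_unique, is_CInt_minus; apply is_CInt_horizontal; auto; intros; now apply H. }
assert (Ev : forall x, (forall y, (y1 <= y <= y2)%R -> Ccontinuous_at f (x, y) /\ Ccontinuous_at g (x, y)) ->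
  CInt (fun y => f (x, y) - g (x, y)) y1 y2 =
  CInt (fun y => f (x, y)) y1 y2 - CInt (fun y => g (x, y)) y1 y2).
{ intros y H. apply CInt_unique, is_CInt_minus; apply is_CInt_vertical; auto; intros; now apply H. }
rewrite !Eh, !Ev by auto. ring.
Qed.

(** The affine part of [f] at [p] has a primitive and integrates to 0. The remainder is at most [e]
    times the half perimeter, over a contour of twice that length. *)
Lemma Crect_local_estimate (f : C -> C) (p l : C) (e x1 x2 y1 y2 : R) :
  (x1 <= Re p <= x2)%R -> (y1 <= Im p <= y2)%R ->
  (forall x y, (x1 <= x <= x2)%R -> (y1 <= y <= y2)%R ->
    Ccontinuous_at f (x, y) /\ (Cmod (f (x, y) - f p - l * ((x, y) - p)%C) <= e * Cmod ((x, y) - p)%C)%R) ->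
  (0 <= e)%R ->
  (Cmod (Crect f x1 x2 y1 y2) <= 2 * e * ((x2 - x1) + (y2 - y1)) ^ 2)%R.
Proof.
intros Hp Hp' H He.
set (g := fun z => f p + l * (z - p)).
assert (Dg : forall z, is_Cderive g z (0 + (0 * (z - p) + l * (1 - 0)))).
{ intros z. apply is_Cderive_plus; [apply is_Cderive_const|].
  apply (is_Cderive_mult (fun _ => l) (fun z => z - p)); [apply is_Cderive_const|].
  apply is_Cderive_minus; [apply is_Cderive_id|apply is_Cderive_const]. }
assert (Cg : forall z, Ccontinuous_at g z) by (intros z; eapply is_Cderive_continuous, Dg).
assert (Eg : Crect g x1 x2 y1 y2 = 0).
{ apply Crect_primitive with (fun z => f p * z + l * / 2 * ((z - p) * (z - p))); auto.
  intros z. apply is_Cderive_eq with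
    ((0 * z + f p * 1) + (0 * ((z - p) * (z - p)) + l * / 2 * ((1 - 0) * (z - p) + (z - p) * (1 - 0)))).
  - apply is_Cderive_plus.
    + apply (is_Cderive_mult (fun _ => f p) (fun z => z)); [apply is_Cderive_const|apply is_Cderive_id].
    + apply (is_Cderive_mult (fun _ => l * / 2) (fun z => (z - p) * (z - p))); [apply is_Cderive_const|].
      apply (is_Cderive_mult (fun z => z - p) (fun z => z - p));
      (apply is_Cderive_minus; [apply is_Cderive_id|apply is_Cderive_const]).
  - unfold g. field. }
assert (E : Crect f x1 x2 y1 y2 = Crect (fun z => f z - g z) x1 x2 y1 y2).
{ rewrite Crect_minus, Eg; [ring|lra|lra|..]; intros; (split; [apply H; lra|apply Cg]). }
rewrite E.
apply Rle_trans with (2 * ((x2 - x1) + (y2 - y1)) * (e * ((x2 - x1) + (y2 - y1))))%R; [|right; ring].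
assert (B : forall x y, (x1 <= x <= x2)%R -> (y1 <= y <= y2)%R ->
  Ccontinuous_at (fun z => f z - g z) (x, y) /\ (Cmod (f (x, y) - g (x, y)) <= e * ((x2 - x1) + (y2 - y1)))%R).
{ intros x y h1 h2. destruct (H x y h1 h2) as [h3 h4]. split.
  - apply Ccontinuous_minus; auto.
  - unfold g. replace (f (x, y) - (f p + l * ((x, y) - p))) with (f (x, y) - f p - l * ((x, y) - p)) by ring.
    eapply Rle_trans; [apply h4|]. apply Rmult_le_compat_l; auto.
    eapply Rle_trans; [apply Cmod_le_Rabs|].
    replace (Re ((x, y) - p)) with (x - Re p)%R by (simpl; unfold Re; ring).
    replace (Im ((x, y) - p)) with (y - Im p)%R by (simpl; unfold Im; ring).
    apply Rplus_le_compat; apply Rabs_le; lra. }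
apply Crect_bound; try lra; intros; apply B; lra.
Qed.

(** The inner sides of the four quarters cancel, so one quarter carries at least a fourth of the
    integral; [q] is its lower left corner. *)
Lemma Crect_quarter (f : C -> C) (x y a b c : R) :
  (0 <= a)%R -> (0 <= b)%R ->
  (forall u v, (x <= u <= x + 2 * a)%R -> (y <= v <= y + 2 * b)%R -> Ccontinuous_at f (u, v)) ->
  (c <= Cmod (Crect f x (x + 2 * a) y (y + 2 * b)))%R ->
  exists q : C, (Re q = x \/ Re q = x + a)%R /\ (Im q = y \/ Im q = y + b)%R /\
   (c <= 4 * Cmod (Crect f (Re q) (Re q + a) (Im q) (Im q + b)))%R.
Proof.
intros Ha Hb Hc H.
assert (E : Crect f x (x + 2 * a) y (y + 2 * b) =
  (Crect f x (x + a) y (y + b) + Crect f x (x + a) (y + b) (y + b + b)) +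
  (Crect f (x + a) (x + a + a) y (y + b) + Crect f (x + a) (x + a + a) (y + b) (y + b + b))).
{ rewrite (Crect_split_x f x (x + a)); [|lra|intros; apply Hc; lra..].
  rewrite (Crect_split_y f x (x + a) y (y + b) (y + 2 * b)); [|lra|intros; apply Hc; lra..].
  rewrite (Crect_split_y f (x + a) (x + 2 * a) y (y + b) (y + 2 * b)); [|lra|intros; apply Hc; lra..].
  replace (x + 2 * a)%R with (x + a + a)%R by ring.
  replace (y + 2 * b)%R with (y + b + b)%R by ring. ring. }
rewrite E in H.
set (r1 := Crect f x (x + a) y (y + b)) in *.
set (r2 := Crect f x (x + a) (y + b) (y + b + b)) in *.
set (r3 := Crect f (x + a) (x + a + a) y (y + b)) in *.
set (r4 := Crect f (x + a) (x + a + a) (y + b) (y + b + b)) in *.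
assert (T := Cmod_triangle (r1 + r2) (r3 + r4)).
assert (T1 := Cmod_triangle r1 r2). assert (T2 := Cmod_triangle r3 r4).
destruct (Rle_dec c (4 * Cmod r1)) as [h1|h1]; [exists (x, y); simpl; auto|].
destruct (Rle_dec c (4 * Cmod r2)) as [h2|h2]; [exists (x, (y + b)%R); simpl; auto|].
destruct (Rle_dec c (4 * Cmod r3)) as [h3|h3]; [exists ((x + a)%R, y); simpl; auto|].
destruct (Rle_dec c (4 * Cmod r4)) as [h4|h4]; [exists ((x + a)%R, (y + b)%R); simpl; auto|].
exfalso; lra.
Qed.

(** Nested intervals: left ends increase, and right ends do not, since [u] moves by at most half of
    the current length. *)
Lemma bisection_limit (u : nat -> R) (L : R) :
  (0 <= L)%R -> (forall n, u (S n) = u n \/ u (S n) = u n + L / 2 ^ S n)%R ->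
  exists X : R, forall n, (u n <= X <= u n + L / 2 ^ n)%R.
Proof.
intros HL Hu.
assert (Hp : forall n, (0 <= L / 2 ^ n)%R).
{ intros n. apply Rdiv_le_0_compat; auto. apply pow_lt; lra. }
assert (Hs : forall n, (L / 2 ^ n = 2 * (L / 2 ^ S n))%R).
{ intros n. simpl. field. apply pow_nonzero; lra. }
assert (H1 : forall n, (u n <= u (S n))%R).
{ intros n. generalize (Hp (S n)). destruct (Hu n) as [-> | ->]; lra. }
assert (H2 : forall n k, (u n <= u (n + k)%nat /\ u (n + k)%nat + L / 2 ^ (n + k) <= u n + L / 2 ^ n)%R).
{ intros n k; induction k as [|k [IH1 IH2]].
  - rewrite Nat.add_0_r. lra.
  - rewrite Nat.add_succ_r. split; [generalize (H1 (n + k)%nat); lra|].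
    generalize (Hs (n + k)%nat) (Hp (S (n + k))).
    destruct (Hu (n + k)%nat) as [-> | ->]; lra. }
destruct (ex_finite_lim_seq_incr u (u 0%nat + L)) as [X HX]; auto.
{ intros n. destruct (H2 0%nat n) as [_ h]. simpl in h. rewrite Rdiv_1_r in h.
  generalize (Hp n). simpl in *. lra. }
exists X. intros n. split.
- apply (is_lim_seq_incr_compare u X HX H1).
- assert (HX' : is_lim_seq (fun k => u (k + n)%nat) X) by now apply is_lim_seq_incr_n.
  apply (is_lim_seq_le (fun k => u (k + n)%nat) (fun _ => u n + L / 2 ^ n)%R X (u n + L / 2 ^ n)%R); auto.
  + intros k. destruct (H2 n k) as [_ h]. rewrite Nat.add_comm. generalize (Hp (n + k)%nat). lra.
  + apply is_lim_seq_const.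
Qed.

Lemma goursat (f : C -> C) (x1 x2 y1 y2 : R) :
  (x1 <= x2)%R -> (y1 <= y2)%R ->
  (forall x y, (x1 <= x <= x2)%R -> (y1 <= y <= y2)%R -> exists l, is_Cderive f (x, y) l) ->
  Crect f x1 x2 y1 y2 = 0.
Proof.
intros Hx Hy D.
assert (Hc : forall x y, (x1 <= x <= x2)%R -> (y1 <= y <= y2)%R -> Ccontinuous_at f (x, y)).
{ intros x y h1 h2. destruct (D x y h1 h2) as [l Hl]. now apply is_Cderive_continuous in Hl. }
apply Cmod_eq_0.
set (c := Cmod (Crect f x1 x2 y1 y2)).
set (A := (x2 - x1)%R). set (B := (y2 - y1)%R).
assert (Hs : forall L n, (L / 2 ^ n = 2 * (L / 2 ^ S n))%R).
{ intros L n. simpl. field. apply pow_nonzero; lra. }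
assert (Hp : forall L n, (0 <= L -> 0 <= L / 2 ^ n)%R).
{ intros L n HL. apply Rdiv_le_0_compat; auto. apply pow_lt; lra. }
(* [p] is the lower left corner of a rectangle of generation [n]; the last clause says that it
   carries at least [c / 4 ^ n]. *)
set (P := fun (n : nat) (p : C) =>
  (x1 <= Re p)%R /\ (Re p + A / 2 ^ n <= x2)%R /\ (y1 <= Im p)%R /\ (Im p + B / 2 ^ n <= y2)%R /\
  (c <= 4 ^ n * Cmod (Crect f (Re p) (Re p + A / 2 ^ n) (Im p) (Im p + B / 2 ^ n)))%R).
assert (step : forall n (p : {p | P n p}), exists q : {q | P (S n) q},
  (Re (proj1_sig q) = Re (proj1_sig p) \/ Re (proj1_sig q) = Re (proj1_sig p) + A / 2 ^ S n)%R /\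
  (Im (proj1_sig q) = Im (proj1_sig p) \/ Im (proj1_sig q) = Im (proj1_sig p) + B / 2 ^ S n)%R).
{ intros n [p [h1 [h2 [h3 [h4 h5]]]]]. simpl proj1_sig.
  rewrite !(Hs _ n) in *.
  assert (HA := Hp A (S n) ltac:(unfold A; lra)). assert (HB := Hp B (S n) ltac:(unfold B; lra)).
  destruct (Crect_quarter f (Re p) (Im p) (A / 2 ^ S n) (B / 2 ^ S n) (c / 4 ^ n)) as [q [q1 [q2 q3]]]; auto.
  { intros u v hu hv. apply Hc; lra. }
  { apply Rle_div_l; [apply pow_lt; lra|]. lra. }
  assert (Hq : P (S n) q).
  { unfold P. repeat split; try (destruct q1; destruct q2; lra).
    apply (Rle_div_l c _ (4 ^ n)) in q3; [|apply pow_lt; lra]. simpl pow at 1. lra. }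
  exists (exist _ q Hq). simpl proj1_sig. auto. }
assert (P0 : P 0%nat (x1, y1)).
{ unfold P. simpl. rewrite !Rdiv_1_r.
  replace (x1 + A)%R with x2 by (unfold A; ring). replace (y1 + B)%R with y2 by (unfold B; ring).
  fold c. repeat split; lra. }
set (nxt := fun n p => proj1_sig (constructive_indefinite_description _ (step n p))).
(* Dependent choice: the invariant travels with the corner in a sigma type. *)
set (s := fix s n : {p | P n p} :=
  match n return {p | P n p} with O => exist _ _ P0 | S m => nxt m (s m) end).
assert (Hstep : forall n,
  (Re (proj1_sig (s (S n))) = Re (proj1_sig (s n)) \/ Re (proj1_sig (s (S n))) = Re (proj1_sig (s n)) + A / 2 ^ S n)%R /\
  (Im (proj1_sig (s (S n))) = Im (proj1_sig (s n)) \/ Im (proj1_sig (s (S n))) = Im (proj1_sig (s n)) + B / 2 ^ S n)%R).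
{ intros n. exact (proj2_sig (constructive_indefinite_description _ (step n (s n)))). }
destruct (bisection_limit (fun n => Re (proj1_sig (s n))) A) as [X HX];
 [unfold A; lra|intros n; apply Hstep|].
destruct (bisection_limit (fun n => Im (proj1_sig (s n))) B) as [Y HY];
 [unfold B; lra|intros n; apply Hstep|].
assert (HXY : exists l, is_Cderive f (X, Y) l).
{ apply D.
  - specialize (HX 0%nat). simpl in HX. rewrite Rdiv_1_r in HX. unfold A in HX; lra.
  - specialize (HY 0%nat). simpl in HY. rewrite Rdiv_1_r in HY. unfold B in HY; lra. }
destruct HXY as [l Hl]. rewrite is_Cderive_Cmod in Hl.
(* The loss [4 ^ n] from the subdivisions is compensated exactly by the square of the side lengths
   in the local estimate, so the bound does not depend on the generation. *)
assert (key : forall e, (0 < e)%R -> (c <= 2 * e * (A + B) ^ 2)%R).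
{ intros e He. destruct (Hl e He) as [d [Hd Hd']].
  assert (HN : exists n, ((A + B) / 2 ^ n < d)%R).
  { destruct (pow_lt_1_zero (/ 2) ltac:(rewrite Rabs_pos_eq; lra) (d / (A + B + 1))) as [N HN].
    { apply Rdiv_lt_0_compat; auto. unfold A, B; lra. }
    exists N. specialize (HN N (le_n N)). rewrite Rabs_pos_eq in HN by (apply pow_le; lra).
    rewrite pow_inv in HN.
    assert (0 < A + B + 1)%R by (unfold A, B; lra).
    apply Rlt_div_r in HN; auto. unfold Rdiv.
    assert (0 < / 2 ^ N)%R by (apply Rinv_0_lt_compat, pow_lt; lra). lra. }
  destruct HN as [n Hn].
  destruct (s n) as [p Hpn] eqn:Es. specialize (HX n). specialize (HY n). cbv beta in HX, HY.
  rewrite Es in HX, HY. simpl proj1_sig in HX, HY.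
  destruct Hpn as [h1 [h2 [h3 [h4 h5]]]].
  assert (H := Crect_local_estimate f (X, Y) l e (Re p) (Re p + A / 2 ^ n) (Im p) (Im p + B / 2 ^ n) HX HY).
  assert (HH : (Cmod (Crect f (Re p) (Re p + A / 2 ^ n) (Im p) (Im p + B / 2 ^ n)) <= 2 * e * ((A + B) / 2 ^ n) ^ 2)%R).
  { replace ((A + B) / 2 ^ n)%R with (Re p + A / 2 ^ n - Re p + (Im p + B / 2 ^ n - Im p))%R by (unfold Rdiv; ring).
    apply H; [|lra]. intros x y hx hy. split; [apply Hc; lra|]. apply Hd'.
    eapply Rle_lt_trans; [apply Cmod_le_Rabs|]. apply Rle_lt_trans with ((A + B) / 2 ^ n)%R; auto.
    unfold Rdiv in *. rewrite Rmult_plus_distr_r.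
    apply Rplus_le_compat; simpl; apply Rabs_le; lra. }
  eapply Rle_trans; [apply h5|].
  apply Rle_trans with (4 ^ n * (2 * e * ((A + B) / 2 ^ n) ^ 2))%R.
  - apply Rmult_le_compat_l; auto. apply pow_le; lra.
  - replace 4%R with (2 * 2)%R by ring. rewrite Rpow_mult_distr. right. field. apply pow_nonzero; lra. }
assert (c0 : (0 <= c)%R) by apply Cmod_ge_0.
apply Rle_antisym; auto. apply Rnot_lt_le. intros Hcpos.
assert (HAB : (0 <= (A + B) ^ 2)%R) by apply pow2_ge_0.
(* With this [e], [key] says that [c] is at most [c / 2] times a ratio below 1. The [+ 1] covers a
   rectangle reduced to a point. *)
assert (H := key (c / (4 * ((A + B) ^ 2 + 1)))%R ltac:(apply Rdiv_lt_0_compat; lra)).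
replace (2 * (c / (4 * ((A + B) ^ 2 + 1))) * (A + B) ^ 2)%R with
  ((c / 2) * ((A + B) ^ 2 / ((A + B) ^ 2 + 1)))%R in H by (field; lra).
assert ((A + B) ^ 2 / ((A + B) ^ 2 + 1) <= 1)%R by (apply Rle_div_l; lra).
nra.
Qed.

(** * Uniqueness of the continuation *)

(* In the coordinate w with z = p + exp w, Goursat's theorem on [u, ln r] x [0, 2 pi] says that
   the mean of g over the circle of radius exp u does not depend on u; let u tend to -oo. *)
Lemma entire_zero_of_circle (g dg : C -> C) (p : C) (r : R) :
  (forall z, is_Cderive g z (dg z)) -> (0 < r)%R ->
  (forall v : R, g (p + (r * cos v, r * sin v)%R) = 0) -> g p = 0.
Proof.
intros D Hr Hz.
set (G := fun w => g (p + Cexp w)).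
assert (DG : forall w, is_Cderive G w ((0 + Cexp w) * dg (p + Cexp w))).
{ intros w. apply (is_Cderive_comp g (fun w => p + Cexp w)); [apply D|].
  apply is_Cderive_plus; [apply is_Cderive_const|apply is_Cderive_Cexp]. }
assert (CG : forall w, Ccontinuous_at G w) by (intros w; eapply is_Cderive_continuous, DG).
assert (Cg : Ccontinuous_at g p) by (eapply is_Cderive_continuous, D).
assert (HPI := PI_RGT_0).
assert (mean : forall u, (u <= ln r)%R -> CInt (fun y => G (u, y)) 0 (2 * PI) = 0).
{ intros u Hu.
  assert (H := goursat G u (ln r) 0 (2 * PI) Hu ltac:(lra) (fun x y _ _ => ex_intro _ _ (DG (x, y)))).
  unfold Crect in H.
  (* The horizontal sides cancel because [Cexp] has period [2 PI * Ci]. *)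
  assert (E1 : CInt (fun x => G (x, (2 * PI)%R)) u (ln r) = CInt (fun x => G (x, 0%R)) u (ln r)).
  { apply CInt_ext. intros x. unfold G, Cexp; simpl. rewrite cos_2PI, sin_2PI, cos_0, sin_0. reflexivity. }
  assert (E2 : CInt (fun y => G (ln r, y)) 0 (2 * PI) = 0).
  { transitivity (0 * CInt (fun _ => RtoC 1) 0 (2 * PI)); [|ring].
    apply CInt_unique. apply is_CInt_ext with (fun _ => 0 * 1).
    - intros y _. unfold G, Cexp; simpl. rewrite exp_ln by auto. rewrite Hz. ring.
    - apply is_CInt_mult, is_CInt_CInt. intros; apply Ccontinuous_const. }
  rewrite E1, E2 in H.
  set (I := CInt (fun y => G (u, y)) 0 (2 * PI)) in *.
  set (J := CInt (fun x => G (x, 0%R)) u (ln r)) in *.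
  transitivity (Ci * - (J + Ci * 0 - J - Ci * I) * / Ci * / Ci); [|rewrite H; field; apply Ci_nz].
  field. apply Ci_nz. }
apply Cmod_eq_0. apply Rle_antisym; [|apply Cmod_ge_0]. apply le_epsilon. intros e He.
apply filterlim_Cmod with (e := e) in Cg; auto; [|apply locally_filter].
apply locally_Cmod in Cg. destruct Cg as [d [Hd Hc]].
(* A radius small enough for the continuity of [g] at [p], and at most [r] so that the mean is known
   to vanish. *)
set (q := Rmin (d / 2) r). assert (Hq : (0 < q)%R) by (apply Rmin_pos; lra).
set (u := ln q).
assert (Hu : (u <= ln r)%R) by (apply ln_le; auto; apply Rmin_r).
assert (I0 : is_CInt (fun y => G (u, y)) 0 (2 * PI) 0).
{ generalize (mean u Hu). intros <-. apply is_CInt_CInt. intros; apply Ccontinuous_vertical, CG. }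
(* The mean of [G] being 0, this integral is [2 PI * g p], whereas its integrand stays below [e]. *)
assert (I1 : is_CInt (fun y => g p - G (u, y)) 0 (2 * PI) (scal (V := C_R_NormedModule) (2 * PI - 0)%R (g p) - 0)).
{ apply is_CInt_minus; auto. apply (is_RInt_const (V := C_R_NormedModule)). }
apply is_CInt_le_const with (M := e) in I1; [|lra|].
- rewrite scal_R_Cmult in I1. unfold Cminus in I1. rewrite Copp_0, Cplus_0_r in I1. rewrite Cmod_mult, Cmod_R in I1.
  rewrite Rabs_pos_eq in I1 by lra. apply Rmult_le_reg_l in I1; lra.
- intros y _. left. replace (g p - G (u, y)) with (- (G (u, y) - g p)) by ring. rewrite Cmod_opp.
  apply Hc. replace (p + Cexp (u, y) - p) with (Cexp (u, y)) by ring. rewrite Cmod_Cexp. simpl.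
  unfold u. rewrite exp_ln by auto. unfold q. generalize (Rmin_l (d / 2) r); lra.
Qed.

(** The arc with ordinate at most -1/2 is a third of the circle, so it meets every orbit of the
    rotation by 2 pi/3. Algebraically, adding 1/2 to each of the last two ordinates gives factors
    whose product is (2s + 1)(s - 1)/2, which is not positive for -1/2 < s <= 1. *)
Lemma three_sines (c s : R) :
  (c * c + s * s = 1)%R ->
  (s <= - / 2 \/ - / 2 * s + sqrt 3 / 2 * c <= - / 2 \/ - / 2 * s - sqrt 3 / 2 * c <= - / 2)%R.
Proof.
intros H.
destruct (Rle_lt_dec s (- / 2)) as [h1|h1]; auto.
destruct (Rle_lt_dec (- / 2 * s + sqrt 3 / 2 * c) (- / 2)) as [h2|h2]; auto.
destruct (Rle_lt_dec (- / 2 * s - sqrt 3 / 2 * c) (- / 2)) as [h3|h3]; auto.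
exfalso.
assert (H3 : (sqrt 3 * sqrt 3 = 3)%R) by (apply sqrt_sqrt; lra).
assert (0 < (/ 2 + (- / 2 * s + sqrt 3 / 2 * c)) * (/ 2 + (- / 2 * s - sqrt 3 / 2 * c)))%R
  by (apply Rmult_lt_0_compat; lra).
replace ((/ 2 + (- / 2 * s + sqrt 3 / 2 * c)) * (/ 2 + (- / 2 * s - sqrt 3 / 2 * c)))%R with
  (((1 - s) * (1 - s) - (sqrt 3 * sqrt 3) * (c * c)) / 4)%R in H0 by field.
rewrite H3 in H0. nra.
Qed.

(* On the circle of radius 5/2 around p, one of the three rotations of each point by multiples
   of 2 pi/3 falls into the strip, so the product of the rotated functions vanishes there. *)
Lemma entire_zero_extend (g dg : C -> C) (Y : R) (p : C) :
  (forall z, is_Cderive g z (dg z)) -> (3 / 2 <= Y)%R ->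
  (forall z, (Rabs (Im z) < Y)%R -> g z = 0) ->
  (0 <= Im p < Y + 1)%R -> g p = 0.
Proof.
intros D HY Hz Hp.
destruct (Rlt_le_dec (Im p) Y) as [h|h].
{ apply Hz. rewrite Rabs_pos_eq; lra. }
(* The two primitive cube roots of unity. *)
set (o1 := (- / 2, sqrt 3 / 2)%R : C). set (o2 := (- / 2, - (sqrt 3 / 2))%R : C).
set (P := fun z => g (p + z) * (g (p + o1 * z) * g (p + o2 * z))).
assert (Dr : forall o z, is_Cderive (fun z => g (p + o * z)) z ((0 + (0 * z + o * 1)) * dg (p + o * z))).
{ intros o z. apply (is_Cderive_comp g (fun z => p + o * z)); [apply D|].
  apply is_Cderive_plus; [apply is_Cderive_const|].
  apply (is_Cderive_mult (fun _ => o) (fun z => z)); [apply is_Cderive_const|apply is_Cderive_id]. }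
assert (D1 : forall z, is_Cderive (fun z => g (p + z)) z ((0 + 1) * dg (p + z))).
{ intros z. apply (is_Cderive_comp g (fun z => p + z)); [apply D|].
  apply is_Cderive_plus; [apply is_Cderive_const|apply is_Cderive_id]. }
assert (HP : P 0 = 0).
(* A radius of at least 2 brings ordinates [Im p - r / 2] below [Y]; a radius below [2 * Y] keeps
   [Im p - r] above [- Y]. As [Y >= 3 / 2], the value 5/2 does both. *)
{ eapply entire_zero_of_circle with (r := (5 / 2)%R); [|lra|].
  - intros z. apply (is_Cderive_mult (fun z => g (p + z)) (fun z => g (p + o1 * z) * g (p + o2 * z))); [apply D1|].
    apply (is_Cderive_mult (fun z => g (p + o1 * z)) (fun z => g (p + o2 * z))); apply Dr.
  - intros v. set (c := cos v). set (s := sin v).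
    assert (Hcs : (c * c + s * s = 1)%R).
    { generalize (sin2_cos2 v). unfold Rsqr; fold c s; lra. }
    assert (small : forall x : R, (- (1) <= x <= - / 2)%R -> (Rabs (Im p + 5 / 2 * x) < Y)%R)
      by (intros x Hx; apply Rabs_def1; lra).
    assert (bd : forall x y : R, (x * x + y * y = 1)%R -> (- (1) <= y)%R) by (intros; nra).
    assert (H3 : (sqrt 3 * sqrt 3 = 3)%R) by (apply sqrt_sqrt; lra).
    unfold P. destruct (three_sines c s Hcs) as [H|[H|H]].
    + rewrite (Hz (p + _)); [ring|].
      replace (Im (p + (0 + (5 / 2 * c, 5 / 2 * s)%R))) with (Im p + 5 / 2 * s)%R by (simpl; unfold Im; ring).
      apply small. split; auto. now apply (bd c).
    + rewrite (Hz (p + o1 * _)); [ring|].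
      replace (Im (p + o1 * (0 + (5 / 2 * c, 5 / 2 * s)%R))) with (Im p + 5 / 2 * (- / 2 * s + sqrt 3 / 2 * c))%R
        by (simpl; unfold Im; ring).
      apply small. split; auto. apply (bd (- / 2 * c - sqrt 3 / 2 * s)%R).
      transitivity ((c * c + s * s) * (/ 4 + sqrt 3 * sqrt 3 / 4))%R; [field|rewrite Hcs, H3; field].
    + rewrite (Hz (p + o2 * _)); [ring|].
      replace (Im (p + o2 * (0 + (5 / 2 * c, 5 / 2 * s)%R))) with (Im p + 5 / 2 * (- / 2 * s - sqrt 3 / 2 * c))%R
        by (simpl; unfold Im; ring).
      apply small. split; auto. apply (bd (- / 2 * c + sqrt 3 / 2 * s)%R).
      transitivity ((c * c + s * s) * (/ 4 + sqrt 3 * sqrt 3 / 4))%R; [field|rewrite Hcs, H3; field]. }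
(* All three factors equal [g p] at 0, so [HP] says that the cube of [g p] is 0. *)
unfold P in HP. rewrite !Cmult_0_r, !Cplus_0_r in HP.
destruct (Ceq_dec (g p) 0) as [H|H]; auto.
exfalso. revert HP. repeat apply Cmult_neq_0; auto.
Qed.

(** Each extension widens the strip by 1, the lower half by the reflection [z -> - z]. The
    half-width 3/2 is the least one accepted by the extension, and it is below pi/2, so the
    exponential maps the strip into the right half-plane. *)
Lemma entire_zero_of_strip (g dg : C -> C) :
  (forall z, is_Cderive g z (dg z)) ->
  (forall z, (Rabs (Im z) < 3 / 2)%R -> g z = 0) -> forall z, g z = 0.
Proof.
intros D Hz.
assert (H : forall n z, (Rabs (Im z) < 3 / 2 + INR n)%R -> g z = 0).
{ induction n as [|n IH].
  - intros z Hn. apply Hz. simpl in Hn. lra.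
  - intros z Hn. rewrite S_INR in Hn. apply Rabs_lt_between in Hn.
    assert (HY : (3 / 2 <= 3 / 2 + INR n)%R) by (generalize (pos_INR n); lra).
    destruct (Rle_lt_dec 0 (Im z)) as [h|h].
    + apply (entire_zero_extend g dg (3 / 2 + INR n)); auto. lra.
    + replace z with (- - z) by ring.
      apply (entire_zero_extend (fun z => g (- z)) (fun z => - (1) * dg (- z)) (3 / 2 + INR n)); auto.
      * intros w. apply (is_Cderive_comp g (fun w => - w)); [apply D|].
        apply is_Cderive_opp, is_Cderive_id.
      * intros w Hw. apply IH. simpl. change (Rabs (- Im w) < 3 / 2 + INR n)%R. now rewrite Rabs_Ropp.
      * change (Im (- z)) with (- Im z)%R. lra. }
intros z. destruct (nfloor_ex (Rabs (Im z)) (Rabs_pos _)) as [n Hn].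
apply (H (S n)). rewrite S_INR. lra.
Qed.

(* The map w |-> 1 + exp w makes the difference of F1 and F2 entire and sends a strip into Re > 1. *)
Lemma hurwitz_zeta_unique (a : C) (F1 F2 : C -> C) (s : C) :
  is_hurwitz_zeta a F1 -> is_hurwitz_zeta a F2 -> s <> 1 -> F1 s = F2 s.
Proof.
intros [S1 [D1 _]] [S2 [D2 _]] Hs.
assert (Hne : forall w, 1 + Cexp w <> 1).
{ intros w H. apply (Cexp_neq_0 w). replace (Cexp w) with (1 + Cexp w - 1) by ring. rewrite H; ring. }
assert (Ha : forall w, exists l, is_Cderive (fun w => F1 (1 + Cexp w) - F2 (1 + Cexp w)) w l).
{ intros w. destruct (D1 _ (Hne w)) as [l1 H1]. destruct (D2 _ (Hne w)) as [l2 H2].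
  eexists. apply is_Cderive_minus.
  - apply (is_Cderive_comp F1 (fun w => 1 + Cexp w)); [exact H1|].
    apply is_Cderive_plus; [apply is_Cderive_const|apply is_Cderive_Cexp].
  - apply (is_Cderive_comp F2 (fun w => 1 + Cexp w)); [exact H2|].
    apply is_Cderive_plus; [apply is_Cderive_const|apply is_Cderive_Cexp]. }
assert (Z := entire_zero_of_strip _ _ (fun w => proj2_sig (constructive_indefinite_description _ (Ha w)))).
assert (Hs' : s - 1 <> 0) by (now apply Cminus_eq_contra).
replace s with (1 + Cexp (Cln (s - 1))) by (rewrite Cexp_Cln by auto; ring).
apply Ceq_minus. apply Z. clear Z.
intros w Hw. apply (proj1 (Ceq_minus _ _)).
assert (Hr : (1 < Re (1 + Cexp w))%R).
{ simpl. assert (0 < exp (Re w) * cos (Im w))%R; [|unfold Re, Im in *; lra].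
  apply Rmult_lt_0_compat; [apply exp_pos|].
  apply Rabs_lt_between in Hw. generalize PI2_3_2; intros. apply cos_gt_0; lra. }
specialize (S1 _ Hr). specialize (S2 _ Hr).
rewrite is_series_Csum in S1, S2.
exact (filterlim_locally_unique (V := C_NormedModule) _ _ _ S1 S2).
Qed.

(** * Improper integrals and dominated convergence *)

Notation Clim u l := (filterlim (u : nat -> C) eventually (Clocally (l%C : C))).

Lemma Clim_Cmod (u : nat -> C) (l : C) :
  Clim u l <-> forall e : R, (0 < e)%R -> exists N : nat, forall n, (N <= n)%nat -> (Cmod (u n - l) < e)%R.
Proof. exact (filterlim_Cmod eventually u l). Qed.

Lemma Clim_unique (u : nat -> C) (l m : C) : Clim u l -> Clim u m -> l = m.
Proof. apply (filterlim_locally_unique (V := C_NormedModule)). Qed.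

Lemma Clim_ext (u v : nat -> C) (l : C) : (forall n, u n = v n) -> Clim u l -> Clim v l.
Proof. apply filterlim_ext. Qed.

Lemma Clim_const (l : C) : Clim (fun _ => l) l.
Proof. apply filterlim_const. Qed.

Lemma Clim_plus (u v : nat -> C) (l m : C) :
  Clim u l -> Clim v m -> Clim (fun n => u n + v n) (l + m).
Proof.
intros Hu Hv.
apply (filterlim_comp_2 (F := eventually) u v Cplus Hu Hv).
exact (filterlim_plus (V := C_NormedModule) l m).
Qed.

Lemma Clim_mult (c : C) (u : nat -> C) (l : C) :
  Clim u l -> Clim (fun n => c * u n) (c * l).
Proof.
intros Hu.
apply (filterlim_comp _ _ _ u (fun z => c * z) _ _ _ Hu).
apply (Ccontinuous_mult (fun _ => c) (fun z : C_UniformSpace => z)); [apply continuous_const|apply continuous_id].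
Qed.

Lemma Clim_minus (u v : nat -> C) (l m : C) :
  Clim u l -> Clim v m -> Clim (fun n => u n - v n) (l - m).
Proof.
intros Hu Hv. replace (l - m) with (l + (- (1)) * m) by ring.
apply Clim_ext with (fun n => u n + (- (1)) * v n); [intros n; ring|].
apply Clim_plus; auto. now apply Clim_mult.
Qed.

Lemma Clim_bound (u : nat -> C) (l : C) (v : nat -> R) (N0 : nat) :
  (forall n, (N0 <= n)%nat -> (Cmod (u n - l) <= v n)%R) -> is_lim_seq v 0%R -> Clim u l.
Proof.
intros H Hv. apply Clim_Cmod. intros e He.
apply is_lim_seq_spec in Hv. destruct (Hv (mkposreal e He)) as [N HN].
exists (max N N0). intros n Hn. specialize (HN n ltac:(lia)). simpl in HN.
rewrite Rminus_0_r in HN. apply Rabs_lt_between in HN. specialize (H n ltac:(lia)). lra.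
Qed.

(** Symmetric integer cut-offs are those of the contours, whose horizontal sides lie at height [n]
    and [- n]. *)
Definition is_CIntR (f : R -> C) (l : C) : Prop :=
  exists u : nat -> C, (forall n, is_CInt f (- INR n) (INR n) (u n)) /\ Clim u l.

Lemma is_CIntR_unique (f : R -> C) (l m : C) : is_CIntR f l -> is_CIntR f m -> l = m.
Proof.
intros [u [Hu Lu]] [v [Hv Lv]]. apply (Clim_unique u); auto.
apply Clim_ext with v; auto.
intros n. rewrite <- (CInt_unique _ _ _ _ (Hu n)). now rewrite <- (CInt_unique _ _ _ _ (Hv n)).
Qed.

Lemma is_CIntR_ext (f g : R -> C) (l : C) :
  (forall t, f t = g t) -> is_CIntR f l -> is_CIntR g l.
Proof.
intros H [u [Hu Lu]]. exists u; split; auto. intros n; apply is_CInt_ext with f; auto.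
Qed.

Lemma is_CIntR_plus (f g : R -> C) (l m : C) :
  is_CIntR f l -> is_CIntR g m -> is_CIntR (fun t => f t + g t) (l + m).
Proof.
intros [u [Hu Lu]] [v [Hv Lv]]. exists (fun n => u n + v n); split.
- intros n; now apply is_CInt_plus.
- now apply Clim_plus.
Qed.

Lemma is_CIntR_minus (f g : R -> C) (l m : C) :
  is_CIntR f l -> is_CIntR g m -> is_CIntR (fun t => f t - g t) (l - m).
Proof.
intros [u [Hu Lu]] [v [Hv Lv]]. exists (fun n => u n - v n); split.
- intros n; now apply is_CInt_minus.
- now apply Clim_minus.
Qed.

Lemma is_CIntR_mult (c : C) (f : R -> C) (l : C) :
  is_CIntR f l -> is_CIntR (fun t => c * f t) (c * l).
Proof.
intros [u [Hu Lu]]. exists (fun n => c * u n); split.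
- intros n; now apply is_CInt_mult.
- now apply Clim_mult.
Qed.

Lemma is_CIntR_Csum (f : nat -> R -> C) (l : nat -> C) (n : nat) :
  (forall k, is_CIntR (f k) (l k)) -> is_CIntR (fun t => Csum (fun k => f k t) n) (Csum l n).
Proof.
intros H. induction n as [|n IH]; simpl.
- apply is_CIntR_ext with (fun t => 0 * f 0%nat t); [intros; ring|].
  replace (RtoC 0) with (0 * l 0%nat) at 1 by ring. now apply is_CIntR_mult.
- now apply is_CIntR_plus.
Qed.

(** The only kind of majorant in use: it has an elementary primitive, which makes every tail
    estimate explicit in [B] and [tau]. *)
Definition dominated (tau B : R) (f : R -> C) : Prop :=
  (forall t, Ccontinuous f t) /\
  forall t, (Cmod (f t) <= B * Rpower (1 + Rabs t) (- tau))%R.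

Lemma Rpower_pos (x y : R) : (0 < Rpower x y)%R.
Proof. apply exp_pos. Qed.

Lemma dominated_pos (tau B : R) (f : R -> C) : dominated tau B f -> (0 <= B)%R.
Proof.
intros [_ H]. specialize (H 0%R). generalize (Cmod_ge_0 (f 0%R)) (Rpower_pos (1 + Rabs 0) (- tau)).
intros. destruct (Rle_lt_dec 0 B); auto. nra.
Qed.

Lemma is_RInt_tail_right (tau a b : R) :
  (1 < tau)%R -> (0 <= a <= b)%R ->
  is_RInt (fun t => Rpower (1 + Rabs t) (- tau)) a b
    ((Rpower (1 + a) (1 - tau) - Rpower (1 + b) (1 - tau)) / (tau - 1))%R.
Proof.
intros Ht Hab.
apply is_RInt_ext with (fun t => Rpower (1 + t) (- tau)).
{ intros t. rewrite Rmin_left, Rmax_right by lra. intros Htt. now rewrite Rabs_pos_eq by lra. }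
assert (E : ((Rpower (1 + a) (1 - tau) - Rpower (1 + b) (1 - tau)) / (tau - 1))%R =
  minus (- Rpower (1 + b) (1 - tau) / (tau - 1))%R (- Rpower (1 + a) (1 - tau) / (tau - 1))%R)
  by (unfold minus, plus, opp; simpl; field; lra).
rewrite E.
apply (is_RInt_derive (V := R_CompleteNormedModule) (fun t => - Rpower (1 + t) (1 - tau) / (tau - 1))%R).
- intros t. rewrite Rmin_left, Rmax_right by lra. intros Htt.
  replace (1 - tau)%R with (- tau + 1)%R by ring.
  unfold Rpower. auto_derive; [lra|].
  replace ((- tau + 1) * ln (1 + t))%R with (- tau * ln (1 + t) + ln (1 + t))%R by ring.
  rewrite exp_plus, exp_ln by lra. field. lra.
- intros t. rewrite Rmin_left, Rmax_right by lra. intros Htt.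
  apply (ex_derive_continuous (K := R_AbsRing) (V := R_NormedModule)). unfold Rpower. auto_derive. lra.
Qed.

Lemma is_RInt_tail_left (tau a b : R) :
  (1 < tau)%R -> (0 <= a <= b)%R ->
  is_RInt (fun t => Rpower (1 + Rabs t) (- tau)) (- b) (- a)
    ((Rpower (1 + a) (1 - tau) - Rpower (1 + b) (1 - tau)) / (tau - 1))%R.
Proof.
intros Ht Hab.
apply is_RInt_ext with (fun t => Rpower (1 - t) (- tau)).
{ intros t. rewrite Rmin_left, Rmax_right by lra. intros Htt. rewrite Rabs_left by lra. reflexivity. }
assert (E : ((Rpower (1 + a) (1 - tau) - Rpower (1 + b) (1 - tau)) / (tau - 1))%R =
  minus (Rpower (1 - - a) (1 - tau) / (tau - 1))%R (Rpower (1 - - b) (1 - tau) / (tau - 1))%R).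
{ unfold minus, plus, opp; simpl. replace (1 - - a)%R with (1 + a)%R by ring.
  replace (1 - - b)%R with (1 + b)%R by ring. field; lra. }
rewrite E.
apply (is_RInt_derive (V := R_CompleteNormedModule) (fun t => Rpower (1 - t) (1 - tau) / (tau - 1))%R).
- intros t. rewrite Rmin_left, Rmax_right by lra. intros Htt.
  replace (1 - tau)%R with (- tau + 1)%R by ring.
  unfold Rpower. auto_derive; [lra|].
  replace (1 + - t)%R with (1 - t)%R by ring.
  replace ((- tau + 1) * ln (1 - t))%R with (- tau * ln (1 - t) + ln (1 - t))%R by ring.
  rewrite exp_plus, exp_ln by lra. field. lra.
- intros t. rewrite Rmin_left, Rmax_right by lra. intros Htt.
  apply (ex_derive_continuous (K := R_AbsRing) (V := R_NormedModule)). unfold Rpower. auto_derive. lra.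
Qed.

Lemma dominated_CInt_tail (tau B : R) (f : R -> C) (m n : nat) :
  (1 < tau)%R -> dominated tau B f -> (m <= n)%nat ->
  (Cmod (CInt f (- INR n) (INR n) - CInt f (- INR m) (INR m))
   <= 2 * B / (tau - 1) * Rpower (1 + INR m) (1 - tau))%R.
Proof.
intros Ht D Hmn. assert (HB := dominated_pos _ _ _ D). destruct D as [Hc Hb].
assert (Hm := pos_INR m). assert (Hmn' := le_INR _ _ Hmn).
assert (I : forall a b, is_CInt f a b (CInt f a b)) by (intros; apply is_CInt_CInt; auto).
assert (E : CInt f (- INR n) (INR n) =
  CInt f (- INR n) (- INR m) + CInt f (- INR m) (INR m) + CInt f (INR m) (INR n)).
{ apply CInt_unique. apply is_CInt_Chasles with (INR m); auto. apply is_CInt_Chasles with (- INR m)%R; auto. }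
rewrite E.
replace (_ + _ + _ - _) with (CInt f (- INR n) (- INR m) + CInt f (INR m) (INR n)) by ring.
eapply Rle_trans; [apply Cmod_triangle|].
set (T := ((Rpower (1 + INR m) (1 - tau) - Rpower (1 + INR n) (1 - tau)) / (tau - 1))%R).
assert (HT : (T <= Rpower (1 + INR m) (1 - tau) / (tau - 1))%R).
{ unfold T, Rdiv. apply Rmult_le_compat_r; [left; apply Rinv_0_lt_compat; lra|].
  generalize (Rpower_pos (1 + INR n) (1 - tau)); lra. }
assert (H1 : (Cmod (CInt f (- INR n) (- INR m)) <= B * T)%R).
{ apply is_CInt_le with f (fun t => B * Rpower (1 + Rabs t) (- tau))%R (- INR n)%R (- INR m)%R; auto; [lra|].
  apply (is_RInt_scal (V := R_NormedModule)). apply is_RInt_tail_left; lra. }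
assert (H2 : (Cmod (CInt f (INR m) (INR n)) <= B * T)%R).
{ apply is_CInt_le with f (fun t => B * Rpower (1 + Rabs t) (- tau))%R (INR m)%R (INR n)%R; auto.
  apply (is_RInt_scal (V := R_NormedModule)). apply is_RInt_tail_right; lra. }
replace (2 * B / (tau - 1) * Rpower (1 + INR m) (1 - tau))%R with
 (2 * (B * (Rpower (1 + INR m) (1 - tau) / (tau - 1))))%R by (field; lra).
assert (B * T <= B * (Rpower (1 + INR m) (1 - tau) / (tau - 1)))%R by (apply Rmult_le_compat_l; lra).
lra.
Qed.

Lemma Rpower_neg_lim (d : R) : (0 < d)%R -> is_lim_seq (fun n => Rpower (1 + INR n) (- d)) 0%R.
Proof.
intros Hd. apply is_lim_seq_spec. intros e.
destruct (nfloor_ex (exp (- ln e / d))) as [N HN]; [left; apply exp_pos|].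
exists N. intros n Hn. rewrite Rminus_0_r, Rabs_pos_eq by (left; apply Rpower_pos).
unfold Rpower. rewrite <- (exp_ln e) by apply cond_pos. apply exp_increasing.
assert (Hn' := le_INR _ _ Hn).
assert (H : (- ln e / d < ln (1 + INR n))%R).
{ rewrite <- (ln_exp (- ln e / d)). apply ln_increasing; [apply exp_pos|lra]. }
apply Rlt_div_l in H; auto. lra.
Qed.

Lemma Rpower_neg_lim_scal (c d : R) :
  (0 < d)%R -> is_lim_seq (fun n => (c * Rpower (1 + INR n) (- d))%R) 0%R.
Proof.
intros Hd. replace 0%R with (c * 0)%R by ring.
apply (is_lim_seq_scal_l _ c 0%R). now apply Rpower_neg_lim.
Qed.

(** The tail estimate makes the truncated integrals a Cauchy sequence and survives in the limit as
    an error bound. *)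
Lemma dominated_is_CIntR (tau B : R) (f : R -> C) :
  (1 < tau)%R -> dominated tau B f ->
  exists l, is_CIntR f l /\
   forall n, (Cmod (l - CInt f (- INR n) (INR n)) <= 2 * B / (tau - 1) * Rpower (1 + INR n) (1 - tau))%R.
Proof.
intros Ht D.
assert (HB := dominated_pos _ _ _ D).
set (u := fun n => CInt f (- INR n) (INR n)).
set (T := fun n => (2 * B / (tau - 1) * Rpower (1 + INR n) (1 - tau))%R).
assert (HT : is_lim_seq T 0%R).
{ apply is_lim_seq_ext with (fun n => 2 * B / (tau - 1) * Rpower (1 + INR n) (- (tau - 1)))%R.
  - intros n; unfold T; do 2 f_equal; ring.
  - apply Rpower_neg_lim_scal; lra. }
assert (Hu : forall m n, (m <= n)%nat -> (Cmod (u n - u m) <= T m)%R)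
  by (intros; now apply dominated_CInt_tail).
assert (HL : exists l, Clim u l).
{ apply (filterlim_locally_cauchy (U := C_R_CompleteNormedModule) (F := eventually)).
  intros e. apply is_lim_seq_spec in HT.
  destruct (HT (mkposreal (e / 2) (is_pos_div_2 e))) as [N HN].
  exists (fun n => (N <= n)%nat). split; [now exists N|].
  intros m n Hm Hn.
  specialize (HN N (le_n N)). simpl in HN. rewrite Rminus_0_r in HN. apply Rabs_lt_between in HN.
  assert (Hk : (Cmod (u n - u m) < e)%R).
  { replace (u n - u m) with ((u n - u N) + - (u m - u N)) by ring.
    eapply Rle_lt_trans; [apply Cmod_triangle|]. rewrite Cmod_opp.
    generalize (Hu N n Hn) (Hu N m Hm). lra. }
  split; (eapply Rle_lt_trans; [|exact Hk]).
  - exact (re_le_Cmod (u n - u m)).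
  - exact (im_le_Cmod (u n - u m)). }
destruct HL as [l Hl]. exists l. split.
{ exists u. split; auto. intros n. apply is_CInt_CInt. intros; apply D. }
intros n. apply le_epsilon. intros e He.
destruct (proj1 (Clim_Cmod _ _) Hl e He) as [N HN].
assert (H1 := HN (max N n) (Nat.le_max_l _ _)).
assert (H2 := Hu n (max N n) (Nat.le_max_r _ _)).
change (Cmod (l - u n) <= T n + e)%R.
replace (l - u n) with (- (u (max N n) - l) + (u (max N n) - u n)) by ring.
eapply Rle_trans; [apply Cmod_triangle|]. rewrite Cmod_opp. lra.
Qed.

Lemma dominated_CIntR_tail (tau B : R) (f : R -> C) (l : C) (n : nat) :
  (1 < tau)%R -> dominated tau B f -> is_CIntR f l ->
  (Cmod (l - CInt f (- INR n) (INR n)) <= 2 * B / (tau - 1) * Rpower (1 + INR n) (1 - tau))%R.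
Proof.
intros Ht D H. destruct (dominated_is_CIntR tau B f Ht D) as [m [Hm Hb]].
now rewrite (is_CIntR_unique f l m).
Qed.

Lemma dominated_CIntR_bound (tau B : R) (f : R -> C) (l : C) :
  (1 < tau)%R -> dominated tau B f -> is_CIntR f l -> (Cmod l <= 2 * B / (tau - 1))%R.
Proof.
intros Ht D H. assert (H0 := dominated_CIntR_tail tau B f l 0 Ht D H).
simpl in H0. rewrite Ropp_0 in H0.
replace (CInt f 0 0) with (RtoC 0) in H0.
- replace (l - 0) with l in H0 by ring. rewrite Rplus_0_r in H0.
  unfold Rpower in H0 at 1. rewrite ln_1, Rmult_0_r, exp_0, Rmult_1_r in H0. exact H0.
- symmetry. apply CInt_unique. apply (is_RInt_point (V := C_R_NormedModule)).
Qed.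

(** The common majorant makes all tails beyond some [N] small at once; on the remaining interval the
    uniform convergence applies. The sequences are remainders, hence the limit 0. *)
Lemma dominated_convergence (tau B : R) (f : nat -> R -> C) (l : nat -> C) :
  (1 < tau)%R -> (forall k, dominated tau B (f k)) -> (forall k, is_CIntR (f k) (l k)) ->
  (forall (N : nat) (e : R), (0 < e)%R -> exists K : nat, forall (k : nat) (t : R),
     (K <= k)%nat -> (Rabs t <= INR N)%R -> (Cmod (f k t) <= e)%R) ->
  Clim l 0.
Proof.
intros Ht D HI HU. apply Clim_Cmod. intros e He.
assert (HB := dominated_pos _ _ _ (D 0%nat)).
assert (HT : is_lim_seq (fun n => (2 * B / (tau - 1) * Rpower (1 + INR n) (1 - tau))%R) 0%R).
{ apply is_lim_seq_ext with (fun n => 2 * B / (tau - 1) * Rpower (1 + INR n) (- (tau - 1)))%R.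
  - intros n; do 2 f_equal; ring.
  - apply Rpower_neg_lim_scal; lra. }
apply is_lim_seq_spec in HT.
destruct (HT (mkposreal (e / 2) ltac:(lra))) as [N HN]. specialize (HN N (le_n N)).
simpl in HN. rewrite Rminus_0_r in HN. apply Rabs_lt_between in HN.
assert (HNN := pos_INR N).
(* Over an interval of length [2 * INR N] this tolerance contributes at most [e / 2]. *)
destruct (HU N (e / (4 * (INR N + 1)))%R) as [K HK].
{ apply Rdiv_lt_0_compat; lra. }
exists K. intros k Hk. replace (l k - 0) with (l k) by ring.
assert (H1 := dominated_CIntR_tail tau B (f k) (l k) N Ht (D k) (HI k)).
assert (H2 : (Cmod (CInt (f k) (- INR N) (INR N)) <= (INR N - - INR N) * (e / (4 * (INR N + 1))))%R).
{ apply is_CInt_le_const with (f k); [lra| |].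
  - intros t Htt. apply HK; auto. apply Rabs_le; lra.
  - apply is_CInt_CInt. intros; apply (D k). }
replace (l k) with ((l k - CInt (f k) (- INR N) (INR N)) + CInt (f k) (- INR N) (INR N)) by ring.
eapply Rle_lt_trans; [apply Cmod_triangle|].
assert ((INR N - - INR N) * (e / (4 * (INR N + 1))) <= e / 2)%R.
{ replace ((INR N - - INR N) * (e / (4 * (INR N + 1))))%R with (e / 2 * (INR N / (INR N + 1)))%R by (field; lra).
  assert (INR N / (INR N + 1) <= 1)%R by (apply Rle_div_l; lra). nra. }
lra.
Qed.

(** * The kernel *)

Lemma RtoC_neq_0 (x : R) : x <> 0%R -> RtoC x <> 0.
Proof. intros H E. now apply RtoC_inj in E. Qed.

Lemma exp_le (x y : R) : (x <= y)%R -> (exp x <= exp y)%R.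
Proof. intros [H| ->]; [left; now apply exp_increasing|lra]. Qed.

Lemma is_Cderive_Csin (z : C) : is_Cderive Csin z (Ccos z).
Proof.
assert (H2i : 2 * Ci <> 0) by (apply Cmult_neq_0; [apply RtoC_neq_0; lra|apply Ci_nz]).
apply is_Cderive_eq with
 (((0 * z + Ci * 1) * Cexp (Ci * z) - - (0 * z + Ci * 1) * Cexp (- (Ci * z))) * / (2 * Ci) +
  (Cexp (Ci * z) - Cexp (- (Ci * z))) * 0).
- assert (D : is_Cderive (fun w => Ci * w) z (0 * z + Ci * 1)).
  { apply (is_Cderive_mult (fun _ => Ci) (fun w => w)); [apply is_Cderive_const|apply is_Cderive_id]. }
  apply (is_Cderive_mult (fun w => Cexp (Ci * w) - Cexp (- (Ci * w))) (fun _ => / (2 * Ci)));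
   [|apply is_Cderive_const].
  apply is_Cderive_minus.
  + apply (is_Cderive_comp Cexp (fun w => Ci * w)); [apply is_Cderive_Cexp|auto].
  + apply (is_Cderive_comp Cexp (fun w => - (Ci * w))); [apply is_Cderive_Cexp|].
    now apply is_Cderive_opp.
- unfold Ccos. field. apply Ci_nz.
Qed.

Lemma Csin_eq (x y : R) : Csin (x, y) = ((sin x * cosh y)%R, (cos x * sinh y)%R).
Proof.
unfold Csin.
transitivity ((Cexp (Ci * (x, y)) - Cexp (- (Ci * (x, y)))) * (- Ci / 2)).
- replace (- Ci / 2) with (/ Ci / 2) by (rewrite Ci_inv; reflexivity). field. apply Ci_nz.
- replace (- Ci / 2) with (0, (- / 2))%R by (apply C_ext; simpl; field).
  unfold Cexp, sinh, cosh. simpl.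
  replace (0 * x - 1 * y)%R with (- y)%R by ring. replace (0 * y + 1 * x)%R with x by ring.
  rewrite Ropp_involutive, cos_neg, sin_neg. apply C_ext; simpl; field.
Qed.

(** This identity locates the zeros of the sine in the strip and bounds it from below, uniformly in
    [x], far from the real axis. *)
Lemma Cmod2_Csin (x y : R) :
  (Cmod (Csin (x, y)) * Cmod (Csin (x, y)) = sin x * sin x + sinh y * sinh y)%R.
Proof.
rewrite Cmod2_eq, Csin_eq. simpl.
assert (H1 : (cosh y * cosh y = 1 + sinh y * sinh y)%R).
{ unfold cosh, sinh. assert (H : (exp y * exp (- y) = 1)%R) by (rewrite <- exp_plus, Rplus_opp_r; apply exp_0). nra. }
assert (H2 : (cos x * cos x = 1 - sin x * sin x)%R) by (generalize (sin2_cos2 x); unfold Rsqr; lra).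
replace (sin x * cosh y * (sin x * cosh y))%R with (sin x * sin x * (cosh y * cosh y))%R by ring.
replace (cos x * sinh y * (cos x * sinh y))%R with (cos x * cos x * (sinh y * sinh y))%R by ring.
rewrite H1, H2. ring.
Qed.

(** Cauchy's theorem around a singularity of size o(1/|w|). Four rectangles around a small central
    square avoid the origin; the perimeter of the square shrinks like [q] while [f] on it is
    o(1/q). *)
Lemma goursat_punctured (f : C -> C) (X Y : R) :
  (0 < X)%R -> (0 < Y)%R ->
  (forall x y, (- X <= x <= X)%R -> (- Y <= y <= Y)%R -> (x <> 0 \/ y <> 0)%R ->
     exists l, is_Cderive f (x, y) l) ->
  (forall e, (0 < e)%R -> exists d, (0 < d)%R /\
     forall w : C, w <> 0 -> (Cmod w < d)%R -> (Cmod (f w) <= e / Cmod w)%R) ->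
  Crect f (- X) X (- Y) Y = 0.
Proof.
intros HX HY D Hs.
assert (Hc : forall x y, (- X <= x <= X)%R -> (- Y <= y <= Y)%R -> (x <> 0 \/ y <> 0)%R -> Ccontinuous_at f (x, y)).
{ intros x y h1 h2 h3. destruct (D x y h1 h2 h3) as [l Hl]. now apply is_Cderive_continuous in Hl. }
apply Cmod_eq_0. apply Rle_antisym; [|apply Cmod_ge_0]. apply le_epsilon. intros e He.
rewrite Rplus_0_l.
destruct (Hs (e / 8)%R ltac:(lra)) as [d [Hd Hf]].
(* Points of the square have modulus at most [2 * q], which is below [d]; its perimeter [8 * q]
   accounts for the tolerance [e / 8]. *)
set (q := Rmin (d / 3) (Rmin X Y)).
assert (Hq : (0 < q)%R) by (repeat apply Rmin_pos; lra).
assert (Hq1 : (q <= d / 3)%R) by apply Rmin_l.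
assert (Hq2 : (q <= X)%R) by (eapply Rle_trans; [apply Rmin_r|apply Rmin_l]).
assert (Hq3 : (q <= Y)%R) by (eapply Rle_trans; [apply Rmin_r|apply Rmin_r]).
rewrite (Crect_split_x f (- X) (- q) X); [|lra|intros; apply Hc; (lra || (right; lra))..].
rewrite (Crect_split_x f (- q) q X); [|lra|intros; apply Hc; (lra || (right; lra))..].
rewrite (Crect_split_y f (- q) q (- Y) (- q) Y); [|lra|intros; apply Hc; (lra || (left; lra))..].
rewrite (Crect_split_y f (- q) q (- q) q Y); [|lra|intros; apply Hc; (lra || (left; lra))..].
rewrite (goursat f (- X) (- q) (- Y) Y); [|lra|lra|intros; apply D; (lra || (left; lra))].
rewrite (goursat f q X (- Y) Y); [|lra|lra|intros; apply D; (lra || (left; lra))].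
rewrite (goursat f (- q) q (- Y) (- q)); [|lra|lra|intros; apply D; (lra || (right; lra))].
rewrite (goursat f (- q) q q Y); [|lra|lra|intros; apply D; (lra || (right; lra))].
rewrite !Cplus_0_l, !Cplus_0_r.
assert (B : forall x y, (- q <= x <= q)%R -> (- q <= y <= q)%R -> (Rabs x = q \/ Rabs y = q) ->
  Ccontinuous_at f (x, y) /\ (Cmod (f (x, y)) <= e / 8 / q)%R).
{ intros x y hx hy h.
  assert (hn : (x <> 0 \/ y <> 0)%R).
  { destruct h as [h|h]; [left|right]; intros h'; rewrite h', Rabs_R0 in h; lra. }
  assert (hm : (q <= Cmod (x, y))%R).
  { destruct h as [<-|<-]; [apply (re_le_Cmod (x, y))|apply (im_le_Cmod (x, y))]. }
  split; [apply Hc; lra|].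
  eapply Rle_trans; [apply Hf|].
  - apply Cmod_gt_0; lra.
  - eapply Rle_lt_trans; [apply Cmod_le_Rabs|]. simpl.
    assert (Rabs x <= q)%R by (apply Rabs_le; lra). assert (Rabs y <= q)%R by (apply Rabs_le; lra). lra.
  - unfold Rdiv. apply Rmult_le_compat_l; [lra|]. apply Rinv_le_contravar; auto. }
eapply Rle_trans; [apply Crect_bound with (M := (e / 8 / q)%R)|right; field; lra]; try lra;
intros; apply B; try lra; [right|right|left|left]; rewrite ?Rabs_Ropp; apply Rabs_pos_eq; lra.
Qed.

(* Both sides of the strip |Re w| <= 1/2 carry the weight [sech2] as boundary values of [csc2]. *)
Definition sech2 (t : R) : R := (PI / 2 / (cosh (PI * t) * cosh (PI * t)))%R.
Definition csc2 (w : C) : C := RtoC (PI / 2) * / (Csin (RtoC PI * w) * Csin (RtoC PI * w)).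

Lemma cosh_pos (x : R) : (0 < cosh x)%R.
Proof. unfold cosh. generalize (exp_pos x) (exp_pos (- x)); lra. Qed.

Lemma csc2_half (t : R) : csc2 ((/ 2)%R, t) = RtoC (sech2 t) /\ csc2 ((- / 2)%R, t) = RtoC (sech2 t).
Proof.
assert (Hc := cosh_pos (PI * t)).
assert (H1 : Csin (RtoC PI * ((/ 2)%R, t)) = RtoC (cosh (PI * t))).
{ replace (RtoC PI * ((/ 2)%R, t)) with ((PI / 2)%R, (PI * t)%R) by (apply C_ext; simpl; field).
  rewrite Csin_eq, sin_PI2, cos_PI2. apply C_ext; simpl; ring. }
assert (H2 : Csin (RtoC PI * ((- / 2)%R, t)) = RtoC (- cosh (PI * t))).
{ replace (RtoC PI * ((- / 2)%R, t)) with ((- (PI / 2))%R, (PI * t)%R) by (apply C_ext; simpl; field).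
  rewrite Csin_eq, sin_neg, cos_neg, sin_PI2, cos_PI2. apply C_ext; simpl; ring. }
unfold csc2, sech2. rewrite H1, H2, RtoC_opp, (RtoC_div (PI / 2)), RtoC_mult by nra. assert (RtoC (cosh (PI * t)) <> 0) by (apply RtoC_neq_0; lra).
split; field; auto.
Qed.

Lemma sin_PI_mult_neq_0 (x y : R) :
  (- / 2 <= x <= / 2)%R -> (x <> 0 \/ y <> 0)%R -> Csin (RtoC PI * (x, y)) <> 0.
Proof.
intros Hx Hn H. assert (HPI := PI_RGT_0).
replace (RtoC PI * (x, y)) with ((PI * x)%R, (PI * y)%R) in H by (apply C_ext; simpl; ring).
assert (E := Cmod2_Csin (PI * x) (PI * y)). rewrite H, Cmod_0 in E.
assert (h1 : sin (PI * x) = 0%R) by nra. assert (h2 : sinh (PI * y) = 0%R) by nra.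
destruct Hn as [h|h]; apply h.
- destruct (Rtotal_order x 0) as [h'|[h'|h']]; auto.
  + assert (0 < sin (PI * - x))%R by (apply sin_gt_0; nra).
    replace (PI * - x)%R with (- (PI * x))%R in H0 by ring. rewrite sin_neg in H0. lra.
  + assert (0 < sin (PI * x))%R by (apply sin_gt_0; nra). lra.
- rewrite <- sinh_0 in h2.
  destruct (Rtotal_order (PI * y) 0) as [h'|[h'|h']]; [|nra|];
  [apply sinh_lt in h'|apply sinh_lt in h']; lra.
Qed.

Lemma ex_Cderive_csc2 (x y : R) :
  (- / 2 <= x <= / 2)%R -> (x <> 0 \/ y <> 0)%R -> exists l, is_Cderive csc2 (x, y) l.
Proof.
intros Hx Hn. assert (H := sin_PI_mult_neq_0 x y Hx Hn).
assert (D : is_Cderive (fun w => Csin (RtoC PI * w)) (x, y)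
  ((0 * (x, y) + RtoC PI * 1) * Ccos (RtoC PI * (x, y)))).
{ apply (is_Cderive_comp Csin (fun w => RtoC PI * w)); [apply is_Cderive_Csin|].
  apply (is_Cderive_mult (fun _ => RtoC PI) (fun w => w)); [apply is_Cderive_const|apply is_Cderive_id]. }
eexists. apply (is_Cderive_mult (fun _ => RtoC (PI / 2))); [apply is_Cderive_const|].
apply (is_Cderive_comp Cinv (fun w => Csin (RtoC PI * w) * Csin (RtoC PI * w))).
- apply is_Cderive_inv. now apply Cmult_neq_0.
- apply (is_Cderive_mult _ _ _ _ _ D D).
Qed.

(** The derivative of sin(pi w) at 0 is pi > 2, so an error of at most |w| in the linear
    approximation leaves |sin(pi w)| >= |w|. *)
Lemma csc2_bound_0 : exists d, (0 < d)%R /\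
  forall w : C, w <> 0 -> (Cmod w < d)%R -> (Cmod (csc2 w) <= PI / 2 / (Cmod w * Cmod w))%R.
Proof.
assert (HPI : (2 < PI)%R) by (generalize PI2_1; lra).
assert (D : is_Cderive (fun w => Csin (RtoC PI * w)) 0
  ((0 * 0 + RtoC PI * 1) * Ccos (RtoC PI * 0))).
{ apply (is_Cderive_comp Csin (fun w => RtoC PI * w)); [apply is_Cderive_Csin|].
  apply (is_Cderive_mult (fun _ => RtoC PI) (fun w => w)); [apply is_Cderive_const|apply is_Cderive_id]. }
assert (S0 : Csin (RtoC PI * 0) = 0).
{ unfold Csin. rewrite !Cmult_0_r, Copp_0. field. apply Ci_nz. }
assert (C0 : Ccos (RtoC PI * 0) = 1).
{ unfold Ccos. rewrite !Cmult_0_r, Copp_0, Cexp_0. field. }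
destruct (proj1 (is_Cderive_Cmod _ _ _) D 1%R ltac:(lra)) as [d [Hd H]].
exists d; split; auto. intros w Hw0 Hw.
assert (Hm := proj1 (Cmod_gt_0 w) Hw0).
specialize (H w). rewrite C0, S0 in H.
replace (w - 0) with w in H by ring. specialize (H Hw).
replace (Csin (RtoC PI * w) - 0 - (0 * 0 + RtoC PI * 1) * 1 * w) with (Csin (RtoC PI * w) - RtoC PI * w) in H by ring.
assert (Hb : (Cmod w <= Cmod (Csin (RtoC PI * w)))%R).
{ assert (T := Cmod_triangle (Csin (RtoC PI * w)) (- (Csin (RtoC PI * w) - RtoC PI * w))).
  replace (Csin (RtoC PI * w) + - (Csin (RtoC PI * w) - RtoC PI * w)) with (RtoC PI * w) in T by ring.
  rewrite Cmod_opp, Cmod_mult, Cmod_R, Rabs_pos_eq in T by lra. nra. }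
unfold csc2.
assert (Hs : Csin (RtoC PI * w) <> 0) by (apply Cmod_gt_0; lra).
rewrite Cmod_mult, Cmod_inv by (now apply Cmult_neq_0). rewrite Cmod_mult, Cmod_R, Rabs_pos_eq by lra.
unfold Rdiv at 2. apply Rmult_le_compat_l; [lra|]. apply Rinv_le_contravar; [nra|].
apply Rmult_le_compat; lra.
Qed.

Lemma PI_gt_2 : (2 < PI)%R.
Proof. generalize PI2_1; lra. Qed.

Lemma sech2_bound (t : R) : (0 < sech2 t <= 2 * PI * exp (- (2 * PI * Rabs t)))%R.
Proof.
assert (HPI := PI_gt_2).
assert (Hc := cosh_pos (PI * t)). unfold sech2. split.
{ apply Rdiv_lt_0_compat; nra. }
assert (H : (exp (PI * Rabs t) / 2 <= cosh (PI * t))%R).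
{ unfold cosh. generalize (exp_pos (PI * t)) (exp_pos (- (PI * t))).
  unfold Rabs; destruct (Rcase_abs t).
  - replace (PI * - t)%R with (- (PI * t))%R by ring. lra.
  - lra. }
replace (exp (- (2 * PI * Rabs t))) with (/ (exp (PI * Rabs t) * exp (PI * Rabs t)))%R.
2: { rewrite <- exp_plus, <- exp_Ropp. f_equal; ring. }
set (E := exp (PI * Rabs t)) in *. assert (HE : (0 < E)%R) by apply exp_pos.
replace (2 * PI * / (E * E))%R with (PI / 2 * / (E / 2 * (E / 2)))%R by (field; lra).
unfold Rdiv at 1. apply Rmult_le_compat_l; [lra|]. apply Rinv_le_contravar; [nra|].
apply Rmult_le_compat; lra.
Qed.

Lemma csc2_bound_top (x : R) (y : R) : (1 <= Rabs y)%R ->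
  (Cmod (csc2 (x, y)) <= 8 * PI * exp (- (2 * PI * Rabs y)))%R.
Proof.
intros Hy. assert (HPI := PI_gt_2).
unfold csc2. replace (RtoC PI * (x, y)) with ((PI * x)%R, (PI * y)%R) by (apply C_ext; simpl; ring).
assert (H := Cmod2_Csin (PI * x) (PI * y)).
set (S := Csin ((PI * x)%R, (PI * y)%R)) in *.
set (E := exp (PI * Rabs y)). assert (HE0 : (0 < E)%R) by apply exp_pos.
assert (HE : (2 <= E)%R).
{ unfold E. assert (1 <= PI * Rabs y)%R by nra. generalize (exp_ineq1_le (PI * Rabs y)). lra. }
assert (Hs : (E / 4 * (E / 4) <= sinh (PI * y) * sinh (PI * y))%R).
{ assert (Hn : (E / 4 <= Rabs (sinh (PI * y)))%R).
  { unfold E, sinh in *. unfold Rabs in HE |- *; destruct (Rcase_abs y).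
    - replace (PI * - y)%R with (- (PI * y))%R in * by ring.
      assert (h : (exp (PI * y) * exp (- (PI * y)) = 1)%R) by (rewrite <- exp_plus, Rplus_opp_r; apply exp_0).
      generalize (exp_pos (PI * y)); intros. assert (exp (PI * y) <= / 2)%R by nra.
      destruct (Rcase_abs ((exp (PI * y) - exp (- (PI * y))) / 2)); lra.
    - assert (h : (exp (PI * y) * exp (- (PI * y)) = 1)%R) by (rewrite <- exp_plus, Rplus_opp_r; apply exp_0).
      generalize (exp_pos (- (PI * y))); intros. assert (exp (- (PI * y)) <= / 2)%R by nra.
      destruct (Rcase_abs ((exp (PI * y) - exp (- (PI * y))) / 2)); lra. }
  replace (sinh (PI * y) * sinh (PI * y))%R with (Rabs (sinh (PI * y)) * Rabs (sinh (PI * y)))%R.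
  - apply Rmult_le_compat; lra.
  - rewrite <- Rabs_mult, Rabs_pos_eq; nra. }
assert (HSS : (E / 4 * (E / 4) <= Cmod (S * S))%R) by (rewrite Cmod_mult; nra).
assert (HS0 : S * S <> 0) by (apply Cmod_gt_0; nra).
rewrite Cmod_mult, Cmod_inv, Cmod_R, Rabs_pos_eq by (auto; lra).
replace (exp (- (2 * PI * Rabs y))) with (/ (E * E))%R.
2: { unfold E. rewrite <- exp_plus, <- exp_Ropp. f_equal; ring. }
replace (8 * PI * / (E * E))%R with (PI / 2 * / (E / 4 * (E / 4)))%R by (field; lra).
apply Rmult_le_compat_l; [lra|]. apply Rinv_le_contravar; [nra|]. auto.
Qed.

(** Peetre's inequality, from [1 + |t| <= (1 + |u|)(1 + |u + t|)]. It moves the imaginary part of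
    [b] out of the majorant into a constant. *)
Lemma Rpower_shift (tau u t : R) : (0 <= tau)%R ->
  (Rpower (1 + Rabs (u + t)) (- tau) <= Rpower (1 + Rabs u) tau * Rpower (1 + Rabs t) (- tau))%R.
Proof.
intros Ht.
assert (Hu := Rabs_pos u). assert (Htt := Rabs_pos t). assert (Hut := Rabs_pos (u + t)).
rewrite !Rpower_Ropp.
assert (H : (Rpower (1 + Rabs t) tau <= Rpower (1 + Rabs u) tau * Rpower (1 + Rabs (u + t)) tau)%R).
{ rewrite Rpower_mult_distr by lra. apply Rle_Rpower_l; [lra|]. split; [lra|].
  assert (Rabs t <= Rabs (u + t) + Rabs u)%R.
  { replace t with ((u + t) + - u)%R at 1 by ring. eapply Rle_trans; [apply Rabs_triang|]. rewrite Rabs_Ropp; lra. }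
  nra. }
set (A := Rpower (1 + Rabs t) tau) in *. set (P := Rpower (1 + Rabs u) tau) in *.
set (Q := Rpower (1 + Rabs (u + t)) tau) in *.
assert (0 < A)%R by apply Rpower_pos. assert (0 < Q)%R by apply Rpower_pos.
apply Rmult_le_reg_l with (A * Q)%R; [nra|].
replace (A * Q * / Q)%R with A by (field; lra).
replace (A * Q * (P * / A))%R with (P * Q)%R by (field; lra). auto.
Qed.

(** * Summation by an integral over a vertical line *)

(** A primitive is tanh(pi t)/2, with limits 1/2 and -1/2. The factor pi/2 in the kernel is chosen
    for this total mass. *)
Lemma is_CIntR_sech2 : is_CIntR (fun t => RtoC (sech2 t)) 1.
Proof.
assert (HPI := PI_gt_2).
set (F := fun t => (sinh (PI * t) / (2 * cosh (PI * t)))%R).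
exists (fun n => RtoC (F (INR n) - F (- INR n)%R)). split.
- intros n. apply is_CInt_RtoC.
  apply (is_RInt_derive (V := R_CompleteNormedModule) F).
  + intros t _. unfold F, sech2. assert (Hc := cosh_pos (PI * t)). unfold sinh, cosh in *.
    auto_derive; [lra|].
    assert (h : (exp (PI * t) * exp (- (PI * t)) = 1)%R) by (rewrite <- exp_plus, Rplus_opp_r; apply exp_0).
    set (X := exp (PI * t)) in *. set (Y := exp (- (PI * t))) in *.
    replace (PI / 2)%R with (PI / 2 * (X * Y))%R by (rewrite h; ring). field. lra.
  + intros t _. apply (ex_derive_continuous (K := R_AbsRing) (V := R_NormedModule)).
    unfold sech2. assert (Hc := cosh_pos (PI * t)). unfold cosh in *. auto_derive. nra.
- apply Clim_bound with (N0 := 0%nat) (v := fun n => (2 * Rpower (1 + INR n) (- (1)))%R);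
   [|apply Rpower_neg_lim_scal; lra].
  intros n _. assert (Hn := pos_INR n).
  rewrite Rpower_Ropp, Rpower_1 by lra.
  rewrite <- RtoC_minus, Cmod_R.
  assert (Hc := cosh_pos (PI * INR n)).
  unfold F. replace (PI * - INR n)%R with (- (PI * INR n))%R by ring.
  unfold sinh, cosh in *. rewrite Ropp_involutive.
  set (X := exp (PI * INR n)) in *. set (Y := exp (- (PI * INR n))) in *.
  assert (h : (X * Y = 1)%R) by (unfold X, Y; rewrite <- exp_plus, Rplus_opp_r; apply exp_0).
  assert (hY : (0 < Y)%R) by apply exp_pos.
  assert (hX : (1 + INR n <= X)%R).
  { unfold X. generalize (exp_ineq1_le (PI * INR n)). nra. }
  replace ((X - Y) / 2 / (2 * ((X + Y) / 2)) - (Y - X) / 2 / (2 * ((Y + X) / 2)) - 1)%R with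
    (- (2 * (Y / (X + Y))))%R by (field; lra).
  rewrite Rabs_Ropp, Rabs_pos_eq.
  + apply Rmult_le_compat_l; [lra|]. apply Rle_div_l; [lra|].
    apply Rmult_le_reg_l with (1 + INR n)%R; [lra|]. rewrite <- Rmult_assoc, Rinv_r by lra. nra.
  + apply Rmult_le_pos; [lra|]. apply Rdiv_le_0_compat; lra.
Qed.

(** The exponent [d] lets the integrals over lines far to the right vanish, [tau] makes each of them
    converge, and the exponential is the growth that the kernel just absorbs. *)
Definition strip_growth (phi : C -> C) (B d tau : R) : Prop :=
  (0 <= B)%R /\ forall z, (1 <= Re z)%R ->
  (Cmod (phi z) <= B * Rpower (Re z) (- d) * Rpower (1 + Rabs (Im z)) (- tau) * exp (2 * PI * Rabs (Im z)))%R.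

Definition plana_integrand (phi : C -> C) (b : C) (t : R) : C :=
  phi (b + ((- / 2)%R, t)) * RtoC (sech2 t).

Lemma continuous_sech2 (t : R) : continuous sech2 t.
Proof.
apply (ex_derive_continuous (K := R_AbsRing) (V := R_NormedModule)).
unfold sech2. assert (Hc := cosh_pos (PI * t)). unfold cosh in *. auto_derive. nra.
Qed.

(** The price of translating the growth bound by an imaginary part [beta]: one factor for the power,
    one for the exponential. *)
Definition plana_const (B tau beta : R) : R :=
  (B * Rpower (1 + Rabs beta) tau * exp (2 * PI * Rabs beta))%R.

Lemma plana_const_pos (B tau beta : R) : (0 <= B)%R -> (0 <= plana_const B tau beta)%R.
Proof.
intros HB. unfold plana_const.
apply Rmult_le_pos; [apply Rmult_le_pos; auto; left; apply Rpower_pos|left; apply exp_pos].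
Qed.

Lemma strip_growth_line (phi : C -> C) (B d tau : R) (b : C) (x t : R) :
  strip_growth phi B d tau -> (0 <= tau)%R -> (1 <= Re b + x)%R ->
  (Cmod (phi (b + (x, t))%C) <= plana_const B tau (Im b) * Rpower (Re b + x) (- d) *
     Rpower (1 + Rabs t) (- tau) * exp (2 * PI * Rabs t))%R.
Proof.
intros [HB H] Ht Hx.
specialize (H (b + (x, t))). simpl in H.
change (fst b + x)%R with (Re b + x)%R in H. change (snd b + t)%R with (Im b + t)%R in H.
specialize (H Hx). eapply Rle_trans; [exact H|].
assert (HPI := PI_gt_2).
assert (H1 := Rpower_shift tau (Im b) t Ht).
assert (H2 : (exp (2 * PI * Rabs (Im b + t)) <= exp (2 * PI * Rabs (Im b)) * exp (2 * PI * Rabs t))%R).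
{ rewrite <- exp_plus. apply exp_le. generalize (Rabs_triang (Im b) t). nra. }
unfold plana_const.
apply Rle_trans with (B * Rpower (Re b + x) (- d) *
  (Rpower (1 + Rabs (Im b)) tau * Rpower (1 + Rabs t) (- tau)) *
  (exp (2 * PI * Rabs (Im b)) * exp (2 * PI * Rabs t)))%R; [|right; ring].
assert (0 <= B * Rpower (Re b + x) (- d))%R by (apply Rmult_le_pos; auto; left; apply Rpower_pos).
apply Rmult_le_compat; auto.
- apply Rmult_le_pos; auto. left; apply Rpower_pos.
- left; apply exp_pos.
- apply Rmult_le_compat_l; auto.
Qed.

(* The kernel decays like exp (- 2 pi |t|), exactly the growth allowed to f. *)
Lemma dominated_mult_sech2 (f : R -> C) (K tau : R) :
  (0 <= K)%R -> (forall t, Ccontinuous f t) ->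
  (forall t, (Cmod (f t) <= K * Rpower (1 + Rabs t) (- tau) * exp (2 * PI * Rabs t))%R) ->
  dominated tau (2 * PI * K) (fun t => f t * RtoC (sech2 t)).
Proof.
intros HK Hc H. split.
- intros t. apply Ccontinuous_mult; auto. apply Ccontinuous_RtoC, continuous_sech2.
- intros t. assert (Hs := sech2_bound t).
  rewrite Cmod_mult, Cmod_R, (Rabs_pos_eq (sech2 t)) by lra.
  eapply Rle_trans; [apply Rmult_le_compat; [apply Cmod_ge_0|lra|apply H|apply Hs]|].
  right. rewrite exp_Ropp. field. generalize (exp_pos (2 * PI * Rabs t)); lra.
Qed.

Lemma plana_dominated (phi dphi : C -> C) (B d tau : R) (b : C) :
  (forall z, (0 < Re z)%R -> is_Cderive phi z (dphi z)) ->
  strip_growth phi B d tau -> (0 <= tau)%R -> (3 / 2 <= Re b)%R ->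
  dominated tau (2 * PI * (plana_const B tau (Im b) * Rpower (Re b + - / 2) (- d))) (plana_integrand phi b).
Proof.
intros D G Ht Hb. apply dominated_mult_sech2.
- apply Rmult_le_pos; [|left; apply Rpower_pos]. apply plana_const_pos, G.
- intros t. apply (Ccontinuous_comp phi (fun t : R => b + ((- / 2)%R, t))).
  + apply Ccontinuous_plus; [apply Ccontinuous_const|].
    apply Ccontinuous_pair; [apply continuous_const|apply continuous_id].
  + eapply is_Cderive_continuous, D. simpl. unfold Re in *; lra.
- intros t. apply strip_growth_line with (x := (- / 2)%R); auto. lra.
Qed.

(* Apply [goursat_punctured] to (phi (b + w) - phi b - dphi b w) csc2 w, which is o(1/w) at 0;
   the linear term contributes - dphi b times the integral of [sech2], which is 1. *)
Lemma plana_step (phi dphi : C -> C) (B d tau : R) (b I0 I1 : C) :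
  (forall z, (0 < Re z)%R -> is_Cderive phi z (dphi z)) ->
  strip_growth phi B d tau -> (0 <= d)%R -> (1 <= tau)%R -> (3 / 2 <= Re b)%R ->
  is_CIntR (plana_integrand phi b) I0 -> is_CIntR (plana_integrand phi (b + 1)) I1 ->
  - dphi b = I0 - I1.
Proof.
intros D Gr Hd Ht Hb H0 H1.
assert (HPI := PI_gt_2).
set (l := dphi b).
set (h := fun w => phi (b + w) - phi b - l * w).
set (G := fun w => h w * csc2 w).
assert (Dh : forall w, (-1 <= Re w)%R -> is_Cderive h w ((0 + 1) * dphi (b + w) - 0 - (0 * w + l * 1))).
{ intros w Hw. apply is_Cderive_minus.
  - apply is_Cderive_minus; [|apply is_Cderive_const].
    apply (is_Cderive_comp phi (fun w => b + w)).
    + apply D. simpl. unfold Re in *; lra.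
    + apply is_Cderive_plus; [apply is_Cderive_const|apply is_Cderive_id].
  - apply (is_Cderive_mult (fun _ => l) (fun w => w)); [apply is_Cderive_const|apply is_Cderive_id]. }
assert (DG : forall x y, (- / 2 <= x <= / 2)%R -> (x <> 0 \/ y <> 0)%R -> exists m, is_Cderive G (x, y) m).
{ intros x y hx hn. destruct (ex_Cderive_csc2 x y hx hn) as [m Hm]. eexists.
  apply is_Cderive_mult; [apply Dh; simpl; lra|exact Hm]. }
assert (CG : forall x y, (- / 2 <= x <= / 2)%R -> (x <> 0 \/ y <> 0)%R -> Ccontinuous_at G (x, y)).
{ intros x y hx hn. destruct (DG x y hx hn) as [m Hm]. now apply is_Cderive_continuous in Hm. }
assert (SG : forall e, (0 < e)%R -> exists d, (0 < d)%R /\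
     forall w : C, w <> 0 -> (Cmod w < d)%R -> (Cmod (G w) <= e / Cmod w)%R).
{ intros e He. destruct csc2_bound_0 as [d1 [Hd1 B1]].
  assert (Db := D b ltac:(lra)).
  (* The tolerance cancels the [PI / 2] of [csc2_bound_0]; an o(w) times a double pole is o(1/w). *)
  destruct (proj1 (is_Cderive_Cmod _ _ _) Db (2 * e / PI)%R) as [d2 [Hd2 B2]].
  { apply Rdiv_lt_0_compat; lra. }
  exists (Rmin d1 d2). split; [now apply Rmin_pos|]. intros w Hw0 Hw.
  assert (Hm := proj1 (Cmod_gt_0 w) Hw0).
  specialize (B1 w Hw0 (Rlt_le_trans _ _ _ Hw (Rmin_l _ _))).
  specialize (B2 (b + w)). replace (b + w - b) with w in B2 by ring.
  specialize (B2 (Rlt_le_trans _ _ _ Hw (Rmin_r _ _))).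
  unfold G, h. rewrite Cmod_mult.
  eapply Rle_trans; [apply Rmult_le_compat; [apply Cmod_ge_0|apply Cmod_ge_0|apply B2|apply B1]|].
  right. field. lra. }
(* On the horizontal sides the exponentials of [phi] and of the kernel cancel and a factor
   [1 / (1 + n)] is left. The affine part that was subtracted grows only linearly and fits under the
   same bound, because [(1 + n)^2 <= exp (2 * PI * n)]. *)
assert (edge : forall x y (n : nat), (- / 2 <= x <= / 2)%R -> (1 <= n)%nat -> Rabs y = INR n ->
  (Cmod (G (x, y)) <= 8 * PI * (plana_const B tau (Im b) + Cmod (phi b) + Cmod l) * Rpower (1 + INR n) (- (1)))%R).
{ intros x y n Hx Hn Hy. assert (Hn1 : (1 <= INR n)%R) by (apply (le_INR 1); auto).
  unfold G. rewrite Cmod_mult.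
  assert (K1 := csc2_bound_top x y ltac:(lra)).
  assert (K2 := strip_growth_line phi B d tau b x y Gr ltac:(lra) ltac:(lra)).
  rewrite Hy in K1, K2.
  assert (K3 : (Rpower (Re b + x) (- d) <= 1)%R).
  { rewrite <- (Rpower_O (Re b + x)) by lra. apply Rle_Rpower; lra. }
  assert (K4 : (Rpower (1 + INR n) (- tau) <= Rpower (1 + INR n) (- (1)))%R) by (apply Rle_Rpower; lra).
  assert (Kc : (0 <= plana_const B tau (Im b))%R) by (apply plana_const_pos, Gr).
  set (E := exp (2 * PI * INR n)) in *. assert (HE : (0 < E)%R) by apply exp_pos.
  assert (K5 : (Cmod (phi (b + (x, y))%C) <= plana_const B tau (Im b) * Rpower (1 + INR n) (- (1)) * E)%R).
  { eapply Rle_trans; [apply K2|]. apply Rmult_le_compat_r; [lra|].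
    apply Rmult_le_compat; auto.
    - apply Rmult_le_pos; auto. left; apply Rpower_pos.
    - left; apply Rpower_pos.
    - rewrite <- (Rmult_1_r (plana_const B tau (Im b))) at 2. now apply Rmult_le_compat_l. }
  assert (K6 : (1 + INR n <= Rpower (1 + INR n) (- (1)) * E)%R).
  { rewrite Rpower_Ropp, Rpower_1 by lra. apply Rmult_le_reg_l with (1 + INR n)%R; [lra|].
    rewrite <- Rmult_assoc, Rinv_r, Rmult_1_l by lra.
    apply Rle_trans with (exp (INR n) * exp (INR n))%R.
    - generalize (exp_ineq1_le (INR n)); intros. apply Rmult_le_compat; lra.
    - rewrite <- exp_plus. apply exp_le. nra. }
  assert (K7 : (Cmod (x, y) <= 1 + INR n)%R).
  { eapply Rle_trans; [apply Cmod_le_Rabs|]. simpl. rewrite Hy.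
    assert (Rabs x <= 1)%R by (apply Rabs_le; lra). lra. }
  assert (K8 : (Cmod (h (x, y)) <= (plana_const B tau (Im b) + Cmod (phi b) + Cmod l) * Rpower (1 + INR n) (- (1)) * E)%R).
  { unfold h. eapply Rle_trans; [apply Cmod_triangle|].
    rewrite Cmod_opp, Cmod_mult.
    eapply Rle_trans; [apply Rplus_le_compat_r, Cmod_triangle|]. rewrite Cmod_opp.
    assert (Cmod (phi b) <= Cmod (phi b) * (Rpower (1 + INR n) (- (1)) * E))%R
      by (generalize (Cmod_ge_0 (phi b)); nra).
    assert (Cmod l * Cmod (x, y) <= Cmod l * (Rpower (1 + INR n) (- (1)) * E))%R
      by (apply Rmult_le_compat_l; [apply Cmod_ge_0|lra]).
    lra. }
  eapply Rle_trans; [apply Rmult_le_compat; [apply Cmod_ge_0|apply Cmod_ge_0|apply K8|apply K1]|].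
  right. rewrite exp_Ropp. fold E. field. lra. }
set (T := fun n => (8 * PI * (plana_const B tau (Im b) + Cmod (phi b) + Cmod l) * Rpower (1 + INR n) (- (1)))%R) in *.
assert (HG : forall x n, (x = / 2 \/ x = - / 2)%R ->
  is_CInt (fun y => G (x, y)) (- INR n) (INR n) (CInt (fun y => G (x, y)) (- INR n) (INR n))).
{ intros x n hx. apply is_CInt_CInt. intros t _. apply Ccontinuous_vertical, CG; [lra|left; lra]. }
assert (HD : is_CIntR (fun y => G ((/ 2)%R, y) - G ((- / 2)%R, y)) 0).
{ exists (fun n => CInt (fun y => G ((/ 2)%R, y)) (- INR n) (INR n) - CInt (fun y => G ((- / 2)%R, y)) (- INR n) (INR n)).
  split.
  - intros n. apply is_CInt_minus; apply HG; auto.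
  - apply Clim_bound with (N0 := 1%nat) (v := fun n => (2 * (8 * PI * (plana_const B tau (Im b) + Cmod (phi b) + Cmod l)) * Rpower (1 + INR n) (- (1)))%R);
    [|apply Rpower_neg_lim_scal; lra].
    intros n Hn. assert (Hn1 : (1 <= INR n)%R) by (apply (le_INR 1); auto).
    assert (HR := goursat_punctured G (/ 2) (INR n) ltac:(lra) ltac:(lra) (fun x y hx _ hn => DG x y hx hn) SG).
    unfold Crect in HR.
    assert (HT : is_CInt (fun x => G (x, INR n)) (- / 2) (/ 2) (CInt (fun x => G (x, INR n)) (- / 2) (/ 2))).
    { apply is_CInt_horizontal; [lra|]. intros x hx. apply CG; [lra|right; lra]. }
    assert (HB : is_CInt (fun x => G (x, (- INR n)%R)) (- / 2) (/ 2) (CInt (fun x => G (x, (- INR n)%R)) (- / 2) (/ 2))).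
    { apply is_CInt_horizontal; [lra|]. intros x hx. apply CG; [lra|right; lra]. }
    apply is_CInt_le_const with (M := T n) in HT; [|lra|intros x hx; apply edge; auto; apply Rabs_pos_eq; lra].
    apply is_CInt_le_const with (M := T n) in HB; [|lra|intros x hx; apply edge; auto; rewrite Rabs_Ropp; apply Rabs_pos_eq; lra].
    set (t1 := CInt (fun x => G (x, INR n)) (- / 2) (/ 2)) in *.
    set (t2 := CInt (fun x => G (x, (- INR n)%R)) (- / 2) (/ 2)) in *.
    set (v1 := CInt (fun y => G ((/ 2)%R, y)) (- INR n) (INR n)) in *.
    set (v2 := CInt (fun y => G ((- / 2)%R, y)) (- INR n) (INR n)) in *.
    assert (E : Ci * (v1 - v2 - 0) = t1 + - t2).
    { transitivity ((t2 + Ci * v1 - t1 - Ci * v2) + (t1 - t2)); [ring|].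
      rewrite HR; ring. }
    assert (E' : Cmod (v1 - v2 - 0) = Cmod (t1 + - t2)).
    { rewrite <- E, Cmod_mult, Cmod_Ci. ring. }
    rewrite E'. eapply Rle_trans; [apply Cmod_triangle|]. rewrite Cmod_opp.
    unfold T in *. lra. }
(* On the two vertical sides the kernel has the same values, so [phi b] drops out and the linear
   terms differ by [l]; adding 1/2 to [b] is the same as taking -1/2 from [b + 1]. *)
assert (HD' : is_CIntR (fun y => G ((/ 2)%R, y) - G ((- / 2)%R, y)) (I1 - I0 - l * 1)).
{ apply is_CIntR_ext with (fun t => plana_integrand phi (b + 1) t - plana_integrand phi b t - l * RtoC (sech2 t)).
  - intros t. unfold G, plana_integrand, h. destruct (csc2_half t) as [-> ->].
    replace (b + 1 + ((- / 2)%R, t)) with (b + ((/ 2)%R, t)) by (apply C_ext; simpl; field).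
    replace ((/ 2)%R, t) with (((- / 2)%R, t) + 1) at 3 by (apply C_ext; simpl; field). ring.
  - apply is_CIntR_minus; [now apply is_CIntR_minus|]. apply is_CIntR_mult, is_CIntR_sech2. }
assert (E := is_CIntR_unique _ _ _ HD HD').
transitivity ((I1 - I0 - l * 1) - (I1 - I0)); [ring|]. rewrite <- E. ring.
Qed.

(** Moving the line by one step costs one term, so the partial sums telescope to [I 0 - I n]; the
    decay of order [d] in the real part sends [I n] to 0. *)
Theorem plana_sum (phi dphi : C -> C) (B d tau : R) (b : C) :
  (forall z, (0 < Re z)%R -> is_Cderive phi z (dphi z)) ->
  strip_growth phi B d tau -> (0 < d)%R -> (1 < tau)%R -> (3 / 2 <= Re b)%R ->
  exists I, is_CIntR (plana_integrand phi b) I /\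
    Clim (Csum (fun n => - dphi (b + RtoC (INR n)))) I.
Proof.
intros D G Hd Ht Hb.
assert (Hr : forall n, Re (b + RtoC (INR n)) = (Re b + INR n)%R) by reflexivity.
assert (Hi : forall n, Im (b + RtoC (INR n)) = Im b) by (intros n; simpl; unfold Im; ring).
assert (Hdom : forall n, dominated tau
   (2 * PI * (plana_const B tau (Im b) * Rpower (Re b + INR n + - / 2) (- d)))
   (plana_integrand phi (b + RtoC (INR n)))).
{ intros n. rewrite <- Hr, <- (Hi n). apply plana_dominated with dphi; auto; [lra|].
  rewrite Hr. generalize (pos_INR n); lra. }
assert (HI : forall n, exists I, is_CIntR (plana_integrand phi (b + RtoC (INR n))) I).
{ intros n. destruct (dominated_is_CIntR _ _ _ Ht (Hdom n)) as [I [HI _]]. now exists I. }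
set (I := fun n => proj1_sig (constructive_indefinite_description _ (HI n))).
assert (II : forall n, is_CIntR (plana_integrand phi (b + RtoC (INR n))) (I n))
  by (intros n; exact (proj2_sig (constructive_indefinite_description _ (HI n)))).
exists (I 0%nat). split.
{ replace b with (b + RtoC (INR 0)) by (simpl; ring). apply II. }
assert (Hs : forall n, I 0%nat - I n = Csum (fun n => - dphi (b + RtoC (INR n))) n).
{ induction n as [|n IH]; [simpl; ring|]. simpl Csum. rewrite <- IH.
  rewrite (plana_step phi dphi B d tau (b + RtoC (INR n)) (I n) (I (S n))); auto; try lra; [ring| |].
  - rewrite Hr. generalize (pos_INR n); lra.
  - replace (b + RtoC (INR n) + 1) with (b + RtoC (INR (S n))) by (rewrite S_INR, RtoC_plus; ring).
    apply II. }
apply Clim_ext with (1 := Hs).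
cut (Clim (fun n => I 0%nat - I n) (I 0%nat - 0)).
{ now replace (I 0%nat - 0) with (I 0%nat) by ring. }
apply Clim_minus; [apply Clim_const|].
set (K := (2 * (2 * PI * plana_const B tau (Im b)) / (tau - 1))%R).
apply Clim_bound with (N0 := 0%nat) (v := fun n => (K * Rpower (1 + INR n) (- d))%R);
  [|now apply Rpower_neg_lim_scal].
intros n _. replace (I n - 0) with (I n) by ring.
eapply Rle_trans; [apply (dominated_CIntR_bound _ _ _ _ Ht (Hdom n) (II n))|].
replace (2 * (2 * PI * (plana_const B tau (Im b) * Rpower (Re b + INR n + - / 2) (- d))) / (tau - 1))%R
  with (K * Rpower (Re b + INR n + - / 2) (- d))%R by (unfold K; field; lra).
assert (Kc : (0 <= plana_const B tau (Im b))%R) by (apply plana_const_pos, G).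
assert (HPI := PI_gt_2).
apply Rmult_le_compat_l.
- unfold K. apply Rdiv_le_0_compat; [|lra]. nra.
- rewrite !Rpower_Ropp. apply Rinv_le_contravar; [apply Rpower_pos|].
  apply Rle_Rpower_l; [lra|]. generalize (pos_INR n); lra.
Qed.

(** * The Hurwitz zeta function *)

Lemma Re_pos_neq_0 (z : C) : (0 < Re z)%R -> z <> 0.
Proof. intros H ->. simpl in H. lra. Qed.

Lemma Re_le_Cmod (z : C) : (Re z <= Cmod z)%R.
Proof. eapply Rle_trans; [apply Rle_abs|apply re_le_Cmod]. Qed.

(** A power uses none of the exponential growth that is allowed, so the decay exponent 2 is paid for
    by it, through [(1 + |y|)^2 <= exp (2 * PI * |y|)]. *)
Lemma strip_growth_Cpower (s : C) : (1 < Re s)%R ->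
  strip_growth (fun z => Cpower z (1 - s)) (exp (PI * Rabs (Im s))) (Re s - 1) 2.
Proof.
intros Hs. assert (HPI := PI_gt_2). split; [left; apply exp_pos|]. intros z Hz.
assert (Hm := Re_le_Cmod z).
eapply Rle_trans; [apply Cmod_Cpower_le, Re_pos_neq_0; lra|].
replace (Re (1 - s)) with (- (Re s - 1))%R by (simpl; unfold Re; ring).
replace (Im (1 - s)) with (- Im s)%R by (simpl; unfold Im; ring).
rewrite Rabs_Ropp.
assert (H1 : (Rpower (Cmod z) (- (Re s - 1)) <= Rpower (Re z) (- (Re s - 1)))%R).
{ rewrite !Rpower_Ropp. apply Rinv_le_contravar; [apply Rpower_pos|]. apply Rle_Rpower_l; lra. }
assert (H2 : (1 <= Rpower (1 + Rabs (Im z)) (- (2)) * exp (2 * PI * Rabs (Im z)))%R).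
{ assert (Hi := Rabs_pos (Im z)).
  rewrite Rpower_Ropp. replace 2%R with (1 + 1)%R at 1 by ring.
  rewrite Rpower_plus, Rpower_1 by lra.
  apply Rmult_le_reg_l with ((1 + Rabs (Im z)) * (1 + Rabs (Im z)))%R; [nra|].
  rewrite <- Rmult_assoc, Rinv_r, Rmult_1_l, Rmult_1_r by nra.
  apply Rle_trans with (exp (Rabs (Im z)) * exp (Rabs (Im z)))%R.
  - generalize (exp_ineq1_le (Rabs (Im z))); intros. apply Rmult_le_compat; lra.
  - rewrite <- exp_plus. apply exp_le. nra. }
set (E := exp (PI * Rabs (Im s))). assert (HE : (0 < E)%R) by apply exp_pos.
set (P := Rpower (Re z) (- (Re s - 1))) in *. assert (HP : (0 < P)%R) by apply Rpower_pos.
set (Q := Rpower (1 + Rabs (Im z)) (- (2))) in *.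
set (X := exp (2 * PI * Rabs (Im z))) in *.
apply Rle_trans with (E * P)%R; [nra|].
replace (E * P * Q * X)%R with (E * P * (Q * X))%R by ring.
assert (0 < E * P)%R by (apply Rmult_lt_0_compat; auto). nra.
Qed.

Lemma line_bounds (b : C) (t : R) : (3 / 2 <= Re b)%R ->
  (1 <= Re (b + ((- / 2)%R, t)))%R /\ (1 <= Cmod (b + ((- / 2)%R, t)))%R /\
  (Cmod (b + ((- / 2)%R, t)) <= (Cmod b + 1) * (1 + Rabs t))%R /\
  (Cmod (b + ((- / 2)%R, t)) <= Cmod b + 1 + Rabs t)%R /\
  (1 + Rabs t <= Cmod (b + ((- / 2)%R, t)) * (2 + Cmod b))%R.
Proof.
intros Hb. assert (H1 : (1 <= Re (b + ((- / 2)%R, t)))%R) by (simpl; unfold Re in *; lra).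
assert (H2 := Re_le_Cmod (b + ((- / 2)%R, t))).
assert (H3 : (Cmod (b + ((- / 2)%R, t)) <= Cmod b + 1 + Rabs t)%R).
{ eapply Rle_trans; [apply Cmod_triangle|].
  assert (H := Cmod_le_Rabs ((- / 2)%R, t)). simpl in H.
  rewrite Rabs_Ropp, (Rabs_pos_eq (/ 2)) in H by lra. lra. }
assert (Hb0 := Cmod_ge_0 b). assert (Ht := Rabs_pos t).
repeat split; auto; try lra; try nra.
assert (H4 := im_le_Cmod (b + ((- / 2)%R, t))). simpl in H4. change (snd b) with (Im b) in H4.
assert (H5 := im_le_Cmod b).
assert (H6 : (Rabs t <= Rabs (Im b + t) + Rabs (Im b))%R).
{ replace t with ((Im b + t) + - Im b)%R at 1 by ring.
  eapply Rle_trans; [apply Rabs_triang|]. rewrite Rabs_Ropp; lra. }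
nra.
Qed.

Lemma pow_le_fact_exp (n : nat) (x : R) : (0 <= x)%R -> (x ^ n <= INR (fact n) * exp x)%R.
Proof.
intros Hx. assert (H := exp_ge_taylor x n Hx).
assert (Hf := INR_fact_lt_0 n).
assert (H' : (x ^ n / INR (fact n) <= exp x)%R).
{ eapply Rle_trans; [|exact H]. destruct n as [|n]; [simpl; lra|].
  rewrite tech5. assert (0 <= sum_f_R0 (fun k => x ^ k / INR (fact k)) n)%R; [|lra].
  apply cond_pos_sum. intros k. apply Rdiv_le_0_compat; [now apply pow_le|apply INR_fact_lt_0]. }
apply Rle_div_l in H'; auto. lra.
Qed.

(** However large the exponent, a power is integrable against the kernel; therefore the integral for
    [(w - 1) zeta(w, b)] makes sense for every [w]. *)
Lemma line_power_bound (b : C) (m : R) : (3 / 2 <= Re b)%R ->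
  exists K : R, (0 <= K)%R /\ forall t,
   (Rpower (Cmod (b + ((- / 2)%R, t))) m <= K * Rpower (1 + Rabs t) (- (2)) * exp (2 * PI * Rabs t))%R.
Proof.
intros Hb. assert (HPI := PI_gt_2).
assert (HM : exists M, (m <= INR M)%R).
{ destruct (nfloor_ex (Rabs m) (Rabs_pos m)) as [M HM]. exists (S M). rewrite S_INR.
  generalize (Rle_abs m); lra. }
destruct HM as [M HM].
(* Combines [|z| <= (|b| + 1)(1 + |t|)] with [(1 + |t|)^(M + 2) <= (M + 2)! exp (1 + |t|)]; the two
   extra powers pay for the decay exponent 2. *)
exists ((Cmod b + 1) ^ M * (INR (fact (M + 2)) * exp 1))%R.
assert (Hb0 := Cmod_ge_0 b).
assert (HK : (0 <= (Cmod b + 1) ^ M)%R) by (apply pow_le; lra).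
split.
{ apply Rmult_le_pos; auto. apply Rmult_le_pos; [apply pos_INR|left; apply exp_pos]. }
intros t. destruct (line_bounds b t Hb) as [_ [H1 [H2 _]]].
assert (Ht := Rabs_pos t).
set (z := b + ((- / 2)%R, t)) in *.
apply Rle_trans with (Cmod z ^ M)%R.
{ rewrite <- Rpower_pow by lra. apply Rle_Rpower; lra. }
apply Rle_trans with (((Cmod b + 1) * (1 + Rabs t)) ^ M)%R.
{ apply pow_incr; lra. }
rewrite Rpow_mult_distr. set (X := exp (2 * PI * Rabs t)).
rewrite !Rmult_assoc. apply Rmult_le_compat_l; auto.
rewrite Rpower_Ropp. replace (Rpower (1 + Rabs t) 2) with ((1 + Rabs t) ^ 2)%R
  by (rewrite <- Rpower_pow by lra; f_equal; simpl; ring).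
apply Rmult_le_reg_l with ((1 + Rabs t) ^ 2)%R; [nra|].
replace ((1 + Rabs t) ^ 2 * (1 + Rabs t) ^ M)%R with ((1 + Rabs t) ^ (M + 2))%R by (rewrite pow_add; ring).
replace ((1 + Rabs t) ^ 2 * (INR (fact (M + 2)) * (exp 1 * (/ (1 + Rabs t) ^ 2 * X))))%R
 with (INR (fact (M + 2)) * (exp 1 * X))%R by (field; nra).
eapply Rle_trans; [apply pow_le_fact_exp; lra|].
apply Rmult_le_compat_l; [apply pos_INR|]. unfold X. rewrite <- exp_plus. apply exp_le. nra.
Qed.

Lemma Ccontinuous_line (f : C -> C) (b : C) (t : R) :
  Ccontinuous_at f (b + ((- / 2)%R, t)) -> Ccontinuous (fun t => f (b + ((- / 2)%R, t))) t.
Proof.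
intros H. apply (Ccontinuous_comp f (fun t : R => b + ((- / 2)%R, t))); auto.
apply Ccontinuous_plus; [apply Ccontinuous_const|].
apply Ccontinuous_pair; [apply continuous_const|apply continuous_id].
Qed.

Lemma Cpower_line_dominated (b w : C) : (3 / 2 <= Re b)%R ->
  exists K, dominated 2 K (plana_integrand (fun z => Cpower z (1 - w)) b).
Proof.
intros Hb. destruct (line_power_bound b (Re (1 - w)) Hb) as [K [HK H]].
exists (2 * PI * (exp (PI * Rabs (Im (1 - w))) * K))%R.
apply dominated_mult_sech2.
- apply Rmult_le_pos; auto. left; apply exp_pos.
- intros t. destruct (line_bounds b t Hb) as [H1 _].
  apply (Ccontinuous_line (fun z => Cpower z (1 - w))).
  eapply is_Cderive_continuous, is_Cderive_Cpower_l; lra.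
- intros t. destruct (line_bounds b t Hb) as [H1 _].
  eapply Rle_trans; [apply Cmod_Cpower_le, Re_pos_neq_0; lra|].
  specialize (H t). generalize (exp_pos (PI * Rabs (Im (1 - w)))). nra.
Qed.

Definition CIntR (f : R -> C) : C := epsilon (inhabits (RtoC 0)) (is_CIntR f).

Lemma is_CIntR_CIntR (f : R -> C) (tau B : R) :
  (1 < tau)%R -> dominated tau B f -> is_CIntR f (CIntR f).
Proof.
intros Ht D. apply (epsilon_spec (inhabits (RtoC 0)) (is_CIntR f)). destruct (dominated_is_CIntR _ _ _ Ht D) as [l [Hl _]]. now exists l.
Qed.

(* (w - 1) zeta(w, b), as an entire function of w *)
Definition zeta_entire (b w : C) : C := CIntR (plana_integrand (fun z => Cpower z (1 - w)) b).

Lemma is_CIntR_zeta_entire (b w : C) : (3 / 2 <= Re b)%R ->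
  is_CIntR (plana_integrand (fun z => Cpower z (1 - w)) b) (zeta_entire b w).
Proof.
intros Hb. destruct (Cpower_line_dominated b w Hb) as [K HK].
apply (is_CIntR_CIntR _ 2 K); auto. lra.
Qed.

(** At [w = 1] the power is constant, and the residue of zeta becomes the total mass of the
    weight. *)
Lemma zeta_entire_1 (b : C) : (3 / 2 <= Re b)%R -> zeta_entire b 1 = 1.
Proof.
intros Hb. apply is_CIntR_unique with (1 := is_CIntR_zeta_entire b 1 Hb).
apply is_CIntR_ext with (2 := is_CIntR_sech2). intros t. unfold plana_integrand.
replace (1 - 1) with (RtoC 0) by ring. rewrite Cpower_0. ring.
Qed.

Lemma Cmod_Cln_le (z : C) : (1 <= Cmod z)%R -> (Cmod (Cln z) <= ln (Cmod z) + PI)%R.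
Proof.
intros Hz. eapply Rle_trans; [apply Cmod_le_Rabs|].
assert (H := Carg_bound z). simpl.
rewrite Rabs_pos_eq; [lra|]. rewrite <- ln_1. apply ln_le; lra.
Qed.

(** A second-order bound in the exponent that can be integrated in [z]. Of the three extra powers of
    |z|, two bound the square of the logarithm and one bounds [exp (|v - w| |Cln z|)]. *)
Lemma Cpower_remainder (z w v : C) : (1 <= Re z)%R -> (Cmod (v - w) <= 1)%R ->
  (Cmod (Cpower z (1 - v) - Cpower z (1 - w) + (v - w) * (Cln z * Cpower z (1 - w)))
   <= Cmod (v - w) * Cmod (v - w) *
      ((1 + PI) ^ 2 * exp PI * exp (PI * Rabs (Im (1 - w))) * Rpower (Cmod z) (Re (1 - w) + 3)))%R.
Proof.
intros Hz Hv. assert (HPI := PI_gt_2).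
assert (Hm := Re_le_Cmod z).
assert (Hz0 : z <> 0) by (apply Re_pos_neq_0; lra).
set (u := - ((v - w) * Cln z)).
replace (Cpower z (1 - v)) with (Cpower z (1 - w) * Cexp u).
2: { unfold Cpower. rewrite <- Cexp_plus. f_equal. unfold u. ring. }
replace (Cpower z (1 - w) * Cexp u - Cpower z (1 - w) + (v - w) * (Cln z * Cpower z (1 - w)))
  with (Cpower z (1 - w) * (Cexp u - 1 - u)) by (unfold u; ring).
rewrite Cmod_mult.
set (m := Cmod z) in *. set (h := Cmod (v - w)) in *.
assert (Hh : (0 <= h)%R) by apply Cmod_ge_0.
assert (HL := Cmod_Cln_le z ltac:(fold m; lra)). fold m in HL.
set (L := Cmod (Cln z)) in *. assert (HL0 : (0 <= L)%R) by apply Cmod_ge_0.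
assert (Hu : Cmod u = (h * L)%R) by (unfold u; rewrite Cmod_opp, Cmod_mult; reflexivity).
assert (H1 := Cexp_sub_lin_bound_exp u). rewrite Hu in H1.
assert (H2 := Cmod_Cpower_le z (1 - w) Hz0). fold m in H2.
assert (Hlnm : (ln m <= m)%R).
{ generalize (exp_ineq1_le (ln m)). rewrite exp_ln by lra. lra. }
assert (H3 : (L <= (1 + PI) * m)%R) by nra.
assert (H4 : (exp (h * L) <= exp PI * m)%R).
{ rewrite <- (exp_ln m) by lra. rewrite <- exp_plus. apply exp_le. nra. }
assert (H5 : ((h * L) ^ 2 <= h * h * ((1 + PI) ^ 2 * (m * m)))%R).
{ replace ((h * L) ^ 2)%R with (h * h * (L * L))%R by ring.
  apply Rmult_le_compat_l; [nra|].
  replace ((1 + PI) ^ 2 * (m * m))%R with (((1 + PI) * m) * ((1 + PI) * m))%R by ring.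
  apply Rmult_le_compat; auto. }
assert (H6 : (Cmod (Cexp u - 1 - u) <= h * h * ((1 + PI) ^ 2 * (m * m)) * (exp PI * m))%R).
{ eapply Rle_trans; [apply H1|]. apply Rmult_le_compat; auto; [apply pow2_ge_0|left; apply exp_pos]. }
eapply Rle_trans; [apply Rmult_le_compat; [apply Cmod_ge_0|apply Cmod_ge_0|apply H2|apply H6]|].
replace 3%R with (1 + 1 + 1)%R by ring. rewrite !Rpower_plus, !Rpower_1 by lra.
right; ring.
Qed.

(** Differentiation under the integral: the integrated remainder is of order [|v - w|^2], since its
    majorant carries that factor. *)
Lemma ex_Cderive_zeta_entire (b w : C) : (3 / 2 <= Re b)%R ->
  exists l, is_Cderive (zeta_entire b) w l.
Proof.
intros Hb. assert (HPI := PI_gt_2).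
set (g := plana_integrand (fun z => Cln z * Cpower z (1 - w)) b).
assert (Hg : exists K, dominated 2 K g).
{ destruct (line_power_bound b (Re (1 - w) + 1) Hb) as [K [HK H]].
  exists (2 * PI * ((1 + PI) * exp (PI * Rabs (Im (1 - w))) * K))%R.
  apply dominated_mult_sech2.
  - apply Rmult_le_pos; auto. apply Rmult_le_pos; [lra|left; apply exp_pos].
  - intros t. destruct (line_bounds b t Hb) as [H1 _].
    apply (Ccontinuous_line (fun z => Cln z * Cpower z (1 - w))).
    apply Ccontinuous_mult; [apply Cln_continuous; lra|].
    eapply is_Cderive_continuous, is_Cderive_Cpower_l; lra.
  - intros t. destruct (line_bounds b t Hb) as [H1 [H2 _]].
    specialize (H t). set (z := b + ((- / 2)%R, t)) in *.
    rewrite Cmod_mult.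
    assert (H3 := Cmod_Cln_le z H2).
    assert (H4 : (ln (Cmod z) <= Cmod z)%R).
    { generalize (exp_ineq1_le (ln (Cmod z))). rewrite exp_ln by lra. lra. }
    assert (H5 := Cmod_Cpower_le z (1 - w) (Re_pos_neq_0 z ltac:(lra))).
    rewrite Rpower_plus, Rpower_1 in H by lra.
    apply Rle_trans with (((1 + PI) * Cmod z) * (Rpower (Cmod z) (Re (1 - w)) * exp (PI * Rabs (Im (1 - w)))))%R.
    + apply Rmult_le_compat; auto using Cmod_ge_0. nra.
    + assert (0 < (1 + PI) * exp (PI * Rabs (Im (1 - w))))%R
        by (apply Rmult_lt_0_compat; [lra|apply exp_pos]).
      apply Rmult_le_compat_l with (r := ((1 + PI) * exp (PI * Rabs (Im (1 - w))))%R) in H; [|lra].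
      eapply Rle_trans; [|eapply Rle_trans; [exact H|]]; right; ring. }
destruct Hg as [Kg Hg].
assert (Ig : is_CIntR g (CIntR g)) by (apply (is_CIntR_CIntR _ 2 Kg); auto; lra).
exists (- CIntR g).
destruct (line_power_bound b (Re (1 - w) + 3) Hb) as [K [HK H]].
set (c := ((1 + PI) ^ 2 * exp PI * exp (PI * Rabs (Im (1 - w))))%R).
assert (Hc : (0 < c)%R).
{ unfold c. apply Rmult_lt_0_compat; [|apply exp_pos]. apply Rmult_lt_0_compat; [nra|apply exp_pos]. }
(* The bound of [dominated_CIntR_bound] for exponent 2; the [+ 1] keeps it positive when [K = 0]. *)
set (A := (2 * (2 * PI * (c * K)) / (2 - 1) + 1)%R).
assert (HA : (0 < A)%R).
{ unfold A. assert (0 <= 2 * PI * (c * K))%R by (apply Rmult_le_pos; [lra|nra]). lra. }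
apply is_Cderive_Cmod. intros e He.
exists (Rmin 1 (e / A)). split; [apply Rmin_pos; [lra|now apply Rdiv_lt_0_compat]|].
intros v Hv.
assert (Hv1 := Rlt_le_trans _ _ _ Hv (Rmin_l _ _)). assert (Hv2 := Rlt_le_trans _ _ _ Hv (Rmin_r _ _)).
replace (zeta_entire b v - zeta_entire b w - - CIntR g * (v - w))
  with (zeta_entire b v - zeta_entire b w + (v - w) * CIntR g) by ring.
set (r := fun t => plana_integrand (fun z => Cpower z (1 - v)) b t -
   plana_integrand (fun z => Cpower z (1 - w)) b t + (v - w) * g t).
assert (Ir : is_CIntR r (zeta_entire b v - zeta_entire b w + (v - w) * CIntR g)).
{ apply is_CIntR_plus; [|now apply is_CIntR_mult].
  apply is_CIntR_minus; now apply is_CIntR_zeta_entire. }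
assert (Dr : dominated 2 (2 * PI * (Cmod (v - w) * Cmod (v - w) * (c * K))) r).
{ set (F := fun t => Cpower (b + ((- / 2)%R, t)) (1 - v) - Cpower (b + ((- / 2)%R, t)) (1 - w)
      + (v - w) * (Cln (b + ((- / 2)%R, t)) * Cpower (b + ((- / 2)%R, t)) (1 - w))).
  assert (EF : forall t, F t * RtoC (sech2 t) = r t) by (intros t; unfold F, r, g, plana_integrand; ring).
  destruct (dominated_mult_sech2 F
      (Cmod (v - w) * Cmod (v - w) * (c * K)) 2) as [D1 D2].
  - generalize (Cmod_ge_0 (v - w)); intros. apply Rmult_le_pos; nra.
  - intros t. destruct (line_bounds b t Hb) as [H1 _].
    apply (Ccontinuous_line (fun z => Cpower z (1 - v) - Cpower z (1 - w) + (v - w) * (Cln z * Cpower z (1 - w)))).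
    assert (forall u, Ccontinuous_at (fun z => Cpower z u) (b + ((- / 2)%R, t))).
    { intros u. assert (H0 : (0 < Re (b + ((- / 2)%R, t)))%R) by (apply Rlt_le_trans with 1%R; [apply Rlt_0_1|exact H1]).
      exact (is_Cderive_continuous _ _ _ (is_Cderive_Cpower_l _ u H0)). }
    apply Ccontinuous_plus; [apply Ccontinuous_minus; auto|].
    apply Ccontinuous_mult; [apply Ccontinuous_const|].
    apply Ccontinuous_mult; [apply Cln_continuous; lra|auto].
  - intros t. destruct (line_bounds b t Hb) as [H1 _].
    eapply Rle_trans; [apply Cpower_remainder; lra|].
    specialize (H t). fold c.
    replace (Cmod (v - w) * Cmod (v - w) * (c * K) * Rpower (1 + Rabs t) (- (2)) * exp (2 * PI * Rabs t))%R
     with (Cmod (v - w) * Cmod (v - w) * (c * (K * Rpower (1 + Rabs t) (- (2)) * exp (2 * PI * Rabs t))))%R by ring.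
    apply Rmult_le_compat_l; [generalize (Cmod_ge_0 (v - w)); nra|].
    apply Rmult_le_compat_l; [lra|]. exact H.
  - split.
    + intros t. apply continuous_ext with (2 := D1 t). exact EF.
    + intros t. rewrite <- EF. apply D2. }
eapply Rle_trans; [apply (dominated_CIntR_bound 2 _ _ _ ltac:(lra) Dr Ir)|].
apply Rle_trans with (A * Cmod (v - w) * Cmod (v - w))%R.
- unfold A. generalize (Cmod_ge_0 (v - w)); intros.
  replace (2 * (2 * PI * (Cmod (v - w) * Cmod (v - w) * (c * K))) / (2 - 1))%R with
   ((2 * (2 * PI * (c * K)) / (2 - 1)) * (Cmod (v - w) * Cmod (v - w)))%R by field.
  nra.
- apply Rmult_le_compat_r; [apply Cmod_ge_0|]. apply Rlt_div_r in Hv2; lra.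
Qed.

Lemma zeta_entire_series (b s : C) : (3 / 2 <= Re b)%R -> (1 < Re s)%R ->
  Clim (Csum (fun n => (s - 1) * Cpower (b + RtoC (INR n)) (- s))) (zeta_entire b s).
Proof.
intros Hb Hs.
destruct (plana_sum (fun z => Cpower z (1 - s)) (fun z => (1 - s) * Cpower z (1 - s - 1))
  (exp (PI * Rabs (Im s))) (Re s - 1) 2 b) as [I [HI HL]]; auto; try lra.
- intros z Hz. now apply is_Cderive_Cpower_l.
- now apply strip_growth_Cpower.
- rewrite <- (is_CIntR_unique _ _ _ HI (is_CIntR_zeta_entire b s Hb)).
  apply Clim_ext with (2 := HL). intros n. apply Csum_ext. intros k _.
  replace (1 - s - 1) with (- s) by ring. ring.
Qed.

(* (w - 1) zeta(w, a), as an entire function of w, computed from zeta(w, a + N) *)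
Definition zeta_shift (a : C) (N : nat) (w : C) : C :=
  zeta_entire (a + RtoC (INR N)) w + (w - 1) * Csum (fun n => Cpower (RtoC (INR n) + a) (- w)) N.

Lemma ex_Cderive_zeta_shift (a w : C) (N : nat) : (3 / 2 <= Re a + INR N)%R ->
  exists l, is_Cderive (zeta_shift a N) w l.
Proof.
intros Hb. destruct (ex_Cderive_zeta_entire (a + RtoC (INR N)) w) as [l Hl]; [exact Hb|].
assert (HS : exists m, is_Cderive (fun w => Csum (fun n => Cpower (RtoC (INR n) + a) (- w)) N) w m).
{ clear Hb Hl. induction N as [|N [m Hm]].
  - exists 0. apply (is_Cderive_const 0 w).
  - eexists. apply is_Cderive_plus; [exact Hm|].
    apply (is_Cderive_comp (fun v => Cpower (RtoC (INR N) + a) v) (fun w => - w)).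
    + apply is_Cderive_Cpower_r.
    + apply is_Cderive_opp, is_Cderive_id. }
destruct HS as [m Hm].
eexists. apply is_Cderive_plus; [exact Hl|].
apply (is_Cderive_mult (fun w => w - 1)); [|exact Hm].
apply is_Cderive_minus; [apply is_Cderive_id|apply is_Cderive_const].
Qed.

Lemma zeta_shift_continuous (a w : C) (N : nat) : (3 / 2 <= Re a + INR N)%R ->
  Ccontinuous_at (zeta_shift a N) w.
Proof.
intros Hb. destruct (ex_Cderive_zeta_shift a w N Hb) as [l Hl]. now apply is_Cderive_continuous in Hl.
Qed.

Lemma zeta_shift_1 (a : C) (N : nat) : (3 / 2 <= Re a + INR N)%R -> zeta_shift a N 1 = 1.
Proof. intros Hb. unfold zeta_shift. rewrite zeta_entire_1 by exact Hb. ring. Qed.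

Lemma Clim_shift (u : nat -> C) (l : C) (N : nat) : Clim (fun n => u (N + n)%nat) l -> Clim u l.
Proof.
intros H. apply Clim_Cmod. intros e He.
destruct (proj1 (Clim_Cmod _ _) H e He) as [M HM].
exists (N + M)%nat. intros n Hn. replace n with (N + (n - N))%nat by lia. apply HM. lia.
Qed.

(** Division by [s - 1] creates the only singularity, and its residue is the value 1 of [zeta_shift]
    there. *)
Lemma is_hurwitz_zeta_shift (a : C) (N : nat) : (3 / 2 <= Re a + INR N)%R ->
  is_hurwitz_zeta a (fun s => zeta_shift a N s / (s - 1)).
Proof.
intros Hb. split; [|split].
- intros s Hs.
  assert (Hs1 : s - 1 <> 0).
  { intros H. apply (f_equal Re) in H. simpl in H. unfold Re in Hs. lra. }
  apply is_series_Csum. apply Clim_shift with N.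
  assert (HL := zeta_entire_series (a + RtoC (INR N)) s Hb Hs).
  apply (Clim_mult (/ (s - 1))) in HL.
  apply (Clim_plus _ _ _ _ (Clim_const (Csum (fun n => Cpower (RtoC (INR n) + a) (- s)) N))) in HL.
  unfold zeta_shift.
  replace ((zeta_entire (a + RtoC (INR N)) s + (s - 1) * Csum (fun n => Cpower (RtoC (INR n) + a) (- s)) N) / (s - 1))
   with (Csum (fun n => Cpower (RtoC (INR n) + a) (- s)) N + / (s - 1) * zeta_entire (a + RtoC (INR N)) s)
   by (field; auto).
  apply Clim_ext with (2 := HL). intros n. rewrite Csum_split, <- Csum_mult. f_equal.
  apply Csum_ext. intros k _.
  replace (RtoC (INR (N + k)) + a) with (a + RtoC (INR N) + RtoC (INR k)) by (rewrite plus_INR, RtoC_plus; ring).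
  field; auto.
- intros s Hs. destruct (ex_Cderive_zeta_shift a s N Hb) as [l Hl].
  eexists. apply (is_Cderive_mult (zeta_shift a N) (fun s => / (s - 1))); [exact Hl|].
  apply (is_Cderive_comp Cinv (fun s => s - 1)); [apply is_Cderive_inv; now apply Cminus_eq_contra|].
  apply is_Cderive_minus; [apply is_Cderive_id|apply is_Cderive_const].
- assert (Hc := zeta_shift_continuous a 1 N Hb). unfold continuous in Hc. rewrite zeta_shift_1 in Hc by exact Hb.
  apply filterlim_ext_loc with (zeta_shift a N).
  + unfold locally', within. apply locally_Cmod. exists 1%R. split; [lra|]. intros s _ Hs.
    field. now apply Cminus_eq_contra.
  + eapply filterlim_filter_le_1; [|exact Hc]. apply filter_le_within.
Qed.

(** The explicit continuation shows that the choice in [hurwitz_zeta] meets its specification;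
    uniqueness then identifies the two away from 1. *)
Lemma hurwitz_zeta_eq (a s : C) (N : nat) : (3 / 2 <= Re a + INR N)%R -> s <> 1 ->
  hurwitz_zeta s a = zeta_shift a N s / (s - 1).
Proof.
intros Hb Hs. unfold hurwitz_zeta.
assert (H := is_hurwitz_zeta_shift a N Hb).
apply (hurwitz_zeta_unique a _ (fun s => zeta_shift a N s / (s - 1)) s); auto.
apply (epsilon_spec (inhabits (fun _ : C => RtoC 0)) (is_hurwitz_zeta a)). now exists (fun s => zeta_shift a N s / (s - 1)).
Qed.

Lemma hurwitz_zeta_residue (a : C) (N : nat) : (3 / 2 <= Re a + INR N)%R ->
  filterlim (fun w : C => w * hurwitz_zeta (1 + w) a)
    (locally' (T := C_UniformSpace) (RtoC 0)) (Clocally (RtoC 1)).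
Proof.
intros Hb.
assert (Hc : Ccontinuous_at (fun w => zeta_shift a N (1 + w)) (RtoC 0)).
{ apply (Ccontinuous_comp (zeta_shift a N) (fun w : C_UniformSpace => 1 + w)).
  - apply Ccontinuous_plus; [apply Ccontinuous_const|apply continuous_id].
  - now apply zeta_shift_continuous. }
unfold continuous in Hc. replace (1 + 0) with (RtoC 1) in Hc by ring.
rewrite zeta_shift_1 in Hc by exact Hb.
apply filterlim_ext_loc with (fun w => zeta_shift a N (1 + w)).
- assert (E : forall w : C, w <> 0 -> zeta_shift a N (1 + w) = w * hurwitz_zeta (1 + w) a).
  { intros w Hw. rewrite (hurwitz_zeta_eq a (1 + w) N Hb).
    + replace (1 + w - 1) with w by ring. field. exact Hw.
    + intros H. apply Hw. replace w with (1 + w - 1) by ring. rewrite H. ring. }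
  unfold locally', within. apply locally_Cmod. exists 1%R. split; [lra|]. intros w _ Hw. now apply E.
- eapply filterlim_filter_le_1; [|exact Hc]. apply filter_le_within.
Qed.

(** Both branches of the definition are values of one entire function: the exceptional one is its
    value at 1, the limit found in [hurwitz_zeta_residue]. *)
Lemma hurwitz_factor_eq (s a : C) (k N : nat) : (3 / 2 <= Re a + INR N)%R ->
  hurwitz_factor s a k = zeta_shift a N (s + 1 - RtoC (INR (2 * k))).
Proof.
intros Hb. unfold hurwitz_factor. destruct (Ceq_dec s (RtoC (INR (2 * k)))) as [H|H].
- rewrite (is_C_lim_unique _ _ _ (hurwitz_zeta_residue a N Hb)).
  replace (s + 1 - RtoC (INR (2 * k))) with (RtoC 1) by (rewrite H; ring).
  now rewrite zeta_shift_1.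
- assert (H' : s - RtoC (INR (2 * k)) <> 0) by now apply Cminus_eq_contra.
  rewrite (hurwitz_zeta_eq a _ N Hb).
  + replace (s + 1 - RtoC (INR (2 * k)) - 1) with (s - RtoC (INR (2 * k))) by ring. field; auto.
  + intros E. apply H'. replace (s - RtoC (INR (2 * k))) with (s + 1 - RtoC (INR (2 * k)) - 1) by ring.
    rewrite E. ring.
Qed.

(** * Power series of cosine and sine *)

Definition cos_partial (n : nat) (u : C) : C :=
  Csum (fun k => (- (1)) ^ k / RtoC (INR (fact (2 * k))) * u ^ (2 * k)) n.
Definition sin_partial (n : nat) (u : C) : C :=
  Csum (fun k => (- (1)) ^ k / RtoC (INR (fact (S (2 * k)))) * u ^ S (2 * k)) n.

Lemma Cpow_opp_even (v : C) (k : nat) : (- v) ^ (2 * k) = v ^ (2 * k).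
Proof. rewrite !Cpow_mult_r. f_equal. simpl. ring. Qed.

Lemma Cpow_Ci_even (u : C) (k : nat) : (Ci * u) ^ (2 * k) = (- (1)) ^ k * u ^ (2 * k).
Proof.
rewrite !Cpow_mult_r, <- Cpow_mult_l. f_equal.
transitivity ((Ci * Ci) * (u ^ 2)); [simpl; ring|]. now rewrite Ci2.
Qed.

Lemma exp_partial_SS (n : nat) (v : C) :
  exp_partial (2 * S n) v = exp_partial (2 * n) v + v ^ (2 * n) / RtoC (INR (fact (2 * n)))
    + v ^ S (2 * n) / RtoC (INR (fact (S (2 * n)))).
Proof. replace (2 * S n)%nat with (S (S (2 * n))) by lia. reflexivity. Qed.

Lemma exp_partial_cos (n : nat) (u : C) :
  exp_partial (2 * n) (Ci * u) + exp_partial (2 * n) (- (Ci * u)) = 2 * cos_partial n u.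
Proof.
induction n as [|n IH]; [unfold exp_partial, cos_partial; simpl; ring|].
rewrite !exp_partial_SS, !Cpow_S, !Cpow_opp_even, Cpow_Ci_even.
change (cos_partial (S n) u) with
  (cos_partial n u + (- (1)) ^ n / RtoC (INR (fact (2 * n))) * u ^ (2 * n)).
rewrite Cmult_plus_distr_l, <- IH. field. split; apply INR_fact_neq_0_C.
Qed.

Lemma exp_partial_sin (n : nat) (u : C) :
  exp_partial (2 * n) (Ci * u) - exp_partial (2 * n) (- (Ci * u)) = 2 * Ci * sin_partial n u.
Proof.
induction n as [|n IH]; [unfold exp_partial, sin_partial; simpl; ring|].
rewrite !exp_partial_SS, !Cpow_S, !Cpow_opp_even, Cpow_Ci_even.
change (sin_partial (S n) u) with
  (sin_partial n u + (- (1)) ^ n / RtoC (INR (fact (S (2 * n)))) * u ^ S (2 * n)).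
rewrite Cmult_plus_distr_l, <- IH, Cpow_S. field. split; apply INR_fact_neq_0_C.
Qed.

Lemma Cmod_Ci_mult (u : C) : Cmod (Ci * u) = Cmod u.
Proof. rewrite Cmod_mult, Cmod_Ci. ring. Qed.

Lemma C2_neq_0 : RtoC 2 <> 0.
Proof. apply RtoC_neq_0; lra. Qed.

Lemma Ccos_remainder (n : nat) (u : C) :
  (Cmod (Ccos u - cos_partial n u) <= Cmod u ^ (2 * n) / INR (fact (2 * n)) * exp (Cmod u))%R.
Proof.
assert (H1 := Cexp_remainder (2 * n) (Ci * u)). assert (H2 := Cexp_remainder (2 * n) (- (Ci * u))).
rewrite Cmod_opp in H2. rewrite Cmod_Ci_mult in H1, H2.
replace (Ccos u - cos_partial n u) with
  (((Cexp (Ci * u) - exp_partial (2 * n) (Ci * u)) + (Cexp (- (Ci * u)) - exp_partial (2 * n) (- (Ci * u)))) / 2).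
- rewrite Cmod_div by apply C2_neq_0. rewrite Cmod_R, Rabs_pos_eq by lra. apply Rle_div_l; [lra|].
  eapply Rle_trans; [apply Cmod_triangle|]. lra.
- replace (cos_partial n u) with (2 * cos_partial n u / 2) by field.
  rewrite <- exp_partial_cos. unfold Ccos. field.
Qed.

Lemma Csin_remainder (n : nat) (u : C) :
  (Cmod (Csin u - sin_partial n u) <= Cmod u ^ (2 * n) / INR (fact (2 * n)) * exp (Cmod u))%R.
Proof.
assert (H1 := Cexp_remainder (2 * n) (Ci * u)). assert (H2 := Cexp_remainder (2 * n) (- (Ci * u))).
rewrite Cmod_opp in H2. rewrite Cmod_Ci_mult in H1, H2.
replace (Csin u - sin_partial n u) with
  (((Cexp (Ci * u) - exp_partial (2 * n) (Ci * u)) - (Cexp (- (Ci * u)) - exp_partial (2 * n) (- (Ci * u)))) / (2 * Ci)).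
- rewrite Cmod_div by (apply Cmult_neq_0; [apply C2_neq_0|apply Ci_nz]).
  rewrite Cmod_mult, Cmod_Ci, Cmod_R, Rabs_pos_eq by lra. apply Rle_div_l; [lra|].
  eapply Rle_trans; [apply Cmod_triangle|]. rewrite Cmod_opp. lra.
- replace (sin_partial n u) with (2 * Ci * sin_partial n u / (2 * Ci)) by (field; apply Ci_nz).
  rewrite <- exp_partial_sin. unfold Csin. field. apply Ci_nz.
Qed.

Lemma Cmod_exp_partial_le (n : nat) (v : C) : (Cmod (exp_partial n v) <= exp (Cmod v))%R.
Proof.
destruct n as [|n].
- unfold exp_partial; simpl. rewrite Cmod_0. left; apply exp_pos.
- eapply Rle_trans; [|apply (exp_ge_taylor (Cmod v) n), Cmod_ge_0].
  assert (H : forall k, Cmod (v ^ k / RtoC (INR (fact k))) = (Cmod v ^ k / INR (fact k))%R).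
  { intros k. rewrite Cmod_div by apply INR_fact_neq_0_C. rewrite Cmod_pow, Cmod_R, Rabs_pos_eq; auto. apply pos_INR. }
  induction n as [|n IH].
  + change (exp_partial 1 v) with (0 + v ^ 0 / RtoC (INR (fact 0))).
    rewrite Cplus_0_l, (H 0%nat). simpl. lra.
  + rewrite tech5. unfold exp_partial in *.
    change (Csum (fun k => v ^ k / RtoC (INR (fact k))) (S (S n))) with
     (Csum (fun k => v ^ k / RtoC (INR (fact k))) (S n) + v ^ S n / RtoC (INR (fact (S n)))).
    eapply Rle_trans; [apply Cmod_triangle|]. rewrite H. lra.
Qed.

Lemma Cmod_cos_partial_le (n : nat) (u : C) : (Cmod (cos_partial n u) <= exp (Cmod u))%R.
Proof.
replace (cos_partial n u) with ((exp_partial (2 * n) (Ci * u) + exp_partial (2 * n) (- (Ci * u))) / 2)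
  by (rewrite exp_partial_cos; field).
rewrite Cmod_div by apply C2_neq_0. rewrite Cmod_R, Rabs_pos_eq by lra. apply Rle_div_l; [lra|].
eapply Rle_trans; [apply Cmod_triangle|].
assert (H1 := Cmod_exp_partial_le (2 * n) (Ci * u)). assert (H2 := Cmod_exp_partial_le (2 * n) (- (Ci * u))).
rewrite Cmod_opp in H2. rewrite Cmod_Ci_mult in H1, H2. lra.
Qed.

Lemma even_taylor_lim (r : R) : is_lim_seq (fun n => (r ^ (2 * n) / INR (fact (2 * n)) * exp r)%R) 0%R.
Proof.
assert (H : is_lim_seq (fun n => (r ^ n / INR (fact n))%R) 0%R)
  by (apply is_lim_seq_Reals, cv_speed_pow_fact).
apply is_lim_seq_ext with (fun n => (exp r * (r ^ (2 * n) / INR (fact (2 * n))))%R); [intros; ring|].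
replace (Finite 0) with (Rbar_mult (exp r) 0%R) by (simpl; f_equal; ring).
apply is_lim_seq_scal_l.
apply (is_lim_seq_subseq (fun n => (r ^ n / INR (fact n))%R) 0%R (fun n => (2 * n)%nat)); auto.
apply eventually_subseq. intros n; lia.
Qed.

Lemma cos_partial_lim (u : C) : Clim (fun n => cos_partial n u) (Ccos u).
Proof.
apply Clim_bound with (N0 := 0%nat) (v := fun n => (Cmod u ^ (2 * n) / INR (fact (2 * n)) * exp (Cmod u))%R);
 [|apply even_taylor_lim].
intros n _. replace (cos_partial n u - Ccos u) with (- (Ccos u - cos_partial n u)) by ring.
rewrite Cmod_opp. apply Ccos_remainder.
Qed.

Lemma sin_partial_lim (u : C) : Clim (fun n => sin_partial n u) (Csin u).
Proof.
apply Clim_bound with (N0 := 0%nat) (v := fun n => (Cmod u ^ (2 * n) / INR (fact (2 * n)) * exp (Cmod u))%R);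
 [|apply even_taylor_lim].
intros n _. replace (sin_partial n u - Csin u) with (- (Csin u - sin_partial n u)) by ring.
rewrite Cmod_opp. apply Csin_remainder.
Qed.

(** The Euler operator u d/du turns cos u into - u sin u. The left sum has one term more because its
    term [k = 0] vanishes. *)
Lemma cos_partial_euler (n : nat) (u : C) :
  Csum (fun k => RtoC (INR (2 * k)) * ((- (1)) ^ k / RtoC (INR (fact (2 * k))) * u ^ (2 * k))) (S n)
  = - (u * sin_partial n u).
Proof.
induction n as [|n IH]; [unfold sin_partial; simpl; ring|].
change (sin_partial (S n) u) with
  (sin_partial n u + (- (1)) ^ n / RtoC (INR (fact (S (2 * n)))) * u ^ S (2 * n)).
set (f := fun k => RtoC (INR (2 * k)) * ((- (1)) ^ k / RtoC (INR (fact (2 * k))) * u ^ (2 * k))) in *.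
change (Csum f (S (S n))) with (Csum f (S n) + f (S n)). rewrite IH. unfold f.
replace (2 * S n)%nat with (S (S (2 * n))) by lia.
rewrite (fact_simpl (S (2 * n))), mult_INR, RtoC_mult, !Cpow_S.
field. split; [apply INR_fact_neq_0_C|]. apply RtoC_neq_0. now apply not_0_INR.
Qed.

Lemma Clim_Csum_swap (f : nat -> nat -> C) (G : nat -> C) (N : nat) :
  (forall m, (m < N)%nat -> Clim (Csum (fun k => f k m)) (G m)) ->
  Clim (Csum (fun k => Csum (f k) N)) (Csum G N).
Proof.
induction N as [|N IH]; intros H; simpl.
- apply Clim_ext with (fun _ => RtoC 0); [|apply Clim_const].
  induction n as [|n IHn]; simpl; auto. rewrite <- IHn. ring.
- apply Clim_ext with (fun n => Csum (fun k => Csum (f k) N) n + Csum (fun k => f k N) n).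
  { intros n. now rewrite <- Csum_plus. }
  apply Clim_plus; auto.
Qed.

(* - d/dz (z^(-s) cos (theta z)) *)
Definition summand (s : C) (theta : R) (z : C) : C :=
  s * (/ Cpower z (s + 1) * Ccos (RtoC theta * z)) + RtoC theta * (/ Cpower z s * Csin (RtoC theta * z)).

Definition cos_coeff (theta : R) (k : nat) : C :=
  (- (1)) ^ k / RtoC (INR (fact (2 * k))) * RtoC theta ^ (2 * k).

(** Termwise - d/dz of [z^(-s) cos(theta z)]: the part with [s] sums to the cosine, the part with
    [2k] to the sine by [cos_partial_euler]. Only [z <> 0] is assumed, so the terms split off by the
    shift are covered wherever they lie. *)
Lemma summand_expansion (s z : C) (theta : R) : z <> 0 ->
  Clim (Csum (fun k => cos_coeff theta k * ((s - RtoC (INR (2 * k))) * Cpower z (- (s + 1 - RtoC (INR (2 * k)))))))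
    (summand s theta z).
Proof.
(* The shift by 1 matches the extra term in [cos_partial_euler]. *)
intros Hz. set (u := RtoC theta * z). apply Clim_shift with 1%nat.
apply Clim_ext with (fun n => / Cpower z (s + 1) * (s * cos_partial (1 + n) u + u * sin_partial n u)).
- intros n.
  replace (u * sin_partial n u) with
    (- (1) * Csum (fun k => RtoC (INR (2 * k)) * ((- (1)) ^ k / RtoC (INR (fact (2 * k))) * u ^ (2 * k))) (1 + n))
    by (simpl Nat.add; rewrite cos_partial_euler; ring).
  unfold cos_partial. rewrite <- !Csum_mult, <- Csum_plus, <- Csum_mult.
  apply Csum_ext. intros k _.
  replace (- (s + 1 - RtoC (INR (2 * k)))) with (- (s + 1) + RtoC (INR (2 * k))) by ring.
  rewrite (Cpower_plus z (- (s + 1))), Cpower_opp, Cpower_INR by auto. unfold u, cos_coeff. rewrite Cpow_mult_l.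
  field. split; [apply Cpower_neq_0|apply INR_fact_neq_0_C].
- replace (summand s theta z) with (/ Cpower z (s + 1) * (s * Ccos u + u * Csin u)).
  2: { unfold summand. fold u. rewrite Cpower_plus, Cpower_1 by auto. unfold u at 2. field.
       split; auto. apply Cpower_neq_0. }
  apply Clim_mult, Clim_plus; apply Clim_mult.
  + assert (H := cos_partial_lim u). apply Clim_Cmod. intros e He.
    destruct (proj1 (Clim_Cmod _ _) H e He) as [N HN]. exists N. intros n Hn. apply HN. lia.
  + apply sin_partial_lim.
Qed.

Lemma cos_partial_continuous (n : nat) (u : C) : Ccontinuous_at (cos_partial n) u.
Proof.
induction n as [|n IH]; [apply (Ccontinuous_const 0)|].
apply (Ccontinuous_plus (cos_partial n)); auto.
apply (Ccontinuous_mult (fun _ => (- (1)) ^ n / RtoC (INR (fact (2 * n)))) (fun u : C_UniformSpace => u ^ (2 * n)));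
 [apply Ccontinuous_const|].
destruct (2 * n)%nat as [|k]; [apply (Ccontinuous_const 1)|].
eapply is_Cderive_continuous, is_Cderive_Cpow.
Qed.

(** * Integration of the cosine series *)

Lemma is_Cderive_power_cos (s z : C) (theta : R) : (0 < Re z)%R ->
  is_Cderive (fun z => Cpower z (- s) * Ccos (RtoC theta * z)) z (- summand s theta z).
Proof.
intros Hz. assert (Hz0 := Re_pos_neq_0 z Hz).
apply is_Cderive_eq with
  ((- s * Cpower z (- s - 1)) * Ccos (RtoC theta * z) +
   Cpower z (- s) * ((0 * z + RtoC theta * 1) * - Csin (RtoC theta * z))).
- apply (is_Cderive_mult (fun z => Cpower z (- s)) (fun z => Ccos (RtoC theta * z)));
   [now apply is_Cderive_Cpower_l|].
  apply (is_Cderive_comp Ccos (fun z => RtoC theta * z)); [apply is_Cderive_Ccos|].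
  apply (is_Cderive_mult (fun _ => RtoC theta) (fun z => z)); [apply is_Cderive_const|apply is_Cderive_id].
- unfold summand. replace (- s - 1) with (- (s + 1)) by ring. rewrite !Cpower_opp. ring.
Qed.

Lemma Rpower_neg_anti (x y t : R) : (0 < x <= y)%R -> (0 <= t)%R -> (Rpower y (- t) <= Rpower x (- t))%R.
Proof.
intros Hx Ht. rewrite !Rpower_Ropp. apply Rinv_le_contravar; [apply Rpower_pos|]. apply Rle_Rpower_l; lra.
Qed.

(** The exponent [Re s] is shared out: [(Re s - 1) / 2 > 0] for decay in the real part and
    [(Re s + 1) / 2 > 1] for integrability. The factor with base 2 comes from
    [|z| >= (1 + |Im z|) / 2], and the cosine uses up the exponential. *)
Lemma strip_growth_power_cos (s : C) (theta : R) : (1 < Re s)%R -> (Rabs theta <= 2 * PI)%R ->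
  strip_growth (fun z => Cpower z (- s) * Ccos (RtoC theta * z))
    (exp (PI * Rabs (Im s)) * Rpower 2 ((Re s + 1) / 2)) ((Re s - 1) / 2) ((Re s + 1) / 2).
Proof.
intros Hs Hth. assert (HPI := PI_gt_2).
split. { apply Rmult_le_pos; left; [apply exp_pos|apply Rpower_pos]. }
intros z Hz. assert (Hz0 := Re_pos_neq_0 z ltac:(lra)). assert (Hm := Re_le_Cmod z). assert (Hi := im_le_Cmod z).
set (d := ((Re s - 1) / 2)%R). set (tau := ((Re s + 1) / 2)%R).
assert (H1 := Cmod_Cpower_le z (- s) Hz0).
replace (Re (- s)) with (- d + - tau)%R in H1 by (unfold d, tau; simpl; unfold Re; field).
replace (Im (- s)) with (- Im s)%R in H1 by reflexivity.
rewrite Rabs_Ropp, Rpower_plus in H1.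
assert (H2 : (Rpower (Cmod z) (- d) <= Rpower (Re z) (- d))%R) by (apply Rpower_neg_anti; unfold d; lra).
assert (H3 : (Rpower (Cmod z) (- tau) <= Rpower 2 tau * Rpower (1 + Rabs (Im z)) (- tau))%R).
{ assert (Hi0 := Rabs_pos (Im z)).
  apply Rle_trans with (Rpower (/ 2 * (1 + Rabs (Im z))) (- tau)).
  - apply Rpower_neg_anti; unfold tau; lra.
  - rewrite <- Rpower_mult_distr by lra. right. f_equal.
    unfold Rpower. rewrite ln_Rinv by lra. f_equal; ring. }
assert (H4 : (Cmod (Ccos (RtoC theta * z)) <= exp (2 * PI * Rabs (Im z)))%R).
{ eapply Rle_trans; [apply Cmod_Ccos_le|]. apply exp_le.
  replace (Im (RtoC theta * z)) with (theta * Im z)%R by (simpl; unfold Im; ring).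
  rewrite Rabs_mult. apply Rmult_le_compat_r; [apply Rabs_pos|auto]. }
rewrite Cmod_mult.
set (E := exp (PI * Rabs (Im s))) in *. assert (HE : (0 < E)%R) by apply exp_pos.
assert (P1 := Rpower_pos (Cmod z) (- d)). assert (P2 := Rpower_pos (Cmod z) (- tau)).
apply Rmult_le_compat; auto using Cmod_ge_0.
eapply Rle_trans; [apply H1|].
apply Rle_trans with (Rpower (Re z) (- d) * (Rpower 2 tau * Rpower (1 + Rabs (Im z)) (- tau)) * E)%R; [|right; ring].
apply Rmult_le_compat_r; [lra|]. apply Rmult_le_compat; lra.
Qed.

Lemma cos_integrals (b s : C) (theta : R) :
  (3 / 2 <= Re b)%R -> (1 < Re s)%R -> (Rabs theta <= 2 * PI)%R ->
  exists J, Clim (Csum (fun n => summand s theta (b + RtoC (INR n)))) J /\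
    Clim (Csum (fun k => cos_coeff theta k * zeta_entire b (s + 1 - RtoC (INR (2 * k))))) J.
Proof.
intros Hb Hs Hth. assert (HPI := PI_gt_2).
destruct (plana_sum _ _ _ _ _ b (fun z Hz => is_Cderive_power_cos s z theta Hz)
  (strip_growth_power_cos s theta Hs Hth)) as [J [HJ HL]]; try lra.
exists J. split.
{ apply Clim_ext with (2 := HL). intros n. apply Csum_ext. intros k _. ring. }
(* The integrand that remains when the Taylor polynomial of the cosine is removed; each monomial
   gives the power [2k - s], hence [zeta_entire] at [s + 1 - 2k]. *)
set (f := fun (n : nat) t => Cpower (b + ((- / 2)%R, t)) (- s) *
   (Ccos (RtoC theta * (b + ((- / 2)%R, t))) - cos_partial n (RtoC theta * (b + ((- / 2)%R, t))))).
assert (Hf : forall n, is_CIntR (fun t => f n t * RtoC (sech2 t))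
  (J - Csum (fun k => cos_coeff theta k * zeta_entire b (s + 1 - RtoC (INR (2 * k)))) n)).
{ intros n.
  apply is_CIntR_ext with (fun t => plana_integrand (fun z => Cpower z (- s) * Ccos (RtoC theta * z)) b t -
     Csum (fun k => cos_coeff theta k * plana_integrand (fun z => Cpower z (1 - (s + 1 - RtoC (INR (2 * k))))) b t) n).
  - intros t. destruct (line_bounds b t Hb) as [H1 _].
    assert (Hz0 := Re_pos_neq_0 (b + ((- / 2)%R, t)) ltac:(lra)).
    unfold f, plana_integrand. set (z := b + ((- / 2)%R, t)) in *.
    replace (Csum _ n) with (Cpower z (- s) * cos_partial n (RtoC theta * z) * RtoC (sech2 t)); [ring|].
    transitivity ((Cpower z (- s) * RtoC (sech2 t)) * cos_partial n (RtoC theta * z)); [ring|].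
    unfold cos_partial. rewrite <- Csum_mult. apply Csum_ext. intros k _.
    replace (1 - (s + 1 - RtoC (INR (2 * k)))) with (- s + RtoC (INR (2 * k))) by ring.
    rewrite (Cpower_plus z (- s)), Cpower_INR by auto. unfold cos_coeff. rewrite Cpow_mult_l. ring.
  - apply is_CIntR_minus; auto. apply (is_CIntR_Csum (fun k t => cos_coeff theta k * plana_integrand (fun z => Cpower z (1 - (s + 1 - RtoC (INR (2 * k))))) b t)).
    intros k. apply is_CIntR_mult. now apply is_CIntR_zeta_entire. }
assert (Hb0 := Cmod_ge_0 b).
(* The cosine and all its partial sums are bounded by [exp |u|] with [|u| <= 2 pi (|b| + 1 + |t|)],
   so the majorant does not depend on [n]. On this single line the full exponent [Re s] is available
   for decay in [t]. *)
set (K := (Rpower (2 + Cmod b) (Re s) * exp (PI * Rabs (Im s)) * (2 * exp (2 * PI * (Cmod b + 1))))%R).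
assert (HK : (0 <= K)%R).
{ unfold K. apply Rmult_le_pos; [apply Rmult_le_pos; left; [apply Rpower_pos|apply exp_pos]|].
  generalize (exp_pos (2 * PI * (Cmod b + 1))); lra. }
assert (Hpow : forall t, (Cmod (Cpower (b + ((- / 2)%R, t)) (- s)) <=
   Rpower (2 + Cmod b) (Re s) * Rpower (1 + Rabs t) (- Re s) * exp (PI * Rabs (Im s)))%R).
{ intros t. destruct (line_bounds b t Hb) as [H1 [H2 [_ [_ H3]]]].
  assert (Ht := Rabs_pos t).
  set (z := b + ((- / 2)%R, t)) in *.
  eapply Rle_trans; [apply Cmod_Cpower_le, Re_pos_neq_0; lra|].
  replace (Re (- s)) with (- Re s)%R by reflexivity. replace (Im (- s)) with (- Im s)%R by reflexivity.
  rewrite Rabs_Ropp. apply Rmult_le_compat_r; [left; apply exp_pos|].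
  rewrite !Rpower_Ropp.
  assert (H4 : (Rpower (1 + Rabs t) (Re s) <= Rpower (Cmod z) (Re s) * Rpower (2 + Cmod b) (Re s))%R).
  { rewrite Rpower_mult_distr by lra. apply Rle_Rpower_l; lra. }
  assert (P1 := Rpower_pos (1 + Rabs t) (Re s)). assert (P2 := Rpower_pos (Cmod z) (Re s)).
  set (A := Rpower (1 + Rabs t) (Re s)) in *. set (Q := Rpower (Cmod z) (Re s)) in *.
  set (P := Rpower (2 + Cmod b) (Re s)) in *.
  apply Rmult_le_reg_l with (A * Q)%R; [nra|].
  replace (A * Q * / Q)%R with A by (field; lra).
  replace (A * Q * (P * / A))%R with (Q * P)%R by (field; lra). auto. }
assert (Hu : forall t, (Cmod (RtoC theta * (b + ((- / 2)%R, t))) <= 2 * PI * (Cmod b + 1) + 2 * PI * Rabs t)%R).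
{ intros t. destruct (line_bounds b t Hb) as [_ [_ [_ [H3 _]]]]. rewrite Cmod_mult, Cmod_R.
  apply Rle_trans with (2 * PI * (Cmod b + 1 + Rabs t))%R; [|right; ring].
  apply Rmult_le_compat; auto using Rabs_pos, Cmod_ge_0. }
assert (Hdom : forall n, dominated (Re s) (2 * PI * K) (fun t => f n t * RtoC (sech2 t))).
{ intros n. apply dominated_mult_sech2; auto.
  - intros t. destruct (line_bounds b t Hb) as [H1 _]. unfold f.
    apply (Ccontinuous_line (fun z => Cpower z (- s) * (Ccos (RtoC theta * z) - cos_partial n (RtoC theta * z)))).
    set (z := b + ((- / 2)%R, t)) in *.
    assert (Hz : (0 < Re z)%R) by (apply Rlt_le_trans with 1%R; [apply Rlt_0_1|exact H1]).
    apply Ccontinuous_mult.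
    { exact (is_Cderive_continuous _ _ _ (is_Cderive_Cpower_l z (- s) Hz)). }
    assert (Hlin : Ccontinuous_at (fun z => RtoC theta * z) z).
    { apply (Ccontinuous_mult (fun _ => RtoC theta) (fun z : C_UniformSpace => z)); [apply continuous_const|apply continuous_id]. }
    apply Ccontinuous_minus.
    + apply (Ccontinuous_comp Ccos (fun z : C_UniformSpace => RtoC theta * z)); auto.
      eapply is_Cderive_continuous, is_Cderive_Ccos.
    + apply (Ccontinuous_comp (cos_partial n) (fun z : C_UniformSpace => RtoC theta * z)); auto.
      apply cos_partial_continuous.
  - intros t. unfold f. rewrite Cmod_mult.
    assert (H1 := Hpow t). assert (H2 := Hu t).
    set (u := RtoC theta * (b + ((- / 2)%R, t))) in *.
    assert (H3 : (Cmod (Ccos u - cos_partial n u) <= 2 * exp (2 * PI * (Cmod b + 1)) * exp (2 * PI * Rabs t))%R).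
    { apply Rle_trans with (2 * exp (Cmod u))%R.
      - eapply Rle_trans; [apply Cmod_triangle|]. rewrite Cmod_opp.
        assert (h1 := Cmod_cos_partial_le n u).
        assert (h2 : (Cmod (Ccos u) <= exp (Cmod u))%R).
        { eapply Rle_trans; [apply Cmod_Ccos_le|]. apply exp_le, im_le_Cmod. }
        lra.
      - rewrite Rmult_assoc, <- exp_plus. apply Rmult_le_compat_l; [lra|]. now apply exp_le. }
    eapply Rle_trans; [apply Rmult_le_compat; [apply Cmod_ge_0|apply Cmod_ge_0|apply H1|apply H3]|].
    right. unfold K. ring. }
assert (L0 : Clim (fun n => J - Csum (fun k => cos_coeff theta k * zeta_entire b (s + 1 - RtoC (INR (2 * k)))) n) 0).
{ apply dominated_convergence with (tau := Re s) (B := (2 * PI * K)%R) (f := fun n t => f n t * RtoC (sech2 t)); auto.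
  intros N e He.
  (* [r] bounds the argument of the cosine for [|t| <= N], and [P] below bounds the power and the
     weight together, so the Taylor remainder at [r] controls everything. *)
  set (r := (2 * PI * (Cmod b + 1) + 2 * PI * INR N)%R).
  set (P := (Rpower (2 + Cmod b) (Re s) * exp (PI * Rabs (Im s)) * (2 * PI))%R).
  assert (HP : (0 < P)%R).
  { unfold P. apply Rmult_lt_0_compat; [apply Rmult_lt_0_compat; [apply Rpower_pos|apply exp_pos]|lra]. }
  assert (Hlim := even_taylor_lim r). apply is_lim_seq_spec in Hlim.
  destruct (Hlim (mkposreal (e / P) ltac:(now apply Rdiv_lt_0_compat))) as [M HM].
  exists M. intros n t Hn Ht. specialize (HM n Hn).
  change (Rabs (r ^ (2 * n) / INR (fact (2 * n)) * exp r - 0) < e / P)%R in HM. rewrite Rminus_0_r in HM.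
  apply Rabs_lt_between in HM.
  assert (H2 : (Cmod (RtoC theta * (b + ((- / 2)%R, t))) <= r)%R).
  { eapply Rle_trans; [apply Hu|]. unfold r. apply Rplus_le_compat_l. apply Rmult_le_compat_l; lra. }
  unfold f. rewrite !Cmod_mult.
  assert (H1 := Hpow t).
  assert (H3 := Ccos_remainder n (RtoC theta * (b + ((- / 2)%R, t)))).
  set (u := RtoC theta * (b + ((- / 2)%R, t))) in *.
  assert (Hu0 := Cmod_ge_0 u).
  assert (H4 : (Cmod (Ccos u - cos_partial n u) <= e / P)%R).
  { eapply Rle_trans; [apply H3|]. apply Rle_trans with (r ^ (2 * n) / INR (fact (2 * n)) * exp r)%R; [|lra].
    apply Rmult_le_compat.
    - apply Rdiv_le_0_compat; [now apply pow_le|apply INR_fact_lt_0].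
    - left; apply exp_pos.
    - unfold Rdiv. apply Rmult_le_compat_r; [left; apply Rinv_0_lt_compat, INR_fact_lt_0|]. apply pow_incr; lra.
    - now apply exp_le. }
  assert (H5 : (Rpower (1 + Rabs t) (- Re s) <= 1)%R).
  { assert (Ht0 := Rabs_pos t).
    apply Rle_trans with (Rpower (1 + Rabs t) 0); [apply Rle_Rpower; lra|rewrite Rpower_O; lra]. }
  assert (Hs2 := sech2_bound t).
  assert (H6 : (Cmod (RtoC (sech2 t)) <= 2 * PI)%R).
  { rewrite Cmod_R, Rabs_pos_eq by lra.
    assert (exp (- (2 * PI * Rabs t)) <= 1)%R.
    { rewrite <- exp_0. apply exp_le. generalize (Rabs_pos t); nra. }
    nra. }
  assert (H7 : (Cmod (Cpower (b + ((- / 2)%R, t)) (- s)) <= Rpower (2 + Cmod b) (Re s) * exp (PI * Rabs (Im s)))%R).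
  { eapply Rle_trans; [apply H1|]. apply Rmult_le_compat_r; [left; apply exp_pos|].
    generalize (Rpower_pos (2 + Cmod b) (Re s)). nra. }
  apply Rle_trans with ((Rpower (2 + Cmod b) (Re s) * exp (PI * Rabs (Im s))) * (e / P) * (2 * PI))%R.
  - apply Rmult_le_compat; auto using Cmod_ge_0.
    + apply Rmult_le_pos; apply Cmod_ge_0.
    + apply Rmult_le_compat; auto using Cmod_ge_0.
  - right. unfold P. field. unfold P in HP.
    repeat split; try lra; apply Rgt_not_eq; [apply exp_pos|apply Rpower_pos]. }
apply (Clim_minus _ _ _ _ (Clim_const J)) in L0.
replace (J - 0) with J in L0 by ring.
apply Clim_ext with (2 := L0). intros n. ring.
Qed.

(** * Convergence of the series on the left and conclusion *)

Lemma telescoping_ex_series (sigma K : R) : (1 < sigma)%R ->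
  ex_series (fun n => K * Rpower (2 + INR n) (- sigma))%R.
Proof.
intros Hs. apply (ex_series_scal_l (K := R_AbsRing) K (fun n => Rpower (2 + INR n) (- sigma))).
(* [v n - v (S n)] is the integral of [(1 + t)^(-sigma)] over [[n, n + 1]], whose integrand is at
   least its value at the right end. *)
set (v := fun n => (Rpower (1 + INR n) (1 - sigma) / (sigma - 1))%R).
apply (ex_series_le (V := R_CompleteNormedModule)) with (fun n => (v n - v (S n))%R).
- intros n. assert (Hn := pos_INR n). change (Rabs (Rpower (2 + INR n) (- sigma)) <= v n - v (S n))%R.
  rewrite Rabs_pos_eq by (left; apply Rpower_pos).
  replace (v n - v (S n))%R with ((Rpower (1 + INR n) (1 - sigma) - Rpower (1 + (INR n + 1)) (1 - sigma)) / (sigma - 1))%R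
   by (unfold v; rewrite S_INR; field; lra).
  replace (Rpower (2 + INR n) (- sigma)) with (((INR n + 1) - INR n) * Rpower (2 + INR n) (- sigma))%R by ring.
  apply (is_RInt_le (fun _ => Rpower (2 + INR n) (- sigma)) (fun t => Rpower (1 + Rabs t) (- sigma)) (INR n) (INR n + 1)); [lra| |now apply is_RInt_tail_right; lra|].
  + apply (is_RInt_const (V := R_NormedModule)).
  + intros t Ht. rewrite Rabs_pos_eq by lra. apply Rpower_neg_anti; lra.
- exists (v 0%nat).
  assert (Hv : is_lim_seq v 0%R).
  { apply is_lim_seq_ext with (fun n => (/ (sigma - 1) * Rpower (1 + INR n) (- (sigma - 1)))%R).
    - intros n. unfold v, Rdiv. rewrite Rmult_comm. do 2 f_equal. ring.
    - apply Rpower_neg_lim_scal; lra. }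
  assert (H : is_lim_seq (fun n => (v 0%nat - v (S n))%R) (v 0%nat)).
  { replace (Finite (v 0%nat)) with (Finite (v 0%nat - 0)%R) by (f_equal; ring).
    apply is_lim_seq_minus'; [apply is_lim_seq_const|]. now apply -> is_lim_seq_incr_1. }
  apply is_lim_seq_ext with (2 := H). intros n. induction n as [|n IH].
  + now rewrite sum_O.
  + rewrite sum_Sn, <- IH. unfold plus; simpl. ring.
Qed.

Lemma Cseries_convergent (f : nat -> C) (N : nat) (sigma K : R) : (1 < sigma)%R ->
  (forall n, (Cmod (f (N + n)%nat) <= K * Rpower (2 + INR n) (- sigma))%R) ->
  exists l, Clim (Csum f) l.
Proof.
intros Hs H.
destruct (ex_series_le (V := C_CompleteNormedModule) (fun n => f (N + n)%nat) _ H (telescoping_ex_series sigma K Hs)) as [l Hl].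
exists (Csum f N + l). apply Clim_shift with N.
apply Clim_ext with (fun n => Csum f N + Csum (fun n => f (N + n)%nat) n).
{ intros n. now rewrite Csum_split. }
apply Clim_plus; [apply Clim_const|]. apply is_series_Csum. exact Hl.
Qed.

Lemma Cmod_inv_Cpower_shift (a w : C) (N n : nat) : (2 <= Re a + INR N)%R -> (0 <= Re w)%R ->
  (Cmod (/ Cpower (a + RtoC (INR (N + n))) w) <= exp (PI * Rabs (Im w)) * Rpower (2 + INR n) (- Re w))%R.
Proof.
intros Ha Hw. rewrite <- Cpower_opp. set (z := a + RtoC (INR (N + n))).
assert (Hn := pos_INR n).
assert (Hr : (2 + INR n <= Re z)%R) by (unfold z; rewrite plus_INR; simpl; unfold Re in *; lra).
assert (Hm := Re_le_Cmod z).
eapply Rle_trans; [apply Cmod_Cpower_le, Re_pos_neq_0; lra|].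
replace (Re (- w)) with (- Re w)%R by reflexivity. replace (Im (- w)) with (- Im w)%R by reflexivity.
rewrite Rabs_Ropp, Rmult_comm. apply Rmult_le_compat_l; [left; apply exp_pos|]. apply Rpower_neg_anti; lra.
Qed.

Theorem theorem3p19 (c : R) (a s : C) (x : R)
  (hc : (0 < c)%R)
  (ha : forall m : nat, a <> - RtoC (INR m))
  (hs : (1 < Re s)%R)
  (hx : (Rabs x <= 2 * c)%R) :
  filterlim (fun w : C => w * hurwitz_zeta (1 + w) a)
    (locally' (T := C_UniformSpace) (RtoC 0))
    (locally (T := C_UniformSpace) (RtoC 1)) /\
  exists S1 S2 : C,
    is_series (K := C_AbsRing) (V := C_NormedModule)
      (fun n : nat =>
         1 / Cpower (a + RtoC (INR n)) (s + 1)
         * Ccos ((a + RtoC (INR n)) * RtoC PI * RtoC x / RtoC c)) S1 /\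
    is_series (K := C_AbsRing) (V := C_NormedModule)
      (fun n : nat =>
         1 / Cpower (a + RtoC (INR n)) s
         * Csin ((a + RtoC (INR n)) * RtoC PI * RtoC x / RtoC c)) S2 /\
    is_series (K := C_AbsRing) (V := C_NormedModule)
      (fun k : nat =>
         (- (1)) ^ k / RtoC (INR (fact (2 * k)))
         * (RtoC PI * RtoC x / RtoC c) ^ (2 * k)
         * hurwitz_factor s a k)
      (s * S1 + RtoC PI * RtoC x / RtoC c * S2).
Proof.
assert (HPI := PI_gt_2).
(* The bound 2 matches the comparison series in [2 + n] and is more than the 3/2 required by the
   line integral. *)
assert (HN : exists N, (2 <= Re a + INR N)%R).
{ destruct (nfloor_ex (2 + Rabs (Re a))) as [N HN]; [generalize (Rabs_pos (Re a)); lra|].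
  exists (S N). rewrite S_INR. generalize (Rle_abs (- Re a)). rewrite Rabs_Ropp. lra. }
destruct HN as [N HN].
assert (Hb : (3 / 2 <= Re a + INR N)%R) by lra.
split; [exact (hurwitz_zeta_residue a N Hb)|].
assert (Hc0 : RtoC c <> 0) by (apply RtoC_neq_0; lra).
set (theta := (PI * x / c)%R).
assert (Eth : RtoC PI * RtoC x / RtoC c = RtoC theta).
{ unfold theta. rewrite RtoC_div, RtoC_mult by lra. reflexivity. }
assert (Hth : (Rabs theta <= 2 * PI)%R).
{ unfold theta, Rdiv. rewrite !Rabs_mult, Rabs_inv, (Rabs_pos_eq PI), (Rabs_pos_eq c) by lra.
  apply (Rle_div_l (PI * Rabs x) (2 * PI) c); [lra|]. nra. }
assert (Earg : forall n, (a + RtoC (INR n)) * RtoC PI * RtoC x / RtoC c = RtoC theta * (a + RtoC (INR n))).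
{ intros n. rewrite <- Eth. field. exact Hc0. }
(* The excluded values of [a] enter here: no term of the series, in particular none that is split
   off, has base 0. *)
assert (Hz : forall n, a + RtoC (INR n) <> 0).
{ intros n H. apply (ha n). replace a with (a + RtoC (INR n) - RtoC (INR n)) by ring. rewrite H. ring. }
(* The imaginary part is the same for all [n], so the cosine and sine factors are bounded and the
   powers alone give convergence. *)
assert (Harg : forall n, Im (RtoC theta * (a + RtoC (INR n))) = (theta * Im a)%R)
  by (intros n; simpl; unfold Im; ring).
set (t1 := fun n => 1 / Cpower (a + RtoC (INR n)) (s + 1) * Ccos ((a + RtoC (INR n)) * RtoC PI * RtoC x / RtoC c)).
set (t2 := fun n => 1 / Cpower (a + RtoC (INR n)) s * Csin ((a + RtoC (INR n)) * RtoC PI * RtoC x / RtoC c)).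
assert (X1 : exists S1, Clim (Csum t1) S1).
{ apply (Cseries_convergent t1 N (Re s + 1) (exp (PI * Rabs (Im (s + 1))) * exp (Rabs (theta * Im a)))); [lra|].
  intros n. unfold t1, Cdiv at 1. rewrite Cmult_1_l, Cmod_mult, Earg.
  assert (H1 := Cmod_inv_Cpower_shift a (s + 1) N n HN ltac:(simpl; unfold Re in *; lra)).
  assert (H2 := Cmod_Ccos_le (RtoC theta * (a + RtoC (INR (N + n))))). rewrite Harg in H2.
  eapply Rle_trans; [apply Rmult_le_compat; [apply Cmod_ge_0|apply Cmod_ge_0|apply H1|apply H2]|].
  right. replace (Re (s + 1)) with (Re s + 1)%R by reflexivity. ring. }
assert (X2 : exists S2, Clim (Csum t2) S2).
{ apply (Cseries_convergent t2 N (Re s) (exp (PI * Rabs (Im s)) * exp (Rabs (theta * Im a)))); [lra|].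
  intros n. unfold t2, Cdiv at 1. rewrite Cmult_1_l, Cmod_mult, Earg.
  assert (H1 := Cmod_inv_Cpower_shift a s N n HN ltac:(lra)).
  assert (H2 := Cmod_Csin_le (RtoC theta * (a + RtoC (INR (N + n))))). rewrite Harg in H2.
  eapply Rle_trans; [apply Rmult_le_compat; [apply Cmod_ge_0|apply Cmod_ge_0|apply H1|apply H2]|].
  right. ring. }
destruct X1 as [S1 HS1]. destruct X2 as [S2 HS2].
exists S1, S2. rewrite Eth.
split; [now apply is_series_Csum|]. split; [now apply is_series_Csum|].
destruct (cos_integrals (a + RtoC (INR N)) s theta Hb hs Hth) as [J [J1 J2]].
(* The left side is the finite sum of the first [N] terms plus the integral [J] belonging to
   [a + N]. *)
assert (ES : s * S1 + RtoC theta * S2 = Csum (fun m => summand s theta (a + RtoC (INR m))) N + J).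
{ apply (Clim_unique (Csum (fun m => summand s theta (a + RtoC (INR m))))).
  - apply Clim_ext with (fun n => s * Csum t1 n + RtoC theta * Csum t2 n).
    + intros n. rewrite <- !Csum_mult, <- Csum_plus. apply Csum_ext. intros k _.
      unfold t1, t2, summand, Cdiv at 1 3. rewrite !Cmult_1_l, Earg. reflexivity.
    + apply Clim_plus; now apply Clim_mult.
  - apply Clim_shift with N.
    apply Clim_ext with (fun n => Csum (fun m => summand s theta (a + RtoC (INR m))) N +
      Csum (fun n => summand s theta (a + RtoC (INR N) + RtoC (INR n))) n).
    + intros n. rewrite Csum_split. f_equal. apply Csum_ext. intros k _. f_equal.
      rewrite plus_INR, RtoC_plus. ring.
    + apply Clim_plus; [apply Clim_const|exact J1]. }
rewrite ES. apply is_series_Csum.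
(* Each split-off term is expanded in powers of [theta]; added to the series of [J], the
   coefficients recombine into [zeta_shift]. *)
assert (F := Clim_Csum_swap
  (fun k m => cos_coeff theta k * ((s - RtoC (INR (2 * k))) * Cpower (a + RtoC (INR m)) (- (s + 1 - RtoC (INR (2 * k))))))
  (fun m => summand s theta (a + RtoC (INR m))) N (fun m _ => summand_expansion s _ theta (Hz m))).
apply Clim_ext with (2 := Clim_plus _ _ _ _ F J2).
intros n. rewrite <- Csum_plus. apply Csum_ext. intros k _.
rewrite (hurwitz_factor_eq s a k N Hb). unfold zeta_shift. rewrite Csum_mult.
fold (cos_coeff theta k).
replace (s + 1 - RtoC (INR (2 * k)) - 1) with (s - RtoC (INR (2 * k))) by ring.
rewrite Csum_mult.
replace (Csum (fun m => Cpower (a + RtoC (INR m)) (- (s + 1 - RtoC (INR (2 * k))))) N)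
  with (Csum (fun m => Cpower (RtoC (INR m) + a) (- (s + 1 - RtoC (INR (2 * k))))) N).
- ring.
- apply Csum_ext. intros m _. f_equal. ring.
Qed.
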